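(* Let $G=SPL_2$. Let $\mathcal Z_i=(z_i,\theta_i)$, $i=1,\dots,N$, be points of $SC^*\setminus\{(\infty,0)\}$ with pairwise distinct bodies, and let $\check\lambda_i=l_i\check\omega$ $(i=1,\dots,N)$ and $\check\lambda_\infty=l_\infty\check\omega$ with $l_i,l_\infty\in\mathbb Z_{\ge 0}$. Let $\tau$ be a non-degenerate $SPL_2$-superoper belonging to $s\mathrm{Op}_{G}(SC^* )_{(\mathcal Z_i),(\infty,0);\check\lambda_i,\check\lambda_\infty}$. Consider the unique Miura superoper structure on $\tau$ for which $\mathcal F_B$ and $\mathcal F_B'$ coincide at $(\infty,0)$, and let $\tilde\nabla$ be the corresponding $H$-connection. Then there are points $\mathcal W_j=(w_j,\xi_j)$, $j=1,\dots,m$, of $SC^*\setminus\{(\infty,0)\}$, whose bodies are pairwise distinct and distinct from those of the $\mathcal Z_i$, such that $$\tilde\nabla=D_\theta-\sum_{i=1}^N\frac{\theta-\theta_i}{z-z_i-\theta\theta_i}\,\check\lambda_i+\sum_{j=1}^m\frac{\theta-\xi_j}{z-w_j-\theta\xi_j}\,\frac{\check\alpha}{2}+\mathrm{nilp}.$$ Moreover, the bodies of the $z_i$ and $w_j$ (denoted by the same letters) satisfy the Bethe ansatz equations $$\sum_{i=1}^N\frac{2l_i}{w_j-z_i}-\sum_{s\neq j}\frac{2}{w_j-w_s}=0,\qquad j=1,\dots,m,$$ and $$\sum_{i=1}^N l_i-m=l_\infty .$$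
   Context: $S$ is a Grassmann algebra, and all objects are over $S$. The body $\bar A$ of an object $A$ is obtained by setting all odd variables (the generators of $S$ and $\theta$) to zero. $SC^*$ is the super Riemann sphere: it has two charts $(z,\theta)$, $(z',\theta')$ with $z'=-1/z$, $\theta'=\theta/z$. Put $D_\theta=\partial_\theta+\theta\partial_z$. Superconformal coordinate changes satisfy $D_\theta=(D_\theta\theta')D_{\theta'}$. $G=SPL_2$ is the supergroup of superconformal automorphisms of $SC^*$, with Lie superalgebra $osp(1|2)$ (also written $osp(2|1)$). $B$ is its Borel subgroup, $N_B=[B,B]$ and $H=B/N_B$, with Lie superalgebras $\mathfrak b$ and $\mathfrak h$. $\alpha$ is the odd simple root, $f$ is the odd generator of the root space of $-\alpha$, $\check\alpha$ is the coroot with $\langle\alpha,\check\alpha\rangle=2$, and $\check\omega=\check\rho=\check\alpha/2$ is the fundamental coweight, with $\langle\alpha,\check\omega\rangle=1$. The Weyl group is $\{1,s\}$, where $s$ is the reflection in the even root $2\alpha$. One has $G/B\cong SC^*$. The body of $G/B$ is $\mathbb P^1$, which is the union of the point orbit and the big cell of the body of $B$. A flat connection on a $G$-bundle is given by an odd operator (''long superderivative'') $\nabla=D_\theta+A_\theta$, with gauge transformations $A_\theta\mapsto gA_\theta g^{-1}-(D_\theta g)g^{-1}$. A $G$-superoper is a triple $(\mathcal F,\mathcal F_B,\nabla)$ consisting of a $G$-bundle, a $B$-reduction and a long superderivative, such that in local trivializations of $\mathcal F_B$ one has $\nabla=D_\theta+a f+\mu$ with $a$ even and invertible and $\mu$ odd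 and $\mathfrak b$-valued. For a coweight $\check\lambda=l\check\omega$ and a point $x$ with local superconformal coordinates $(t,\vartheta)$ vanishing at $x$, $s\mathrm{Op}_G(SD_x)_{\check\lambda}$ is the set of operators $D_\vartheta+a f+\mu$ with $a=t^{l}(r(\vartheta)+t(\cdots))$, $r$ of nonzero body, and $\mu$ an odd $\mathfrak b$-valued function regular at $x$, modulo regular $B$-valued gauge transformations. The set $s\mathrm{Op}_{G}(SC^* )_{(\mathcal Z_i),(\infty,0);\check\lambda_i,\check\lambda_\infty}$ consists of the superopers on $SC^*\setminus\{\mathcal Z_1,\dots,\mathcal Z_N,(\infty,0)\}$ whose restrictions to the formal superdiscs at $\mathcal Z_i$ and $(\infty,0)$ belong to $s\mathrm{Op}_G(SD_{\mathcal Z_i})_{\check\lambda_i}$ and $s\mathrm{Op}_G(SD_{(\infty,0)})_{\check\lambda_\infty}$ respectively. Such a superoper $\tau$ has no monodromy, and $\mathcal F,\mathcal F_B,\nabla$ extend to all of $SC^*$ (with $a$ vanishing to order $l_i$ at $\mathcal Z_i$ and $l_\infty$ at $(\infty,0)$). Flatly trivializing $\mathcal F$ by its fiber at $(\infty,0)$, the reduction $\mathcal F_B$ defines a map $\phi_\tau:SC^*\to G/B$ sending $(\infty,0)$ to the point orbit. $\tau$ is non-degenerate if (i) $\phi_\tau(\mathcal Z_i)$ is in generic position with $B$ (its body lies in the big cell) for all $i$; and (ii) for every $x\in SC^*\setminus\{(\infty,0)\}$ the relative position of $\phi_\tau(x)$ and $B$ is either generic or corresponds to a reflection. A Miura superoper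 structure on $\tau$ is a second $B$-reduction $\mathcal F'_B$ of $\mathcal F$ preserved by $\nabla$. Where $\mathcal F_B$ and $\mathcal F_B'$ are in generic position, their intersection reduces $\mathcal F$ to $H$. In a trivialization of this $H$-reduction, normalized using the $H$-action so that the coefficient of $f$ is $1$, one has $\nabla=\tilde\nabla+f$ with $\tilde\nabla=D_\theta+u(z,\theta)$, $u$ odd and $\mathfrak h$-valued. The operator $\tilde\nabla$ is the $H$-connection of the Miura superoper (on the $H$-bundle $\mathcal F_B/N_B\cong\mathcal D^{-\check\rho}$). Here ''nilp'' denotes any $\mathfrak h$-valued term $g(z,\theta)$ with $\overline{g}=\overline{D_\theta g}=0$. *)

(* Defs.v *)
From HB Require Import structures.
Set Warnings "-notation-overridden,-ambiguous-paths,-deprecated,-redundant-canonical-projection,-projection-no-head-constant".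
From mathcomp Require Import all_boot all_order all_algebra.
From mathcomp Require Import generic_quotient complex.
From mathcomp Require Import boolp reals.

Set Implicit Arguments.
Unset Strict Implicit.
Unset Printing Implicit Defensive.

Import GRing.Theory.

Local Open Scope ring_scope.

Record fps (A : Type) := Fps { fps_coef : nat -> A }.

Section FpsRing.
Variable A : comNzRingType.
Implicit Types p q r : fps A.

HB.instance Definition _ := gen_eqMixin (fps A).
HB.instance Definition _ := gen_choiceMixin (fps A).

Lemma fpsP p q : fps_coef p =1 fps_coef q <-> p = q.
Proof.
split=> [|-> //]; case: p q => [p] [q] /= /funext pq.
by rewrite pq.
Qed.

Definition fps_zero : fps A := Fps (fun=> 0).
Definition fps_opp p : fps A := Fps (fun k => - fps_coef p k).
Definition fps_add p q : fps A := Fps (fun k => fps_coef p k + fps_coef q k).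
Definition fps_one : fps A := Fps (fun k => (k == 0)%:R).
Definition fps_mul p q : fps A :=
  Fps (fun k => \sum_(i < k.+1) fps_coef p i * fps_coef q (k - i)).

Fact fps_addA : associative fps_add.
Proof. by move=> p q r; apply/fpsP => k /=; rewrite addrA. Qed.
Fact fps_addC : commutative fps_add.
Proof. by move=> p q; apply/fpsP => k /=; rewrite addrC. Qed.
Fact fps_add0 : left_id fps_zero fps_add.
Proof. by move=> p; apply/fpsP => k /=; rewrite add0r. Qed.
Fact fps_addN : left_inverse fps_zero fps_opp fps_add.
Proof. by move=> p; apply/fpsP => k /=; rewrite addNr. Qed.

HB.instance Definition _ :=
  GRing.isZmodule.Build (fps A) fps_addA fps_addC fps_add0 fps_addN.

Definition fps_trunc n p : {poly A} := \poly_(i < n) fps_coef p i.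

Lemma coef_fps_mul n p q k : (k < n)%N ->
  fps_coef (fps_mul p q) k = (fps_trunc n p * fps_trunc n q)`_k.
Proof.
move=> kn; rewrite coefM /=; apply: eq_bigr => i _; rewrite !coef_poly.
by rewrite (leq_ltn_trans _ kn) ?(leq_ltn_trans (leq_subr _ _) kn) -1?ltnS.
Qed.

Fact fps_mulA : associative fps_mul.
Proof.
move=> p q r; apply/fpsP => k.
rewrite !(@coef_fps_mul k.+1) //.
transitivity ((fps_trunc k.+1 p * fps_trunc k.+1 q * fps_trunc k.+1 r)`_k).
  rewrite -mulrA !coefM; apply: eq_bigr => i _; congr (_ * _).
  have ki : (k - i < k.+1)%N by rewrite ltnS leq_subr.
  by rewrite coef_poly ki (coef_fps_mul _ _ ki).
rewrite !coefM; apply: eq_bigr => i _; congr (_ * _).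
by rewrite [RHS]coef_poly ltn_ord (coef_fps_mul _ _ (ltn_ord i)).
Qed.

Fact fps_mulC : commutative fps_mul.
Proof.
move=> p q; apply/fpsP => k.
by rewrite !(@coef_fps_mul k.+1) // mulrC.
Qed.

Fact fps_mul1 : left_id fps_one fps_mul.
Proof.
move=> p; apply/fpsP => k /=.
rewrite big_ord_recl /= mul1r subn0 big1 ?addr0 // => i _.
by rewrite /bump /= mul0r.
Qed.

Fact fps_mulDl : left_distributive fps_mul +%R.
Proof.
move=> p q r; apply/fpsP => k /=; rewrite -big_split /=.
by apply: eq_bigr => i _; rewrite mulrDl.
Qed.

Fact fps_one_neq0 : fps_one != 0.
Proof.
by apply/eqP => /fpsP /(_ 0) /= /eqP; rewrite oner_eq0.
Qed.

HB.instance Definition _ := GRing.Zmodule_isComNzRing.Build (fps A)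
  fps_mulA fps_mulC fps_mul1 fps_mulDl fps_one_neq0.

Definition fps_unit : {pred fps A} := fun p => `[< exists q, q * p = 1 >].
Definition fps_inv p : fps A :=
  if pselect (exists q, q * p = 1) is left e then sval (cid e) else p.

Fact fps_mulV : {in fps_unit, left_inverse 1 fps_inv *%R}.
Proof.
move=> p /asboolP e; rewrite /fps_inv; case: pselect => // e'.
exact: (svalP (cid e')).
Qed.

Fact fps_unitPl p q : q * p = 1 -> fps_unit p.
Proof. by move=> e; apply/asboolP; exists q. Qed.

Fact fps_inv_out : {in [predC fps_unit], fps_inv =1 id}.
Proof.
by move=> p /asboolP e; rewrite /fps_inv; case: pselect.
Qed.

HB.instance Definition _ := GRing.ComNzRing_hasMulInverse.Build (fps A)
  fps_mulV fps_unitPl fps_inv_out.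

Definition fps_X : fps A := Fps (fun k => (k == 1)%:R).
Definition fps_const (a : A) : fps A := Fps (fun k => if k == 0 then a else 0).
Definition fps_deriv p : fps A := Fps (fun k => fps_coef p k.+1 *+ k.+1).

End FpsRing.

Section FpsIdomain.
Variable A : idomainType.

Fact fps_integral (p q : fps A) : p * q = 0 -> (p == 0) || (q == 0).
Proof.
move=> pq0; apply/norP => -[p0 q0].
have nz (r : fps A) : r != 0 -> exists k, fps_coef r k != 0.
  move=> r0; apply: contrapT => h; move/eqP: r0; apply; apply/fpsP => k /=.
  by apply/eqP/negPn/negP => rk; apply: h; exists k.
have [i pi mini] := ex_minnP (nz p p0).
have [j qj minj] := ex_minnP (nz q q0).
have /fpsP /(_ (i + j)%N) /= := pq0.
have ii : (i < (i + j).+1)%N by rewrite ltnS leq_addr.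
rewrite (bigD1 (Ordinal ii)) //= addKn big1 ?addr0 => [/eqP|k].
  by rewrite mulf_eq0 (negbTE pi) (negbTE qj).
rewrite -val_eqE /= neq_ltn => /orP[ki|ik].
  suff /eqP -> : fps_coef p k == 0 by rewrite mul0r.
  by apply/negPn/negP => /mini; rewrite leqNgt ki.
suff /eqP -> : fps_coef q (i + j - k) == 0 by rewrite mulr0.
apply/negPn/negP => /minj; rewrite leqNgt ltn_subLR ?ltn_add2r ?ik //.
by rewrite -ltnS.
Qed.

HB.instance Definition _ :=
  GRing.ComUnitRing_isIntegral.Build (fps A) fps_integral.
End FpsIdomain.

(* The Grassmann algebra over A on n odd generators: F is the element
   \sum_I F I eta_I, where eta_I is the product of the generators of index in I,
   in increasing order. *)

Definition grassmann (n : nat) (A : Type) := {ffun {set 'I_n} -> A}.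

Section Grassmann.
Variables (n : nat) (A : comNzRingType).
Implicit Types (F G H : grassmann n A) (I J K L : {set 'I_n}).

HB.instance Definition _ :=
  GRing.Zmodule.copy (grassmann n A) {ffun {set 'I_n} -> A}.

(* eta_I eta_J = (-1)^(ginversions I J) eta_(I :|: J) for I, J disjoint *)
Definition ginversions I J : nat := \sum_(i in I) \sum_(j in J) (j < i)%N.
Definition gsign I J : A := (-1) ^+ ginversions I J.

Lemma sum_setU (I J : {set 'I_n}) (f : 'I_n -> nat) : [disjoint I & J] ->
  \sum_(i in I :|: J) f i = (\sum_(i in I) f i + \sum_(i in J) f i)%N.
Proof.
by move=> IJ; rewrite -bigU //; apply: eq_bigl => i; rewrite !inE.
Qed.

Lemma gsignUl I J K : [disjoint I & J] ->
  gsign (I :|: J) K = gsign I K * gsign J K.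
Proof. by move=> IJ; rewrite /gsign /ginversions sum_setU // exprD. Qed.

Lemma gsignUr I J K : [disjoint J & K] ->
  gsign I (J :|: K) = gsign I J * gsign I K.
Proof.
move=> JK; rewrite /gsign /ginversions -exprD -big_split /=; congr (_ ^+ _).
by apply: eq_bigr => i _; rewrite sum_setU.
Qed.

Definition gone : grassmann n A := [ffun I => (I == set0)%:R].
Definition gmul F G : grassmann n A :=
  [ffun K : {set 'I_n} => \sum_(I : {set 'I_n} | I \subset K) gsign I (K :\: I) * (F I * G (K :\: I))].

Fact gmulA : associative gmul.
Proof.
move=> F G H; apply/ffunP => K; rewrite !ffunE.
transitivity (\sum_(I : {set 'I_n} | I \subset K) \sum_(J : {set 'I_n} | J \subset K :\: I)
   gsign I (K :\: I) * gsign J (K :\: I :\: J) *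
   (F I * G J * H (K :\: I :\: J))).
  apply: eq_bigr => I IK; rewrite ffunE !mulr_sumr; apply: eq_bigr => J _.
  by rewrite -!mulrA; congr (_ * _); rewrite mulrCA.
under [RHS]eq_bigr => L _ do rewrite ffunE mulr_suml mulr_sumr.
rewrite [RHS](exchange_big_dep (fun I => I \subset K)) /=; last first.
  by move=> L I LK /subset_trans; apply.
apply: eq_bigr => I IK.
rewrite [RHS](reindex_onto (fun J => I :|: J) (fun L => L :\: I)) /=; last first.
  by move=> L /andP[_ IL]; apply/setP => x; rewrite !inE; case xI: (x \in I) => //=; rewrite (subsetP IL).
apply: eq_big => [J|J].
  rewrite subsetUl subUset IK andbT /= subsetD setDUl setDv set0U.
  by congr (_ && _); apply/setDidPl/eqP.
rewrite subsetD => /andP[JK JI].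
have IJ : [disjoint I & J] by rewrite disjoint_sym.
have -> : (I :|: J) :\: I = J by rewrite setDUl setDv set0U; apply/setDidPl.
rewrite setDDl.
have -> : K :\: I = J :|: (K :\: (I :|: J)).
  apply/setP => x; rewrite !inE; case xJ: (x \in J) => /=.
    by rewrite (subsetP JK) // andbT (disjointFr JI).
  by rewrite orbF.
have dJ : [disjoint J & K :\: (I :|: J)].
  by rewrite -setI_eq0; apply/eqP/setP => x; rewrite !inE; case: (x \in J); rewrite ?orbT.
rewrite gsignUr // gsignUl // -!mulrA.
by rewrite [X in _ = _ * X]mulrCA [RHS]mulrCA.
Qed.

Fact gmul1 : left_id gone gmul.
Proof.
move=> F; apply/ffunP => K; rewrite ffunE (bigD1 set0) ?sub0set //=.
rewrite big1 ?addr0 => [|I /andP[_ /negbTE I0]]; last first.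
  by rewrite ffunE I0 mul0r mulr0.
by rewrite ffunE eqxx setD0 /gsign /ginversions big_set0 !mul1r.
Qed.

Fact gmulr1 : right_id gone gmul.
Proof.
move=> F; apply/ffunP => K; rewrite ffunE (bigD1 K) //=.
rewrite big1 ?addr0 => [|I /andP[IK nI]]; last first.
  rewrite ffunE setD_eq0; case: (boolP (K \subset I)) => [KI|_]; rewrite ?mulr0 //.
  by case/eqP: nI; apply/eqP; rewrite eqEsubset IK.
rewrite ffunE setDv eqxx mulr1 /gsign /ginversions.
by rewrite big1 ?expr0 ?mul1r // => i _; rewrite big_set0.
Qed.

Fact gmulDl : left_distributive gmul +%R.
Proof.
move=> F G H; apply/ffunP => K; rewrite !ffunE -big_split /=.
by apply: eq_bigr => I _; rewrite ffunE mulrDl mulrDr.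
Qed.

Fact gmulDr : right_distributive gmul +%R.
Proof.
move=> F G H; apply/ffunP => K; rewrite !ffunE -big_split /=.
by apply: eq_bigr => I _; rewrite ffunE !mulrDr.
Qed.

Fact gone_neq0 : gone != 0.
Proof.
by apply/eqP => /ffunP /(_ set0); rewrite !ffunE eqxx => /eqP; rewrite oner_eq0.
Qed.

HB.instance Definition _ := GRing.Zmodule_isNzRing.Build (grassmann n A)
  gmulA gmul1 gmulr1 gmulDl gmulDr gone_neq0.

Definition gunit : {pred grassmann n A} :=
  fun F => `[< exists G, G * F = 1 /\ F * G = 1 >].
Definition ginverse F : grassmann n A :=
  if pselect (exists G, G * F = 1 /\ F * G = 1) is left e then sval (cid e)
  else F.

Fact gmulV : {in gunit, left_inverse 1 ginverse *%R}.
Proof.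
move=> F /asboolP e; rewrite /ginverse; case: pselect => // e'.
by case: (svalP (cid e')).
Qed.

Fact gdivv : {in gunit, right_inverse 1 ginverse *%R}.
Proof.
move=> F /asboolP e; rewrite /ginverse; case: pselect => // e'.
by case: (svalP (cid e')).
Qed.

Fact gunitP F G : G * F = 1 /\ F * G = 1 -> gunit F.
Proof. by move=> e; apply/asboolP; exists G. Qed.

Fact ginverse_out : {in [predC gunit], ginverse =1 id}.
Proof. by move=> F /asboolP e; rewrite /ginverse; case: pselect. Qed.

HB.instance Definition _ := GRing.NzRing_hasMulInverse.Build (grassmann n A)
  gmulV gdivv gunitP ginverse_out.

Definition gscalar (a : A) : grassmann n A :=
  [ffun I => if I == set0 then a else 0].
Definition ggen (i : 'I_n) : grassmann n A := [ffun I => (I == [set i])%:R].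
Definition gbody F : A := F set0.

(* homogeneous of parity b; 0 has both parities *)
Definition gparity (b : bool) F : Prop := forall I, F I != 0 -> odd #|I| = b.

End Grassmann.

(* Superfields: grassmann n.+1 A.  The generator ord0 is theta, the generator
   lift ord0 i is the i-th generator of the ground algebra
   S = grassmann n K. *)

Section Superfield.
Variables (n : nat) (A : comNzRingType).
Implicit Types F : grassmann n.+1 A.

Definition theta : grassmann n.+1 A := ggen A ord0.

Definition embS (K : Type) (iota : K -> A) (s : grassmann n K) :
    grassmann n.+1 A :=
  [ffun I : {set 'I_n.+1} => if ord0 \in I then 0 else iota (s (lift ord0 @^-1: I))].

(* left derivative; no sign occurs because theta comes first in eta_I *)
Definition d_theta F : grassmann n.+1 A :=
  [ffun I : {set 'I_n.+1} => if ord0 \in I then 0 else F (ord0 |: I)].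

(* d is the derivation of A extending d/dz; the result is
   (d_theta + theta d_z) F *)
Definition Dtheta (d : A -> A) F : grassmann n.+1 A :=
  d_theta F + theta * [ffun I => d (F I)].

End Superfield.

Arguments theta {n A}.

(* SPL_2 as the supergroup of even (2|1) x (2|1) supermatrices with
   Berezinian 1 preserving an even form which is symplectic on the even part.
   The basis is (e1, e2 | e3), and matrices act on columns on the left and
   multiply as ordinary matrices over the Grassmann algebra. *)

Definition i1 : 'I_3 := @Ordinal 3 0 isT.
Definition i2 : 'I_3 := @Ordinal 3 1 isT.
Definition i3 : 'I_3 := @Ordinal 3 2 isT.
Definition spar (i : 'I_3) : bool := i == i3.

Section SPL2.
Variables (n : nat) (A : comNzRingType).
Local Notation smx := ('M[grassmann n A]_3).
Implicit Types M b g : smx.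

Definition smx_even M : Prop :=
  forall i j, gparity (spar i (+) spar j) (M i j).

Definition supertr M : smx :=
  \matrix_(j, i) ((-1) ^+ (spar i && ~~ spar j) * M i j).

Definition osp_form : smx :=
  delta_mx i1 i2 - delta_mx i2 i1 - delta_mx i3 i3.

(* the Berezinian det(P - Q D^-1 R) D^-1 of the block matrix (P Q; R D) *)
Definition berezinian M : grassmann n A :=
  let p i j := M i j - M i i3 * (M i3 i3)^-1 * M i3 j in
  (p i1 i1 * p i2 i2 - p i1 i2 * p i2 i1) * (M i3 i3)^-1.

Definition in_SPL2 M : Prop :=
  [/\ smx_even M, supertr M *m osp_form *m M = osp_form & berezinian M = 1].

(* the inverse of an element of SPL_2; the transpose of osp_form is its
   inverse *)
Definition spl2_inv M : smx := osp_form^T *m supertr M *m osp_form.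

(* the stabilizer of the line spanned by e1 *)
Definition in_B M : Prop := [/\ in_SPL2 M, M i2 i1 = 0 & M i3 i1 = 0].

(* representative of the reflection s *)
Definition weyl_s : smx :=
  delta_mx i1 i2 - delta_mx i2 i1 + delta_mx i3 i3.

(* A basis of osp(1|2).  Here [coweight, osp_f] = - osp_f and
   [coweight, osp_e] = osp_e, so <alpha, coweight> = 1, and coweight is the
   differential of the cocharacter diag(h, h^-1, 1).  Hence
   coweight = check omega = check alpha / 2.  The roots 2 alpha and - 2 alpha
   have root vectors osp_e2 = - osp_e ^ 2 and osp_f ^ 2. *)
Definition osp_f : smx := delta_mx i3 i1 + delta_mx i2 i3.
Definition osp_e : smx := delta_mx i1 i3 - delta_mx i3 i2.
Definition osp_e2 : smx := delta_mx i1 i2.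
Definition coweight : smx := delta_mx i1 i1 - delta_mx i2 i2.

(* odd elements of b, with coefficients satisfying reg.  An element r T of
   the tensor product of the Grassmann algebra with osp(1|2) is the supermatrix
   with entries (-1)^(|i| |r|) r T_ij; the sign is trivial for all the terms
   below. *)
Definition odd_borel (reg : grassmann n A -> Prop) M : Prop :=
  exists c u v : grassmann n A,
    [/\ gparity false c, gparity true u & gparity true v] /\
    [/\ reg c, reg u, reg v &
        M = u *: coweight + c *: osp_e + v *: osp_e2].

End SPL2.

Arguments osp_f {n A}.
Arguments coweight {n A}.
Arguments weyl_s {n A}.

Section Gauge.
Variables (n : nat) (A : comNzRingType) (d : A -> A).
Local Notation smx := ('M[grassmann n.+1 A]_3).

(* The odd operator D_theta on columns of superfields is D_theta (x_i e_i) =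
   (-1)^|i| (D_theta x_i) e_i, since x_i stands to the right of e_i.  With this
   sign D(g M) = (D g) M + g (D M) for g even. *)
Definition smxD (M : smx) : smx :=
  \matrix_(i, j) ((-1) ^+ spar i * Dtheta d (M i j)).

Definition gauge (g M : smx) : smx :=
  g *m M *m spl2_inv g - smxD g *m spl2_inv g.

End Gauge.

Definition frac_deriv (R : idomainType) (d : R -> R) (x : {fraction R}) :
    {fraction R} :=
  let p := (frac (repr x)).1 in let q := (frac (repr x)).2 in
  tofrac (d p * q - p * d q) / tofrac (q ^+ 2).

Notation ratfun K := {fraction {poly K}}.
Notation laurent K := {fraction (fps K)}.
Notation superfun K n := (grassmann n.+1 (ratfun K)).

Section SuperSphere.
Variables (K : fieldType) (n : nat).

(* In the algebraic category superfunctions of (z, theta) with coefficients in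
   S have coefficients in K(z), and superfunctions on a punctured formal
   superdisc have coefficients in K((t)). *)
Local Notation S := (grassmann n K).
Local Notation sfun := (superfun K n).
Local Notation dfun := (grassmann n.+1 (laurent K)).

Definition Dz : ratfun K -> ratfun K := frac_deriv (fun p => p^`()).
Definition Dt : laurent K -> laurent K := frac_deriv (@fps_deriv K).

Definition ratC (a : K) : ratfun K := tofrac a%:P.
Definition laurC (a : K) : laurent K := tofrac (fps_const a).
Definition laurT : laurent K := tofrac (fps_X K).

Definition zfun : sfun := gscalar n.+1 (tofrac 'X).

(* A point of SC^* other than (oo, 0), with coordinates in the chart
   (z, theta). *)
Record superpoint := SuperPoint {
  sp_z : S;
  sp_theta : S;
  sp_z_even : gparity false sp_z;
  sp_theta_odd : gparity true sp_theta }.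

Definition sp_body (P : superpoint) : K := gbody (sp_z P).

(* z - z_P - theta theta_P and (theta - theta_P) / (z - z_P - theta theta_P) *)
Definition sdist (P : superpoint) : sfun :=
  zfun - embS ratC (sp_z P) - theta * embS ratC (sp_theta P).
Definition superpole (P : superpoint) : sfun :=
  (theta - embS ratC (sp_theta P)) / sdist P.

(* regular functions near the body point x of the chart z, and on the open
   complement of the finite set s *)
Definition rat_regular (x : K) (f : ratfun K) : Prop :=
  exists p q : {poly K}, q.[x] != 0 /\ f = tofrac p / tofrac q.
Definition regular_at (x : K) (F : sfun) : Prop :=
  forall I, rat_regular x (F I).
Definition regular_on (s : seq K) (F : sfun) : Prop :=
  forall x, x \notin s -> regular_at x F.

(* Restriction to the punctured formal superdisc at a body point of P^1, None
   being oo.  At Some x the variables of dfun are t = z - x and theta.  For a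
   point P with body x, sdist P and theta - theta_P are superconformal
   coordinates vanishing at P; they differ from (z - x, theta) by nilpotents and
   define the same ring S[[t]][theta] and the same operator D_theta.  At None the
   variables are z' = - 1 / z and theta' = theta / z, that is, z = - 1 / z' and
   theta = - theta' / z'. *)
Definition z_at (x : option K) : laurent K :=
  if x is Some c then laurC c + laurT else - laurT^-1.
Definition theta_at (x : option K) : laurent K :=
  if x is Some _ then 1 else - laurT^-1.

Definition rat_at (x : option K) (f : ratfun K) : laurent K :=
  (map_poly laurC (frac (repr f)).1).[z_at x] /
  (map_poly laurC (frac (repr f)).2).[z_at x].

Definition res (x : option K) (F : sfun) : dfun :=
  [ffun I : {set 'I_n.+1} => rat_at x (F I) * theta_at x ^+ (ord0 \in I)].

(* A = A_theta transforms with D_theta = (D_theta theta') D_theta', and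
   1 / (D_theta theta') = z at oo. *)
Definition res_conn (x : option K) (M : 'M[sfun]_3) : 'M[dfun]_3 :=
  gscalar n.+1 (theta_at x) *: map_mx (res x) M.

Definition disc_regular (F : dfun) : Prop :=
  forall I, exists p : fps K, F I = tofrac p.

(* constant term of an element of K[[t]] *)
Definition laur_coef0 (f : laurent K) : K :=
  if pselect (exists p : fps K, f = tofrac p) is left e
  then fps_coef (sval (cid e)) 0 else 0.

(* the value, in S, of a regular F at (t, theta) = (0, 0) *)
Definition disc_value (F : dfun) : S :=
  [ffun I : {set 'I_n} => laur_coef0 (F (lift ord0 @: I))].
Definition disc_body (F : dfun) : K := laur_coef0 (gbody F).

Definition mx_all (A : Type) (P : A -> Prop) (M : 'M[A]_3) : Prop :=
  forall i j, P (M i j).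

(* Operators D + a f + mu on the superdisc with a = t^l (r(theta) + t (...)),
   where the body of r is nonzero and mu is regular; t is the superconformal
   coordinate. *)
Definition disc_oper (t : dfun) (l : nat) (M : 'M[dfun]_3) : Prop :=
  exists (a r : dfun) (mu : 'M[dfun]_3),
    [/\ gparity false a, a = t ^+ l * r, disc_regular r & disc_body r != 0] /\
    [/\ odd_borel disc_regular mu & M = a *: osp_f + mu].

Section MarkedSphere.
Variables (N : nat) (Z : 'I_N -> superpoint).

(* A superoper (F, F_B, nabla) on SC^* minus the Z_i and (oo, 0), given by a
   Zariski trivialization of F_B.  Chart j is the complement of the finite set
   cut j in the affine z-line; glue j k maps coordinates in the frame k to
   coordinates in the frame j; and F is induced from F_B. *)
Record superoper := Superoper {
  chart : Type;
  cut : chart -> seq K;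
  cut_marked : forall j i, sp_body (Z i) \in cut j;
  cut_cover : forall x, (forall i, x != sp_body (Z i)) ->
    exists j, x \notin cut j;
  glue : chart -> chart -> 'M[sfun]_3;
  glue_B : forall j k, in_B (glue j k);
  glue_regular : forall j k, mx_all (regular_on (cut j ++ cut k)) (glue j k);
  glue_cocycle : forall j k m, glue j k *m glue k m = glue j m;
  conn : chart -> 'M[sfun]_3;
  conn_glue : forall j k, conn j = gauge Dz (glue j k) (conn k);
  conn_oper : forall j, exists (a : sfun) (mu : 'M[sfun]_3),
    [/\ gparity false a, regular_on (cut j) a & exists2 a' : sfun,
         regular_on (cut j) a' & a * a' = 1] /\
    [/\ odd_borel (regular_on (cut j)) mu & conn j = a *: osp_f + mu] }.

Variables (l : 'I_N -> nat) (loo : nat).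

(* The punctures are indexed by option 'I_N, with None for (oo, 0). *)
Definition place (p : option 'I_N) : option K :=
  if p is Some i then Some (sp_body (Z i)) else None.
Definition weight (p : option 'I_N) : nat := if p is Some i then l i else loo.
Definition local_coord (p : option 'I_N) : dfun :=
  if p is Some i then res (place p) (sdist (Z i)) else gscalar n.+1 laurT.

(* The superopers whose restriction to the formal superdisc at each puncture p
   is of coweight (weight p).  The B-valued gauge transformation frame p j of the
   punctured disc takes the restriction of conn j to the required form; the
   frames at p glue F and F_B on the disc to F and F_B on the charts, so they
   also give the extension of (F, F_B, nabla) to SC^*. *)
Record sOp := SOp {
  sOp_oper :> superoper;
  frame : option 'I_N -> chart sOp_oper -> 'M[dfun]_3;
  frame_B : forall p j, in_B (frame p j);
  frame_glue : forall p j k,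
    frame p j *m map_mx (res (place p)) (glue j k) = frame p k;
  frame_oper : forall p j, disc_oper (local_coord p) (weight p)
    (gauge Dt (frame p j) (res_conn (place p) (conn j))) }.

Variable tau : sOp.

(* A flat trivialization of F over SC^*, inducing on the fiber at (oo, 0) the
   trivialization given by frame None.  It is unique, and it exists because
   superopers in sOp have no monodromy. *)
Definition flat_triv (Phi : chart tau -> 'M[sfun]_3) : Prop :=
  [/\ forall j, in_SPL2 (Phi j) /\ mx_all (regular_on (cut j)) (Phi j),
      forall j k, Phi j *m glue j k = Phi k,
      forall j, gauge Dz (Phi j) (conn j) = 0,
      forall p j, mx_all disc_regular
        (map_mx (res (place p)) (Phi j) *m spl2_inv (frame p j)) &
      forall j, map_mx disc_value
        (map_mx (res None) (Phi j) *m spl2_inv (frame None j)) = 1%:M].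

(* The map phi_tau is the class of Phi j in G/B on the chart j, and the class of
   Phi j (frame p j)^-1 at the puncture p.  These are the bodies of the
   representatives. *)
Definition phi_chart (Phi : chart tau -> 'M[sfun]_3) j (x : K) : 'M[K]_3 :=
  map_mx (fun F => disc_body (res (Some x) F)) (Phi j).
Definition phi_puncture (Phi : chart tau -> 'M[sfun]_3) j p : 'M[K]_3 :=
  map_mx disc_body (map_mx (res (place p)) (Phi j) *m spl2_inv (frame p j)).

(* The body of m B in P^1 is [m_11 : m_21].  The B-orbits are the big cell
   (generic position) and the point orbit; the latter is the relative position
   given by the reflection s.  So condition (ii), the last two clauses of
   nondegenerate_superoper, holds automatically for SPL_2. *)
Definition generic_pos (m : 'M[K]_3) : Prop := m i2 i1 != 0.
Definition reflection_pos (m : 'M[K]_3) : Prop := m i2 i1 = 0.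

Definition nondegenerate_superoper : Prop :=
  exists2 Phi : chart tau -> 'M[sfun]_3, flat_triv Phi &
    [/\ forall i j, generic_pos (phi_puncture Phi j (Some i)),
        forall i j, generic_pos (phi_puncture Phi j (Some i)) \/
                    reflection_pos (phi_puncture Phi j (Some i)) &
        forall j x, x \notin cut j ->
          generic_pos (phi_chart Phi j x) \/ reflection_pos (phi_chart Phi j x)].

(* A second B-reduction F'_B of F preserved by nabla.  On the chart j it is the
   section P j B of F / B; it is regular at a point when P j b is regular there
   for some rational B-valued b. *)
Definition miura (P : chart tau -> 'M[sfun]_3) : Prop :=
  [/\ forall j, in_SPL2 (P j),
      forall j k, exists2 b, in_B b & glue j k *m P k = P j *m b,
      forall j x, x \notin cut j ->
        exists2 b, in_B b & mx_all (regular_at x) (P j *m b),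
      forall p j, exists2 b, in_B b &
        mx_all disc_regular
          (frame p j *m map_mx (res (place p)) (P j) *m b) &
      forall j, odd_borel (fun=> True) (gauge Dz (spl2_inv (P j)) (conn j))].

Definition coincide_at_oo (P : chart tau -> 'M[sfun]_3) : Prop :=
  forall j, exists2 b, in_B b &
    let M := frame None j *m map_mx (res None) (P j) *m b in
    mx_all disc_regular M /\ in_B (map_mx disc_value M).

Definition same_reduction (P P' : chart tau -> 'M[sfun]_3) : Prop :=
  forall j, exists2 b, in_B b & P' j = P j *m b.

(* D_theta + U is the H-connection of the Miura superoper P.  A frame of F_B is
   a frame of the H-reduction when F'_B is opposite, that is, equal to s B, in it;
   the frame is normalized when the coefficient of f is 1. *)
Definition H_connection (P : chart tau -> 'M[sfun]_3) (U : 'M[sfun]_3) : Prop :=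
  (exists2 u, gparity true u & U = u *: coweight) /\
  forall j, exists b b', [/\ in_B b, in_B b',
    b *m P j *m b' = weyl_s & gauge Dz b (conn j) = osp_f + U].

End MarkedSphere.

Definition nilp_term (g : sfun) : Prop := gbody g = 0 /\ gbody (Dtheta Dz g) = 0.

End SuperSphere.

(* Main.v *)
(* In a flat trivialization Phi of F, a B-reduction preserved by nabla is constant,
   hence determined by its value at (oo, 0); this gives the Miura structure and its
   uniqueness.  Let (x, y, xi) be the first column of Phi, chi = xi / y and
   w = - D chi.  Since D (x / y) = chi w, there is an explicit frame in which
   nabla = D + f + u check omega, with u = - D w / w.

   On bodies w = a / y, where a is the coefficient of f, and the equation
   D (x / y) = chi w becomes (x / y)' = - (a / y)^2.  For P = prod_i (z - z_i)^(l_i),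
   the functions V = P x / a and Q = P y / a are regular at every point of the affine
   line, so they are polynomials, with V Q' - V' Q = P^2.  Non-degeneracy at Z_i says
   Q(z_i) <> 0.  Hence the zeros w_j of Q are simple, and comparing the Wronskian
   equation with its derivative at w_j gives the Bethe equations.  The local form at
   (oo, 0) gives deg V = deg P + l_oo + 1 > deg Q, and then the degree of the
   Wronskian gives deg P - deg Q = l_oo.  Since nilpotent terms are absorbed in nilp,
   the points W_j can be taken to be (w_j, 0). *)
Require Import Defs.
From HB Require Import structures.
Set Warnings "-notation-overridden,-ambiguous-paths,-redundant-canonical-projection".
Set Implicit Arguments.
Unset Strict Implicit.
Unset Printing Implicit Defensive.
From mathcomp Require Import all_boot all_order all_algebra.
From mathcomp Require Import complex reals.
From mathcomp Require Import generic_quotient boolp.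
From mathcomp Require Import ring.

Import GRing.Theory.
Local Open Scope ring_scope.

(** * Grassmann algebras *)

Section GrassmannTheory.
Context {n : nat} {A : comNzRingType}.
Implicit Types (F G : grassmann n A) (I J K : {set 'I_n}).

(** The conclusion sees only two components of an odd superfield, its body and its theta
    coefficient: a nilp term is one on which both vanish. The operator D exchanges them: the body of
    D F is the theta coefficient of F, and the theta coefficient of D F is the derivative of the
    body of F. So an equation in D becomes an ordinary differential equation once the right
    component is taken. The obstacle before that is algebraic. Entries of supermatrices do not
    commute, so the group laws of SPL_2 and the normalized frame are verified by tracking parities,
    and inverses exist because elements of body 0 are nilpotent. The quotients x / a and y / a are
    the functions that globalize: a change of frame in B multiplies x, y and a by the same entry on
    bodies. The zero of order l_i of a at Z_i then gives a pole of order at most l_i, which P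
    clears. At (oo, 0) the change of D_theta contributes one more factor z, which is the source of
    the 1 in l_oo + 1. *)

Lemma gmulE F G K :
  (F * G) K = \sum_(I : {set 'I_n} | I \subset K)
                gsign A I (K :\: I) * (F I * G (K :\: I)).
Proof. by rewrite /GRing.mul /= ffunE. Qed.

Lemma gaddE F G K : (F + G) K = F K + G K.
Proof. by rewrite ffunE. Qed.

Lemma goppE F K : (- F) K = - F K.
Proof. by rewrite ffunE. Qed.

Lemma goneE K : (1 : grassmann n A) K = (K == set0)%:R.
Proof. by rewrite /GRing.one /= ffunE. Qed.

Lemma gzeroE K : (0 : grassmann n A) K = 0.
Proof. by rewrite ffunE. Qed.

Lemma gsign0l J : gsign A set0 J = 1.
Proof. by rewrite /gsign /ginversions big_set0. Qed.

Lemma gsign0r J : gsign A J set0 = 1.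
Proof.
by rewrite /gsign /ginversions big1 ?expr0 // => i _; rewrite big_set0.
Qed.

Lemma gbodyM F G : gbody (F * G) = gbody F * gbody G.
Proof.
rewrite /gbody gmulE (bigD1 set0) ?sub0set //= set0D gsign0l mul1r.
by rewrite big1 ?addr0 // => I; rewrite subset0 => /andP[/eqP-> /eqP].
Qed.

Lemma gbody_is_zmod_morphism : zmod_morphism (@gbody n A).
Proof. by move=> F G; rewrite /gbody gaddE goppE. Qed.

Lemma gbody_is_monoid_morphism : monoid_morphism (@gbody n A).
Proof. by split=> [|F G]; [rewrite /gbody goneE eqxx | apply: gbodyM]. Qed.

HB.instance Definition _ :=
  GRing.isZmodMorphism.Build (grassmann n A) A (@gbody n A)
    gbody_is_zmod_morphism.
HB.instance Definition _ :=
  GRing.isMonoidMorphism.Build (grassmann n A) A (@gbody n A)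
    gbody_is_monoid_morphism.

Lemma gbodyD F G : gbody (F + G) = gbody F + gbody G.
Proof. exact: gaddE. Qed.

Lemma gbodyN F : gbody (- F) = - gbody F.
Proof. exact: goppE. Qed.

Lemma gbody1 : gbody (1 : grassmann n A) = 1.
Proof. by rewrite /gbody goneE eqxx. Qed.

(** For i = [ord0] this is the coefficient of theta with the odd constants set to 0. It satisfies a
    Leibniz rule over [gbody], without sign, because only the empty set and [set i] lie below
    [set i]. *)
Definition gcoef (i : 'I_n) F : A := F [set i].

Lemma gcoefM i F G :
  gcoef i (F * G) = gbody F * gcoef i G + gcoef i F * gbody G.
Proof.
rewrite /gbody /gcoef gmulE (bigD1 set0) ?sub0set //= setD0 gsign0l mul1r.
congr (_ + _); rewrite (bigD1 [set i]) /=; last first.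
  by rewrite subxx; apply/set0Pn; exists i; rewrite inE.
rewrite setDv gsign0r mul1r big1 ?addr0 // => I.
by rewrite subset1 => /andP[/andP[/orP[/eqP->|/eqP->]]]; rewrite eqxx.
Qed.

Lemma gcoef_is_zmod_morphism i : zmod_morphism (gcoef i).
Proof. by move=> F G; rewrite /gcoef gaddE goppE. Qed.

HB.instance Definition _ i :=
  GRing.isZmodMorphism.Build (grassmann n A) A (gcoef i)
    (gcoef_is_zmod_morphism i).

Lemma gparity0 b : gparity b (0 : grassmann n A).
Proof. by move=> I; rewrite gzeroE eqxx. Qed.

Lemma gparity1 : gparity false (1 : grassmann n A).
Proof.
move=> I; rewrite goneE; case: (I =P set0) => [->|]; first by rewrite cards0.
by rewrite eqxx.
Qed.

Lemma gparityD b F G : gparity b F -> gparity b G -> gparity b (F + G).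
Proof.
move=> pF pG I; rewrite gaddE; have [F0|/pF //] := eqVneq (F I) 0.
by rewrite F0 add0r => /pG.
Qed.

Lemma gparityN b F : gparity b F -> gparity b (- F).
Proof. by move=> pF I; rewrite goppE oppr_eq0 => /pF. Qed.

Lemma gparityB b F G : gparity b F -> gparity b G -> gparity b (F - G).
Proof. by move=> pF pG; apply: gparityD => //; apply: gparityN. Qed.

Lemma gparity_sum b (T : Type) (r : seq T) (P : pred T)
    (f : T -> grassmann n A) :
  (forall i, P i -> gparity b (f i)) -> gparity b (\sum_(i <- r | P i) f i).
Proof. by move=> pf; elim/big_ind: _ => //; [apply: gparity0|apply: gparityD]. Qed.

Lemma gparityM b c F G :
  gparity b F -> gparity c G -> gparity (b (+) c) (F * G).
Proof.
move=> pF pG K; rewrite gmulE => nz; apply: contrapT => K_odd.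
move/eqP: nz; apply; rewrite big1 // => I IK.
have [->|/pF FI] := eqVneq (F I) 0; first by rewrite mul0r mulr0.
have [->|/pG GI] := eqVneq (G (K :\: I)) 0; first by rewrite !mulr0.
by case: K_odd; rewrite -FI -GI -oddD -(cardsID I K) (setIidPr IK).
Qed.

(** Each pair (i, j) is an inversion in exactly one of the two orders, since disjointness rules out
    i = j. *)
Lemma ginversionsC I J : [disjoint I & J] ->
  (ginversions I J + ginversions J I = #|I| * #|J|)%N.
Proof.
move=> IJ; rewrite /ginversions [X in (_ + X)%N]exchange_big /= -big_split /=.
rewrite -sum_nat_const; apply: eq_bigr => i iI.
rewrite -big_split /= -sum1_card; apply: eq_bigr => j jJ.
by case: ltngtP => // /val_inj ij; rewrite ij in jJ; rewrite (disjointFr IJ) in jJ.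
Qed.

Lemma gsignC I J : [disjoint I & J] ->
  gsign A I J = (-1) ^+ (#|I| * #|J|) * gsign A J I.
Proof.
move=> IJ; rewrite /gsign -(ginversionsC IJ) exprD -mulrA.
by rewrite -expr2 sqrr_sign mulr1.
Qed.

(** Replacing I by its complement in K turns the expansion of F * G into that of G * F; the sign of
    a term depends only on the two cardinals, hence on the parities. *)
Lemma gmulC b c F G : gparity b F -> gparity c G ->
  F * G = (-1) ^+ (b && c) * (G * F).
Proof.
move=> pF pG; apply/ffunP => K; transitivity ((-1) ^+ (b && c) * (G * F) K).
  rewrite !gmulE mulr_sumr.
  rewrite (reindex_onto (fun I => K :\: I) (fun I => K :\: I)) /=; last first.
    by move=> I IK; rewrite setDDr setDv set0U; apply/setIidPr.
  apply: eq_big => [I|I /andP[_ /eqP eI]].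
    by rewrite subsetDl /= setDDr setDv set0U; apply/eqP/setIidPr.
  rewrite eI; set J := K :\: I.
  have [->|/pF FI] := eqVneq (F J) 0; first by rewrite mul0r !mulr0.
  have [->|/pG GI] := eqVneq (G I) 0; first by rewrite mul0r !mulr0.
  have JI : [disjoint J & I].
    by rewrite -setI_eq0; apply/eqP/setP => x; rewrite !inE;
      case: (x \in I); rewrite ?andbF.
  rewrite gsignC // -signr_odd oddM FI GI -!mulrA; do 2 congr (_ * _).
  exact: mulrC.
by case: (b && c); rewrite ?mulN1r ?mul1r ?goppE.
Qed.

Lemma geven_comm F G c : gparity false F -> gparity c G -> F * G = G * F.
Proof. by move=> pF pG; rewrite (gmulC pF pG) mul1r. Qed.

Lemma godd_anticomm F G : gparity true F -> gparity true G -> F * G = - (G * F).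
Proof. by move=> pF pG; rewrite (gmulC pF pG) mulN1r. Qed.

Lemma gbody_odd F : gparity true F -> gbody F = 0.
Proof.
by move=> pF; apply/eqP/negPn/negP => /pF; rewrite cards0.
Qed.

(** Membership in the k-th power of the ideal spanned by the odd generators. This filtration makes
    the nilpotency of body-zero elements quantitative, since only 0 has level n.+1. *)
Definition glevel k F : Prop := forall I, (#|I| < k)%N -> F I = 0.

Lemma glevelM j k F G : glevel j F -> glevel k G -> glevel (j + k) (F * G).
Proof.
move=> lF lG K Kjk; rewrite gmulE big1 // => I IK.
have [/lF->|jI] := ltnP #|I| j; first by rewrite mul0r mulr0.
rewrite lG ?mulr0 //; move: Kjk; rewrite -(cardsID I K) (setIidPr IK).
rewrite -ltn_subRL => /leq_trans; apply; rewrite leq_subLR addnC.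
by rewrite addnC leq_add2r.
Qed.

Lemma glevel_max F : glevel n.+1 F -> F = 0.
Proof.
by move=> lF; apply/ffunP => I; rewrite lF ?gzeroE // ltnS -[leqRHS]card_ord max_card.
Qed.

Lemma glevelD k F G : glevel k F -> glevel k G -> glevel k (F + G).
Proof. by move=> lF lG I Ik; rewrite gaddE lF // lG // addr0. Qed.

Lemma glevel1 F : gbody F = 0 -> glevel 1 F.
Proof. by move=> F0 I; rewrite ltnS leqn0 cards_eq0 => /eqP->. Qed.

Lemma glevelX k F : gbody F = 0 -> glevel k (F ^+ k).
Proof.
move=> /glevel1 F0; elim: k => [|k IHk]; first by move=> I.
by rewrite exprS -add1n; apply: glevelM.
Qed.

Lemma gscalarM a F : gscalar n a * F = [ffun I => a * F I].
Proof.
apply/ffunP => K; rewrite gmulE ffunE (bigD1 set0) ?sub0set //= big1.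
  by rewrite addr0 gsign0l setD0 mul1r /gscalar ffunE eqxx.
by move=> I /andP[_ /negbTE I0]; rewrite [gscalar n a I]ffunE I0 mul0r mulr0.
Qed.

Lemma gscalar_even (a : A) : gparity false (gscalar n a).
Proof.
by move=> I; rewrite ffunE; case: (I =P set0) => [->|_]; rewrite ?cards0 ?eqxx.
Qed.

Lemma gbody_scalar a : gbody (gscalar n a) = a :> A.
Proof. by rewrite /gbody ffunE eqxx. Qed.

End GrassmannTheory.

(** * Inverses and odd squares over a field *)

Section GrassmannField.
Context {n : nat} {A : fieldType}.
Implicit Types (F G : grassmann n A).

(* F = a (1 - N) with a the body of F and N nilpotent. *)
Lemma ginv_ex F : gbody F != 0 ->
  exists G, [/\ G * F = 1, F * G = 1 & gparity false F -> gparity false G].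
Proof.
set a := gbody F => a0; pose c : grassmann n A := gscalar n a^-1.
pose N := 1 - c * F.
have cC G : c * G = G * c.
  apply/ffunP => K; rewrite gscalarM ffunE gmulE (bigD1 K) //= setDv gsign0r.
  rewrite /c ffunE eqxx mul1r mulrC big1 ?addr0 // => I /andP[IK nI].
  rewrite ffunE setD_eq0; case: ifP => [KI|]; rewrite ?mulr0 //.
  by case/eqP: nI; apply/eqP; rewrite eqEsubset IK.
have N0 : N ^+ n.+1 = 0.
  by apply/glevel_max/glevelX; rewrite rmorphB rmorph1 rmorphM /= gbody_scalar
    mulVf ?subrr.
pose T := \sum_(i < n.+1) N ^+ i.
have TN : c * F * T = 1.
  have -> : c * F = 1 - N by rewrite opprB addrC subrK.
  by rewrite -(opprB N) mulNr -subrX1 N0 sub0r opprK.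
exists (c * T); split.
- rewrite -mulrA; have NT : GRing.comm (c * F) T.
    have -> : c * F = 1 - N by rewrite opprB addrC subrK.
    apply: commr_sum => i _; apply: commrX; apply: commr_sym.
    by apply: commrB; [apply: commr1|].
  by rewrite mulrA cC -mulrA -NT.
- by rewrite mulrA -cC.
move=> pF; rewrite -[false]/(false (+) false); apply: gparityM.
  exact: gscalar_even.
apply: gparity_sum => i _; elim: {i}(i : nat) => [|i IHi].
  exact: gparity1.
rewrite exprS -[false]/(false (+) false); apply: gparityM => //.
apply: gparityB; first exact: gparity1.
by rewrite -[false]/(false (+) false); apply: gparityM => //; apply: gscalar_even.
Qed.

Lemma gunitE F : (F \is a GRing.unit) = (gbody F != 0).
Proof.
apply/idP/idP => [uF|/ginv_ex[G [GF FG _]]]; last by apply/unitrP; exists G.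
by rewrite -unitfE; apply: rmorph_unit.
Qed.

Lemma gparityV F : gparity false F -> gparity false F^-1.
Proof.
move=> pF; have [/[dup] F0|/negP] := boolP (gbody F != 0).
  move/ginv_ex => [G [GF FG /(_ pF)]]; rewrite -gunitE in F0.
  suff -> : F^-1 = G by [].
  by apply: (mulrI F0); rewrite FG divrr.
(* A non-unit is its own inverse by convention, so it keeps its parity. *)
by rewrite -gunitE => /negP uF; rewrite invr_out.
Qed.

Lemma gbodyV F : gbody F != 0 -> gbody F^-1 = (gbody F)^-1.
Proof. by rewrite -gunitE => uF; rewrite rmorphV. Qed.

Hypothesis A2 : (2 : A) != 0.

Lemma godd_sqr F : gparity true F -> F * F = 0.
Proof.
move=> pF; have /eqP := godd_anticomm pF pF; rewrite -subr_eq0 opprK => /eqP FF.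
apply/ffunP => I; rewrite gzeroE; apply/eqP.
have /ffunP/(_ I)/eqP := FF; rewrite gaddE gzeroE -mulr2n -mulr_natl mulf_eq0.
by rewrite (negbTE A2).
Qed.

End GrassmannField.

(** * The supergroup SPL_2 *)

Lemma ord3_ind (P : 'I_3 -> Prop) : P i1 -> P i2 -> P i3 -> forall i, P i.
Proof.
move=> P1 P2 P3 [[|[|[|]]] // i].
- by rewrite (_ : Ordinal i = i1) //; apply: val_inj.
- by rewrite (_ : Ordinal i = i2) //; apply: val_inj.
- by rewrite (_ : Ordinal i = i3) //; apply: val_inj.
Qed.

Lemma sum_ord3 (V : nmodType) (f : 'I_3 -> V) :
  \sum_i f i = f i1 + f i2 + f i3.
Proof.
rewrite !big_ord_recl big_ord0 addr0 addrA.
by congr (f _ + f _ + f _); apply: val_inj.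
Qed.

Lemma mulmx3 (R : pzSemiRingType) (M N : 'M[R]_3) i j :
  (M *m N) i j = M i i1 * N i1 j + M i i2 * N i2 j + M i i3 * N i3 j.
Proof. by rewrite mxE sum_ord3. Qed.

Lemma eq_mx3 (T : Type) (M N : 'M[T]_3) :
  (forall i, M i i1 = N i i1) -> (forall i, M i i2 = N i i2) ->
  (forall i, M i i3 = N i i3) -> M = N.
Proof.
by move=> e1 e2 e3; apply/matrixP => i; apply: ord3_ind.
Qed.

Section OspForm.
Context {R : pzRingType}.
Let J : 'M[R]_3 := delta_mx i1 i2 - delta_mx i2 i1 - delta_mx i3 i3.

Lemma osp_form_entries :
  (J i1 i1 = 0) * (J i1 i2 = 1) * (J i1 i3 = 0) *
  (J i2 i1 = -1) * (J i2 i2 = 0) * (J i2 i3 = 0) *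
  (J i3 i1 = 0) * (J i3 i2 = 0) * (J i3 i3 = -1).
Proof. by do !split; rewrite !mxE /= ?subr0 ?sub0r. Qed.

Lemma osp_form_mulT : J *m J^T = 1%:M.
Proof.
by apply: eq_mx3; apply: ord3_ind;
  rewrite mulmx3 ![J^T _ _]mxE !osp_form_entries ?(mulr0, mul0r, mulr1, mul1r, mulrN1,
    mulN1r, opprK, oppr0, addr0, add0r) mxE.
Qed.

Lemma osp_formT_mul : J^T *m J = 1%:M.
Proof.
by apply: eq_mx3; apply: ord3_ind;
  rewrite mulmx3 ![J^T _ _]mxE !osp_form_entries ?(mulr0, mul0r, mulr1, mul1r, mulrN1,
    mulN1r, opprK, oppr0, addr0, add0r) mxE.
Qed.

Lemma osp_form_conj (M : 'M[R]_3) : let C := J^T *m M *m J in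
  (C i1 i1 = M i2 i2) * (C i1 i2 = - M i2 i1) * (C i1 i3 = M i2 i3) *
  (C i2 i1 = - M i1 i2) * (C i2 i2 = M i1 i1) * (C i2 i3 = - M i1 i3) *
  (C i3 i1 = M i3 i2) * (C i3 i2 = - M i3 i1) * (C i3 i3 = M i3 i3).
Proof.
by do !split;
  rewrite mulmx3 !mulmx3 ![J^T _ _]mxE !osp_form_entries ?(mulr0, mul0r, mulr1, mul1r, mulrN1,
    mulN1r, opprK, oppr0, addr0, add0r).
Qed.

End OspForm.

Section Supermatrices.
Context {n : nat} {A : comNzRingType}.
Implicit Types (M N : 'M[grassmann n A]_3).

Lemma osp_formTK : osp_form n A *m (osp_form n A)^T = 1%:M.
Proof. exact: osp_form_mulT. Qed.

Lemma osp_formKT : (osp_form n A)^T *m osp_form n A = 1%:M.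
Proof. exact: osp_formT_mul. Qed.

Lemma supertrM M N : smx_even M -> smx_even N ->
  supertr (M *m N) = supertr N *m supertr M.
Proof.
move=> eM eN; apply/matrixP => j i; rewrite !mxE mulr_sumr.
apply: eq_bigr => k _; rewrite !mxE.
rewrite (gmulC (eM i k) (eN k j)).
by case: (spar i); case: (spar j); case: (spar k);
  rewrite /= ?expr0 ?expr1 ?mulN1r ?mul1r ?mulrN ?mulNr ?opprK.
Qed.

Lemma spl2_invE M :
  (spl2_inv M i1 i1 = M i2 i2) * (spl2_inv M i1 i2 = - M i1 i2) *
  (spl2_inv M i1 i3 = - M i3 i2) * (spl2_inv M i2 i1 = - M i2 i1) *
  (spl2_inv M i2 i2 = M i1 i1) * (spl2_inv M i2 i3 = M i3 i1) *
  (spl2_inv M i3 i1 = M i2 i3) * (spl2_inv M i3 i2 = - M i1 i3) *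
  (spl2_inv M i3 i3 = M i3 i3).
Proof.
have C := osp_form_conj (supertr M).
by do !split; rewrite /spl2_inv C mxE /= ?expr0 ?expr1 ?mul1r ?mulN1r ?opprK.
Qed.

End Supermatrices.

(* Locked: unification would otherwise unfold spl2_inv M into a product and
   reassociate it in larger products. *)
HB.lock Definition sinv (n : nat) (A : comNzRingType)
  (M : 'M[grassmann n A]_3) : 'M[grassmann n A]_3 := spl2_inv M.

Section SupermatrixInverse.
Context {n : nat} {A : comNzRingType}.
Implicit Types (M N : 'M[grassmann n A]_3).

Lemma sinv_def M : spl2_inv M = sinv M.
Proof. by rewrite [sinv]unlock. Qed.

Lemma sinvE M :
  (sinv M i1 i1 = M i2 i2) * (sinv M i1 i2 = - M i1 i2) *
  (sinv M i1 i3 = - M i3 i2) * (sinv M i2 i1 = - M i2 i1) *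
  (sinv M i2 i2 = M i1 i1) * (sinv M i2 i3 = M i3 i1) *
  (sinv M i3 i1 = M i2 i3) * (sinv M i3 i2 = - M i1 i3) *
  (sinv M i3 i3 = M i3 i3).
Proof. by rewrite -sinv_def; do !split; rewrite spl2_invE. Qed.

Lemma sinvK M : sinv (sinv M) = M.
Proof.
by apply: eq_mx3; apply: ord3_ind; rewrite sinvE sinvE ?opprK.
Qed.

Lemma sinv1 : sinv (1%:M : 'M[grassmann n A]_3) = 1%:M.
Proof.
by apply: eq_mx3; apply: ord3_ind; rewrite !sinvE !mxE /= ?oppr0.
Qed.

Lemma sinvM M N : smx_even M -> smx_even N ->
  sinv (M *m N) = sinv N *m sinv M.
Proof.
move=> eM eN; rewrite -!sinv_def /spl2_inv (supertrM eM eN) !mulmxA.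
by rewrite -[in RHS](mulmxA _ (osp_form n A)) osp_formTK mulmx1.
Qed.

Lemma sinvM_mul M N : smx_even M -> smx_even N ->
  sinv M *m M = 1%:M -> sinv N *m N = 1%:M ->
  sinv (M *m N) *m (M *m N) = 1%:M.
Proof.
move=> eM eN iM iN; rewrite (sinvM eM eN) -mulmxA (mulmxA _ M).
by rewrite iM mul1mx.
Qed.

Lemma osp_form_invE M :
  supertr M *m osp_form n A *m M = osp_form n A <-> sinv M *m M = 1%:M.
Proof.
rewrite -!sinv_def /spl2_inv -!mulmxA; split=> [->|/(congr1 (mulmx (osp_form n A)))].
  exact: osp_formKT.
by rewrite mulmxA osp_formTK mul1mx mulmx1.
Qed.

Lemma smx_even1 : smx_even (1%:M : 'M[grassmann n A]_3).
Proof.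
move=> i j; rewrite mxE; case: eqP => [->|_]; last exact: gparity0.
by rewrite addbb; apply: gparity1.
Qed.

Lemma smx_evenM M N : smx_even M -> smx_even N -> smx_even (M *m N).
Proof.
move=> eM eN i j; rewrite mxE; apply: gparity_sum => k _.
by have := gparityM (eM i k) (eN k j); rewrite addbA -[_ (+) spar k]addbA addbb addbF.
Qed.

Lemma smx_even_inv M : smx_even M -> smx_even (sinv M).
Proof.
move=> eM i; apply: ord3_ind; move: i; apply: ord3_ind; rewrite !sinvE.
all: try
  first [apply: (eM i1 i1)|apply: (eM i1 i2)|apply: (eM i1 i3)
     |apply: (eM i2 i1)|apply: (eM i2 i2)|apply: (eM i2 i3)
     |apply: (eM i3 i1)|apply: (eM i3 i2)|apply: (eM i3 i3)
     |apply: (gparityN (eM i1 i2))|apply: (gparityN (eM i3 i2))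
     |apply: (gparityN (eM i2 i1))|apply: (gparityN (eM i1 i3))].
Qed.

(* N M = 1 makes 1 - M N an idempotent with body 0, hence of level k for all k. *)
Lemma mulmx1C_grassmann M N : N *m M = 1%:M -> M *m N = 1%:M.
Proof.
move=> NM; pose E := 1%:M - M *m N.
have EE : E *m E = E.
  rewrite /E mulmxBl mul1mx mulmxBr mulmx1 !mulmxA -(mulmxA M) NM mulmx1.
  by rewrite subrr subr0.
have E0 : map_mx (@gbody n A) E = 0.
  rewrite map_mxB map_mxM map_mx1 /=.
  by rewrite (mulmx1C (A := map_mx (@gbody n A) N)) ?subrr // -map_mxM NM map_mx1.
have lE k : forall i j, glevel k.+1 (E i j).
  elim: k => [|k IHk] i j.
    by apply: glevel1; move/matrixP/(_ i j): E0; rewrite !mxE.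
  rewrite -EE mulmx3.
  have lM i' : glevel k.+2 (E i i' * E i' j).
    move=> I Ik; have := @glevelM _ _ k.+1 k.+1 _ _ (IHk i i') (IHk i' j) I.
    by apply; apply: leq_trans Ik _; rewrite addSn ltnS leq_addl.
  by do !apply: glevelD.
suff /eqP : E = 0 by rewrite subr_eq0 => /eqP <-.
by apply/matrixP => i j; rewrite [RHS]mxE; apply: glevel_max.
Qed.

End SupermatrixInverse.

Lemma sinv_map (A B : comNzRingType) (n k : nat)
    (f : grassmann n A -> grassmann k B) (M : 'M[grassmann n A]_3) :
  {morph f : x / - x} -> sinv (map_mx f M) = map_mx f (sinv M).
Proof.
move=> fN; apply: eq_mx3; apply: ord3_ind;
  by rewrite [RHS]mxE !sinvE mxE ?fN.
Qed.

(** * The group structure of SPL_2 and of its Borel subgroup *)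

Section SPL2Theory.
Context {n : nat} {A : fieldType}.
Hypothesis A2 : (2 : A) != 0.
Implicit Types (M N b : 'M[grassmann n A]_3).

(* Put d = M_33 and e = M_13 M_23, so that e^2 = 0.  The form relations express
   M_31 and M_32 by the other entries, and give d^2 = 1 + 2 e, Ber M * d = 1 + e. *)
Lemma berezinian1 M : smx_even M -> sinv M *m M = 1%:M ->
  gbody (M i3 i3) = 1 -> berezinian M = 1.
Proof.
move=> eM inv1 d1; rewrite /berezinian.
set d := M i3 i3; set di := d^-1; set e := M i1 i3 * M i2 i3.
have ud : d \is a GRing.unit by rewrite gunitE d1 oner_eq0.
have ed : gparity false d := eM i3 i3.
have edi : gparity false di by apply: gparityV.
have o1 : gparity true (M i1 i3) := eM i1 i3.
have o2 : gparity true (M i2 i3) := eM i2 i3.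
have ee : gparity false e := gparityM o1 o2.
have s1 := godd_sqr A2 o1; have s2 := godd_sqr A2 o2.
have e21 : M i2 i3 * M i1 i3 = - e by rewrite godd_anticomm.
have e0 : e * e = 0.
  rewrite /e mulrA -(mulrA (M i1 i3)) e21 mulrN mulNr.
  by rewrite /e mulrA s1 !mul0r oppr0.
have ev (i j : 'I_3) : spar i = spar j -> gparity false (M i j).
  by move=> ij; have := eM i j; rewrite ij addbb.
have rel i j : (sinv M *m M) i j = (i == j)%:R by rewrite inv1 mxE.
(* The (3, j) entry of [sinv M *m M] expresses orthogonality of the columns 3 and j; it can be
   solved for M_3j because d is a unit. *)
have g j : spar j = false -> M i3 j = di * (M i2 j * M i1 i3 - M i1 j * M i2 i3).
  move=> je; rewrite -[LHS](mulKr ud); congr (_ * _).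
  have := rel i3 j; rewrite mulmx3 !sinvE -/d.
  rewrite (negbTE (_ : i3 != j)); last by rewrite eq_sym; apply: contraFN je => /eqP->.
  rewrite mulNr -(geven_comm (ev i1 j _) o2) -1?(geven_comm (ev i2 j _) o1) ?je //.
  by move=> /eqP; rewrite addrC addr_eq0 opprB => /eqP.
have T i j : spar i = false -> spar j = false ->
    M i i3 * di * M i3 j = - (di * (di * (M i j * e))).
  move=> ie je; have oi : gparity true (M i i3) by have := eM i i3; rewrite ie.
  rewrite -(geven_comm edi oi) (g _ je) -!mulrA -[RHS]mulrN; congr (_ * _).
  rewrite mulrA -(geven_comm edi oi) -mulrA -[RHS]mulrN; congr (_ * _).
  rewrite mulrBr !mulrA -(geven_comm (ev i2 j _) oi) -1?(geven_comm (ev i1 j _) oi) ?je //.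
  move: i ie oi; apply: ord3_ind => // _ _; rewrite -?mulrA ?s1 ?s2 ?mulr0 ?sub0r ?subr0 //.
  by rewrite e21 mulrN.
set k := 1 + di * di * e.
have ek : gparity false k.
  apply: gparityD; first exact: gparity1.
  exact: gparityM (gparityM edi edi) ee.
have p i j : spar i = false -> spar j = false ->
    M i j - M i i3 * di * M i3 j = M i j * k.
  move=> ie je; rewrite T // opprK mulrDr mulr1; congr (_ + _).
  have eij : gparity false (M i j) by apply: ev; rewrite ie je.
  by rewrite mulrA [in RHS]mulrA (geven_comm eij (gparityM edi edi)) mulrA.
rewrite !p //.
have q i j i' j' : gparity false (M i' j') ->
    M i j * k * (M i' j' * k) = M i j * M i' j' * k * k.
  by move=> e'; rewrite -!mulrA; congr (_ * _); rewrite mulrA (geven_comm ek e') !mulrA.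
rewrite !q; [|exact: (eM i2 i1)|exact: (eM i2 i2)].
set D := M i1 i1 * M i2 i2 - M i1 i2 * M i2 i1.
have eD : gparity false D.
  by apply: gparityB; [apply: gparityM (eM i1 i1) (eM i2 i2)
                      |apply: gparityM (eM i1 i2) (eM i2 i1)].
(* This is the (1, 1) entry of [sinv M *m M], with M_31 and M_32 eliminated by [g]. *)
have Dk : D * k = 1.
  have := rel i1 i1; rewrite mulmx3 !sinvE eqxx mulr1n => <-.
  rewrite mulrDr mulr1 !mulNr (geven_comm (eM i2 i2) (eM i1 i1)); congr (_ + _).
  rewrite !g //; set X := _ - _; set Y := _ - _.
  have oX : gparity true X.
    by apply: gparityB; [apply: gparityM (eM i2 i2) o1|apply: gparityM (eM i1 i2) o2].
  have -> : di * X * (di * Y) = di * di * (X * Y).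
    by rewrite -!mulrA; congr (_ * _); rewrite !mulrA (geven_comm edi oX).
  rewrite mulrA (geven_comm eD (gparityM edi edi)) -mulrA -mulrN; congr (_ * _).
  rewrite /X /Y !mulrBr !mulrBl -!mulrA.
  rewrite !(mulrA (M i1 i3) (M _ _)) -(geven_comm (eM i2 i1) o1) -(geven_comm (eM i1 i1) o1).
  rewrite !(mulrA (M i2 i3) (M _ _)) -(geven_comm (eM i2 i1) o2) -(geven_comm (eM i1 i1) o2).
  rewrite -!mulrA s1 s2 e21 !mulr0 -/e !mulrN subr0 sub0r opprB !opprK.
  congr (_ - _).
  by rewrite !mulrA (geven_comm (eM i2 i2) (eM i1 i1)).
rewrite -mulrBl -mulrBl -/D Dk mul1r.
have dd : d * d = 1 + e + e.
  have := rel i3 i3; rewrite mulmx3 !sinvE eqxx mulr1n -/d e21 mulNr -/e => <-.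
  by rewrite [_ + d * d]addrC addrA subrK subrK.
have dde : di * di * e = e.
  have e' : e = d * d * e by rewrite dd !mulrDl mul1r e0 !addr0.
  by rewrite {1}e' /di -!mulrA !mulKr.
(* Both k = 1 + e and d are square roots of 1 + 2 e with body 1: their difference is killed by 1 + e
   + d, a unit because its body is 2. *)
have -> : k = d; last by rewrite mulrV.
rewrite /k dde; apply/eqP; rewrite -subr_eq0; apply/eqP.
have ue : 1 + e + d \is a GRing.unit.
  rewrite gunitE !rmorphD rmorph1 /= d1 rmorphM /= (gbody_odd o1) mul0r addr0.
  by rewrite -(natrD _ 1 1).
have es : gparity false (1 + e) by apply: gparityD => //; apply: gparity1.
apply: (mulIr ue); rewrite mul0r mulrBl mulrDr [d * (_ + d)]mulrDr.
rewrite (geven_comm ed es) opprD addrA addrK dd.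
by rewrite mulrDr mulr1 mulrDl mul1r e0 addr0 subrr.
Qed.

(** The form leaves a sign free: the body of M_33 squares to 1. The body of the Berezinian is the
    inverse of the body of M_33, so Berezinian 1 selects the sign +1. In this shape the condition
    visibly passes to products and inverses. *)
Lemma in_SPL2E M : in_SPL2 M <->
  [/\ smx_even M, sinv M *m M = 1%:M & gbody (M i3 i3) = 1].
Proof.
split=> [[eM /osp_form_invE inv1 ber]|[eM inv1 d1]]; last first.
  by split=> //; [apply/osp_form_invE|apply: berezinian1].
split=> //.
have rel i j : gbody (sinv M i i1 * M i1 j + sinv M i i2 * M i2 j
    + sinv M i i3 * M i3 j) = (i == j)%:R.
  by rewrite -mulmx3 inv1 mxE rmorph_nat.
have o1 : gbody (M i1 i3) = 0 := gbody_odd (eM i1 i3).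
have o2 : gbody (M i2 i3) = 0 := gbody_odd (eM i2 i3).
have o3 : gbody (M i3 i1) = 0 := gbody_odd (eM i3 i1).
have o4 : gbody (M i3 i2) = 0 := gbody_odd (eM i3 i2).
have := rel i3 i3; have := rel i1 i1.
rewrite !sinvE !(gbodyD, gbodyM, gbodyN) o1 o2 o3 o4.
rewrite !(mulr0, mul0r, oppr0, addr0, add0r) => D1 dd.
have d0 : gbody (M i3 i3) != 0.
  by apply: contra_eq_neq dd => ->; rewrite mul0r eq_sym oner_eq0.
move: (congr1 (@gbody n A) ber); rewrite /berezinian.
rewrite !(gbodyD, gbodyM, gbodyN, gbody1) o1 o2 o3 o4 gbodyV //.
rewrite !(mulr0, mul0r, subr0) => D2.
have /eqP : (gbody (M i3 i3))^-1 = 1.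
  by rewrite -D2 -[LHS]mul1r -[X in X / _]D1 mulNr [_ * gbody (M i1 i1)]mulrC.
by rewrite invr_eq1 => /eqP.
Qed.

Lemma SPL2_even M : in_SPL2 M -> smx_even M. Proof. by case. Qed.

Lemma SPL2_mulVmx M : in_SPL2 M -> sinv M *m M = 1%:M.
Proof. by case/in_SPL2E. Qed.

Lemma SPL2_mulmxV M : in_SPL2 M -> M *m sinv M = 1%:M.
Proof. by move/SPL2_mulVmx/mulmx1C_grassmann. Qed.

Lemma SPL2_body33 M : in_SPL2 M -> gbody (M i3 i3) = 1.
Proof. by case/in_SPL2E. Qed.

Lemma SPL2_inv M : in_SPL2 M -> in_SPL2 (sinv M).
Proof.
move=> GM; apply/in_SPL2E; split; first exact/smx_even_inv/SPL2_even.
  by rewrite sinvK SPL2_mulmxV.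
by rewrite sinvE SPL2_body33.
Qed.

Lemma SPL2M M N : in_SPL2 M -> in_SPL2 N -> in_SPL2 (M *m N).
Proof.
move=> GM GN; have [eM eN] := (SPL2_even GM, SPL2_even GN).
apply/in_SPL2E; split; first exact: smx_evenM.
  exact: sinvM_mul (SPL2_mulVmx GM) (SPL2_mulVmx GN).
rewrite mulmx3 !(gbodyD, gbodyM) (gbody_odd (eM i3 i1)) (gbody_odd (eM i3 i2)).
by rewrite !mul0r !add0r !SPL2_body33 ?mul1r.
Qed.

Lemma SPL2_1 : in_SPL2 (1%:M : 'M[grassmann n A]_3).
Proof.
apply/in_SPL2E; split; first exact: smx_even1.
  by rewrite sinv1 mul1mx.
by rewrite mxE rmorph1.
Qed.

Lemma in_B1 : in_B (1%:M : 'M[grassmann n A]_3).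
Proof. by split; rewrite ?mxE //; apply: SPL2_1. Qed.

(** The first column of b is b_11 e1, so the first column of [sinv b *m b] = 1 reads b_22 b_11 = 1
    and b_23 b_11 = 0. *)
Lemma in_B_entries b : in_B b ->
  [/\ b i2 i2 * b i1 i1 = 1, b i1 i1 * b i2 i2 = 1 & b i2 i3 = 0].
Proof.
case=> Gb b21 b31; have rel i j : sinv b i i1 * b i1 j + sinv b i i2 * b i2 j
    + sinv b i i3 * b i3 j = (i == j)%:R.
  by rewrite -mulmx3 SPL2_mulVmx // mxE.
have := rel i1 i1; have := rel i3 i1; rewrite !sinvE b21 b31.
rewrite !(mulr0, addr0) => b23 b22; have eb := SPL2_even Gb.
have b11 : b i1 i1 * b i2 i2 = 1 by rewrite (geven_comm (eb i1 i1) (eb i2 i2)).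
by split=> //; rewrite -[LHS]mulr1 -b11 mulrA b23 mul0r.
Qed.

End SPL2Theory.

(** * The superderivative and gauge transformations *)

Section SuperDerivation.
Context {n : nat} {A : comNzRingType}.
Implicit Types F G H : grassmann n.+1 A.

Definition theta_free F : Prop := forall I : {set 'I_n.+1}, ord0 \in I -> F I = 0.

Definition theta0 F : grassmann n.+1 A :=
  [ffun I : {set 'I_n.+1} => if ord0 \in I then 0 else F I].

Lemma theta_mulE H K :
  (theta * H) K = if ord0 \in K then H (K :\ ord0) else 0.
Proof.
have th (I : {set 'I_n.+1}) : theta I = (I == [set ord0])%:R :> A.
  by rewrite /theta /ggen ffunE.
rewrite gmulE; case: ifPn => [K0|nK0].
  rewrite (bigD1 [set ord0]) ?sub1set //= th eqxx mul1r big1 ?addr0.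
    rewrite /gsign /ginversions big_set1 big1 ?expr0 ?mul1r //.
  by move=> I /andP[_ /negbTE I0]; rewrite th I0 mul0r mulr0.
rewrite big1 // => I IK; rewrite th; case: eqP => [I0|_].
  by move: IK; rewrite I0 sub1set (negbTE nK0).
by rewrite mul0r mulr0.
Qed.

Lemma theta_sqr : theta * theta = 0 :> grassmann n.+1 A.
Proof.
apply/ffunP => K; rewrite theta_mulE gzeroE; case: ifP => // K0.
rewrite /theta /ggen ffunE; case: eqP => // /setP /(_ ord0).
by rewrite !inE eqxx.
Qed.

Lemma theta_odd : gparity true (theta : grassmann n.+1 A).
Proof.
move=> I; rewrite /theta /ggen ffunE; case: (I =P [set ord0]) => [->|_].
  by rewrite cards1.
by rewrite eqxx.
Qed.

Lemma theta_decomp F : F = theta0 F + theta * d_theta F.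
Proof.
apply/ffunP => K; rewrite gaddE theta_mulE !ffunE.
case: ifP => K0; last by rewrite addr0.
by rewrite !inE eqxx /= add0r setD1K.
Qed.

Lemma theta0_free F : theta_free (theta0 F).
Proof. by move=> I I0; rewrite ffunE I0. Qed.

Lemma d_theta_free F : theta_free (d_theta F).
Proof. by move=> I I0; rewrite ffunE I0. Qed.

Lemma theta_freeM F G : theta_free F -> theta_free G -> theta_free (F * G).
Proof.
move=> fF fG K K0; rewrite gmulE big1 // => I IK.
have [/fF->|I0] := boolP (ord0 \in I); first by rewrite mul0r mulr0.
by rewrite fG ?mulr0 // inE K0 I0.
Qed.

Lemma d_theta_free0 F : theta_free F -> d_theta F = 0.
Proof.
move=> fF; apply/ffunP => K; rewrite ffunE gzeroE; case: ifP => // _.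
by rewrite fF // !inE eqxx.
Qed.

Lemma d_theta_mul_theta F : theta_free F -> d_theta (theta * F) = F.
Proof.
move=> fF; apply/ffunP => K; rewrite ffunE theta_mulE.
case: ifPn => [/fF -> //|K0]; rewrite !inE eqxx /=; congr (F _).
by rewrite setU1K.
Qed.

Lemma d_thetaD F G : d_theta (F + G) = d_theta F + d_theta G.
Proof.
by apply/ffunP => K; rewrite gaddE !ffunE; case: ifP => _; rewrite ?addr0.
Qed.

Lemma d_thetaN F : d_theta (- F) = - d_theta F.
Proof.
by apply/ffunP => K; rewrite goppE !ffunE; case: ifP => _; rewrite ?oppr0.
Qed.

Lemma theta0_parity b F : gparity b F -> gparity b (theta0 F).
Proof. by move=> pF I; rewrite ffunE; case: ifP => _; [rewrite eqxx|apply: pF]. Qed.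

Lemma d_theta_parity b F : gparity b F -> gparity (~~ b) (d_theta F).
Proof.
move=> pF I; rewrite ffunE; case: ifPn => [_|I0 /pF]; first by rewrite eqxx.
by rewrite cardsU1 I0 /= => <-; rewrite negbK.
Qed.

Lemma theta_comm b F : gparity b F -> F * theta = (-1) ^+ b * (theta * F).
Proof. by move=> pF; rewrite (gmulC pF theta_odd) andbT. Qed.

(** Splitting F and G into theta-free parts reduces the rule to multiplying out: theta^2 = 0 removes
    the product of the two theta parts, and moving theta to the left of the theta-free part of F
    produces (-1)^b. *)
Lemma d_thetaM b F G : gparity b F ->
  d_theta (F * G) = d_theta F * G + (-1) ^+ b * (F * d_theta G).
Proof.
move=> pF; have pF0 := theta0_parity pF; have pF1 := d_theta_parity pF.
have [fF0 fG0] := (@theta0_free F, @theta0_free G).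
have [fF1 fG1] := (@d_theta_free F, @d_theta_free G).
rewrite {1}(theta_decomp F) {1}(theta_decomp G).
set F0 := theta0 F in pF0 fF0 *; set F1 := d_theta F in pF1 fF1 *.
set G0 := theta0 G in fG0 *; set G1 := d_theta G in fG1 *.
have -> : (F0 + theta * F1) * (G0 + theta * G1) =
    F0 * G0 + theta * (F1 * G0 + (-1) ^+ b * (F0 * G1)).
  rewrite mulrDl !mulrDr -!addrA; congr (_ + _).
  rewrite !mulrA (theta_comm pF0) -[theta * F1 * theta]mulrA (theta_comm pF1).
  rewrite !mulrA.
  have -> : theta * (-1) ^+ (~~ b) * theta = 0 :> grassmann n.+1 A.
    by case: b {pF pF0 pF1}; rewrite /= ?expr0 ?expr1 ?mulrN1 ?mulr1 ?mulNr theta_sqr ?oppr0.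
  rewrite !mul0r addr0 addrC; congr (_ + _).
  by rewrite -!mulrA; case: b {pF pF0 pF1}; rewrite /= ?expr0 ?expr1 ?mulN1r ?mul1r ?mulrN.
rewrite d_thetaD d_theta_free0; last exact: theta_freeM.
rewrite add0r d_theta_mul_theta; last first.
  move=> I I0; rewrite gaddE theta_freeM // add0r.
  case: b {pF pF0 pF1}; rewrite /= ?expr0 ?expr1 ?mulN1r ?mul1r ?goppE theta_freeM ?oppr0 //.
rewrite (theta_decomp F) (theta_decomp G) -/F0 -/F1 -/G0 -/G1.
rewrite [F1 * (_ + _)]mulrDr [(F0 + _) * G1]mulrDl [_ * (F0 * G1 + _)]mulrDr.
rewrite -!addrA; congr (_ + _); rewrite addrCA -[LHS]addr0; congr (_ + _).
rewrite [F1 * (theta * G1)]mulrA (theta_comm pF1) -!mulrA -mulrDl.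
by case: b {pF pF0 pF1}; rewrite /= ?expr0 ?expr1 ?addrN ?addNr mul0r.
Qed.

Variable d : A -> A.
Hypothesis dD : {morph d : x y / x + y}.
Hypothesis dM : forall x y, d (x * y) = d x * y + x * d y.

Let d0 : d 0 = 0.
Proof. by apply: (addrI (d 0)); rewrite -dD !addr0. Qed.

Let dN x : d (- x) = - d x.
Proof. by apply/eqP; rewrite -addr_eq0 -dD addNr d0. Qed.

Let dz F : grassmann n.+1 A := [ffun I => d (F I)].

Lemma DthetaE F : Dtheta d F = d_theta F + theta * dz F.
Proof. by []. Qed.

Lemma dzM F G : dz (F * G) = dz F * G + F * dz G.
Proof.
apply/ffunP => K; rewrite gaddE ffunE !gmulE (big_morph d dD d0) -big_split /=.
apply: eq_bigr => I _; rewrite !ffunE -mulrDr -dM /gsign -signr_odd.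
by case: odd; rewrite /= ?expr0 ?expr1 ?mulN1r ?mul1r ?dN.
Qed.

Lemma dz_parity b F : gparity b F -> gparity b (dz F).
Proof.
move=> pF I; rewrite ffunE; have [->|/pF //] := eqVneq (F I) 0.
by rewrite d0 eqxx.
Qed.

Lemma DthetaD F G : Dtheta d (F + G) = Dtheta d F + Dtheta d G.
Proof.
rewrite !DthetaE d_thetaD addrACA -mulrDr; congr (_ + _ * _).
by apply/ffunP => K; rewrite gaddE !ffunE dD.
Qed.

Lemma DthetaN F : Dtheta d (- F) = - Dtheta d F.
Proof.
rewrite !DthetaE d_thetaN opprD -mulrN; congr (_ + _ * _).
by apply/ffunP => K; rewrite goppE !ffunE dN.
Qed.

Lemma Dtheta0 : Dtheta d (0 : grassmann n.+1 A) = 0.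
Proof. by rewrite -{1}(subrr 0) DthetaD DthetaN subrr. Qed.

Lemma Dtheta_parity b F : gparity b F -> gparity (~~ b) (Dtheta d F).
Proof.
move=> pF; rewrite DthetaE; apply: gparityD; first exact: d_theta_parity.
exact: gparityM theta_odd (dz_parity pF).
Qed.

Lemma DthetaM b F G : gparity b F ->
  Dtheta d (F * G) = Dtheta d F * G + (-1) ^+ b * (F * Dtheta d G).
Proof.
move=> pF; rewrite !DthetaE (d_thetaM _ pF) dzM mulrDl mulrDr -!addrA.
congr (_ + _); rewrite mulrDr mulrDr [RHS]addrCA; congr (_ + _).
rewrite !mulrA; congr (_ + _); rewrite -[_ * F * theta]mulrA (theta_comm pF) !mulrA.
by rewrite -expr2 sqrr_sign mul1r.
Qed.

Lemma Dtheta_evenM F G : gparity false F ->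
  Dtheta d (F * G) = Dtheta d F * G + F * Dtheta d G.
Proof. by move=> pF; rewrite (DthetaM _ pF) mul1r. Qed.

Lemma Dtheta_oddM F G : gparity true F ->
  Dtheta d (F * G) = Dtheta d F * G - F * Dtheta d G.
Proof. by move=> pF; rewrite (DthetaM _ pF) mulN1r. Qed.

Lemma Dtheta1 : Dtheta d (1 : grassmann n.+1 A) = 0.
Proof.
have := Dtheta_evenM 1 gparity1; rewrite !mul1r mulr1 => /eqP.
by rewrite -subr_eq0 opprD addNKr oppr_eq0 => /eqP.
Qed.

(** Together with [gcoef_Dtheta] this is the passage from superfields to bodies; the two combine to
    D^2 = d/dz on bodies. *)
Lemma gbody_Dtheta F : gbody (Dtheta d F) = gcoef ord0 F.
Proof.
rewrite /gbody DthetaE gaddE theta_mulE inE addr0 ffunE inE /gcoef.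
by rewrite setU0.
Qed.

Lemma gcoef_Dtheta F : gcoef ord0 (Dtheta d F) = d (gbody F).
Proof.
rewrite /gcoef DthetaE gaddE theta_mulE inE eqxx ffunE inE eqxx add0r ffunE.
by rewrite setDv.
Qed.

(** Passing D over M_ik costs the sign of |i| + |k|; with the sign of |i| built into [smxD] this
    leaves that of |k|, the one carried by [smxD d N]. *)
Lemma smxDM (M N : 'M[grassmann n.+1 A]_3) : smx_even M ->
  smxD d (M *m N) = smxD d M *m N + M *m smxD d N.
Proof.
move=> eM; apply/matrixP => i j; rewrite !mxE (big_morph _ DthetaD Dtheta0).
rewrite mulr_sumr -big_split /=; apply: eq_bigr => k _; rewrite !mxE.
rewrite (DthetaM _ (eM i k)) mulrDr; congr (_ + _); first by rewrite mulrA.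
rewrite [LHS]mulrA -signr_addb addbA addbb addFb.
by case: (spar k); rewrite /= ?expr0 ?expr1 ?mul1r ?mulN1r ?mulrN.
Qed.

End SuperDerivation.

Section GaugeTheory.
Context {n : nat} {A : fieldType}.
Hypothesis A2 : (2 : A) != 0.
Variable d : A -> A.
Hypothesis dD : {morph d : x y / x + y}.
Hypothesis dM : forall x y, d (x * y) = d x * y + x * d y.
Local Notation smx := 'M[grassmann n.+1 A]_3.
Implicit Types (g h M : smx).

Lemma gauge0E g M : in_SPL2 g -> gauge d g M = 0 <-> smxD d g = g *m M.
Proof.
move=> Gg; rewrite /gauge !sinv_def; split=> [/eqP|->]; last by rewrite subrr.
rewrite subr_eq0 => /eqP /(congr1 (mulmx^~ g)); rewrite /= -!mulmxA.
by rewrite (SPL2_mulVmx A2 Gg) !mulmx1.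
Qed.

(** The product rule separates the equation of the frame g from that of g h, which trades a gauge
    transform, with its inverses, for a linear equation. Here g h will be the flat frame Phi, with g
    either Phi P for a Miura structure P, or [normal_form]. *)
Lemma gauge_parallel g h M M' : in_SPL2 g -> in_SPL2 h ->
  smxD d (g *m h) = g *m h *m M ->
  gauge d h M = M' <-> smxD d g = g *m M'.
Proof.
move=> Gg Gh; rewrite (smxDM dD dM _ (SPL2_even Gg)) => e.
have -> : gauge d h M = sinv g *m smxD d g.
  rewrite /gauge !sinv_def -mulmxBl.
  have /(congr1 (mulmx (sinv g))) := e; rewrite /=.
  rewrite mulmxDr !mulmxA (SPL2_mulVmx A2 Gg) !mul1mx => <-.
  by rewrite addrK -(mulmxA _ h) (SPL2_mulmxV A2 Gh) mulmx1.
split=> [<-|->]; rewrite mulmxA ?(SPL2_mulmxV A2 Gg) ?(SPL2_mulVmx A2 Gg) mul1mx //.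
Qed.

(** The derivative term does not reach this entry because g_21, g_23 and g_31 vanish, so the
    coefficient of f transforms multiplicatively. Asking only for d 0 = 0 lets the same statement
    serve [Dz] on charts and [Dt] on discs. *)
Lemma gauge_31 g M : d 0 = 0 -> in_B g -> M i2 i1 = 0 ->
  gauge d g M i3 i1 = g i3 i3 * M i3 i1 * g i2 i2.
Proof.
move=> d0 Bg M21; have [_ _ g23] := in_B_entries A2 Bg; case: Bg => _ g21 g31.
have D0 : Dtheta d (0 : grassmann n.+1 A) = 0.
  apply/ffunP => K; rewrite DthetaE gaddE theta_mulE !ffunE d0.
  by rewrite !if_same addr0.
have iE := sinvE g.
rewrite /gauge !sinv_def mxE [X in _ + X]mxE !mulmx3 !iE g21 g23 g31 M21.
rewrite [smxD d g i3 i1]mxE g31 D0.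
by rewrite !(mul0r, mulr0, oppr0, addr0, add0r).
Qed.

End GaugeTheory.

(** * Rational functions and their Laurent expansions *)

Section QuotientRule.
Context {F : fieldType}.
Variables (p q r s dp dq dr ds : F).
Hypotheses (q0 : q != 0) (s0 : s != 0).

(** The derivatives enter as independent variables, so that this and the product rule are plain
    field identities. *)
Lemma quotient_ruleD :
  ((dp * s + p * ds + (dr * q + r * dq)) * (q * s)
    - (p * s + r * q) * (dq * s + q * ds)) / (q * s) ^+ 2 =
  (dp * q - p * dq) / q ^+ 2 + (dr * s - r * ds) / s ^+ 2.
Proof. by field; rewrite q0 s0. Qed.

Lemma quotient_ruleM :
  ((dp * r + p * dr) * (q * s) - p * r * (dq * s + q * ds)) / (q * s) ^+ 2 =
  (dp * q - p * dq) / q ^+ 2 * (r / s) + p / q * ((dr * s - r * ds) / s ^+ 2).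
Proof. by field; rewrite q0 s0. Qed.

End QuotientRule.

Section Fractions.
Context {R : idomainType}.
Implicit Types (x y : {fraction R}) (p q : R).

Lemma frac_reprE x : x = tofrac (frac (repr x)).1 / tofrac (frac (repr x)).2.
Proof.
have q0 : tofrac (frac (repr x)).2 != 0 by rewrite tofrac_eq0 denom_ratioP.
apply: (canRL (mulfK q0)); rewrite -[X in X * _]reprK.
rewrite -[_ * _]/(FracField.mul _ _) !piE; apply/eqmodP.
rewrite /= FracField.equivfE /FracField.mulf /=.
rewrite !numden_Ratio ?mulf_neq0 ?oner_eq0 ?denom_ratioP //.
by rewrite !mulr1 mulrC.
Qed.

Lemma frac_ex x : exists p q, q != 0 /\ x = tofrac p / tofrac q.
Proof.
exists (frac (repr x)).1, (frac (repr x)).2; split; last exact: frac_reprE.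
exact: denom_ratioP.
Qed.

Lemma tofrac_div_eq p q p' q' : q != 0 -> q' != 0 ->
  tofrac p / tofrac q = tofrac p' / tofrac q' -> p * q' = p' * q.
Proof.
move=> q0 q0' /eqP; rewrite eqr_div ?tofrac_eq0 // -!tofracM tofrac_eq.
by move/eqP.
Qed.

Variable d : R -> R.

Lemma frac_deriv0 : d 0 = 0 -> frac_deriv d 0 = 0.
Proof.
move=> d0; rewrite /frac_deriv.
have /esym/eqP := frac_reprE 0; rewrite mulf_eq0 invr_eq0 !tofrac_eq0.
rewrite (negbTE (denom_ratioP _)) orbF => /eqP ->.
by rewrite d0 !mul0r subrr tofrac0 mul0r.
Qed.

Hypothesis dD : {morph d : p q / p + q}.
Hypothesis dM : forall p q, d (p * q) = d p * q + p * d q.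

Lemma frac_derivE p q : q != 0 ->
  frac_deriv d (tofrac p / tofrac q) = tofrac (d p * q - p * d q) / tofrac q ^+ 2.
Proof.
move=> q0; set x := _ / _; rewrite /frac_deriv.
have := denom_ratioP (repr x); have := frac_reprE x.
set n := (frac _).1; set m := (frac _).2 => xE m0.
have e : p * m = n * q by apply: tofrac_div_eq.
have e' := congr1 d e; rewrite !dM in e'.
rewrite -tofracXn; apply/eqP; rewrite eqr_div ?tofrac_eq0 ?expf_neq0 // -!tofracM tofrac_eq.
rewrite -subr_eq0; apply/eqP.
(* Independence of the representative: the difference of the cross products is a combination of p m
   = n q and its derivative. *)
transitivity ((d n * q + n * d q - (d p * m + p * d m)) * (m * q)
  + (p * m - n * q) * (d m * q + d q * m)); first by ring.
by rewrite e' e !subrr !mul0r addr0.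
Qed.

Lemma frac_deriv_tofrac p : frac_deriv d (tofrac p) = tofrac (d p).
Proof.
have d1 : d 1 = 0.
  by apply: (addrI (d 1)); rewrite addr0 -{3}[1]mulr1 dM mulr1 mul1r.
rewrite -[tofrac p]divr1 -tofrac1 frac_derivE ?oner_eq0 //.
by rewrite d1 mulr0 mulr1 subr0 tofrac1 expr1n divr1.
Qed.

Lemma frac_derivD : {morph frac_deriv d : x y / x + y}.
Proof.
move=> x y; have [p [q [q0 ->]]] := frac_ex x; have [r [s [s0 ->]]] := frac_ex y.
have [q0' s0'] : tofrac q != 0 /\ tofrac s != 0 by rewrite !tofrac_eq0.
rewrite addf_div // -!tofracM -tofracD !frac_derivE ?mulf_neq0 // dD !dM.
by rewrite !(tofracD, tofracM, tofracN); apply: quotient_ruleD.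
Qed.

Lemma frac_derivM x y :
  frac_deriv d (x * y) = frac_deriv d x * y + x * frac_deriv d y.
Proof.
have [p [q [q0 ->]]] := frac_ex x; have [r [s [s0 ->]]] := frac_ex y.
have [q0' s0'] : tofrac q != 0 /\ tofrac s != 0 by rewrite !tofrac_eq0.
rewrite mulf_div -!tofracM !frac_derivE ?mulf_neq0 // !dM.
by rewrite !(tofracD, tofracM, tofracN); apply: quotient_ruleM.
Qed.

End Fractions.

Section Dz.
Context {K : fieldType}.
Implicit Types (p q : {poly K}) (f g : ratfun K).

Lemma DzD : {morph @Dz K : f g / f + g}.
Proof. by apply: frac_derivD => [p q|p q]; [apply: derivD|apply: derivM]. Qed.

Lemma DzM f g : Dz (f * g) = Dz f * g + f * Dz g.
Proof. by apply: frac_derivM => p q; apply: derivM. Qed.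

Lemma Dz_tofrac p : Dz (tofrac p) = tofrac p^`().
Proof. by apply: frac_deriv_tofrac => q r; apply: derivM. Qed.

Lemma Dz0 : Dz (0 : ratfun K) = 0.
Proof. by apply: frac_deriv0; rewrite linear0. Qed.

Lemma Dt0 : Dt (0 : laurent K) = 0.
Proof.
by apply: frac_deriv0; apply/fpsP => k /=; rewrite mul0rn.
Qed.

Lemma frac_coprimeE f :
  exists p q, [/\ coprimep p q, q != 0 & f = tofrac p / tofrac q].
Proof.
have [p [q [q0 ->]]] := frac_ex f; set c := gcdp p q.
have c0 : c != 0 by rewrite gcdp_eq0 negb_and q0 orbT.
have ep : p = p %/ c * c by rewrite divpK // dvdp_gcdl.
have eq : q = q %/ c * c by rewrite divpK // dvdp_gcdr.
have q0' : q %/ c != 0 by apply: contraNneq q0 => e; rewrite eq e mul0r.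
exists (p %/ c), (q %/ c); split=> //.
  by apply: coprimep_div_gcd; rewrite q0 orbT.
rewrite {1}ep {1}eq !tofracM -mulf_div divff ?mulr1 // tofrac_eq0 //.
Qed.

(** In lowest terms p' q = p q' forces q to divide q', so q' = 0 by degree and then p' = 0;
    characteristic 0 makes both constant. *)
Lemma Dz_eq0 f : [pchar K] =i pred0 -> Dz f = 0 -> exists c, f = ratC c.
Proof.
move=> /pcharf0P K0; have [p [q [cpq q0 ->]]] := frac_coprimeE f.
rewrite /Dz frac_derivE //; last by move=> r s; apply: derivM.
move/eqP; rewrite mulf_eq0 invr_eq0 expf_eq0 /= !tofrac_eq0 (negbTE q0) orbF.
rewrite subr_eq0 => /eqP e.
have dq : q %| q^`().
  rewrite -(Gauss_dvdpr _ (_ : coprimep q p)); last by rewrite coprimep_sym.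
  by rewrite -e dvdp_mulIr.
have q'0 : q^`() = 0.
  apply/eqP; apply: contraTT dq => q'0; rewrite gtNdvdp //.
  by apply: lt_size_deriv.
have deg0 (r : {poly K}) : r^`() = 0 -> r = (r`_0)%:P.
  move=> r0; apply/polyP => -[|i]; rewrite coefC //=.
  have /polyP/(_ i)/eqP := r0; rewrite coef_deriv coef0 -mulr_natr mulf_eq0.
  by rewrite K0 orbF => /eqP.
have p'0 : p^`() = 0.
  move/eqP: e; rewrite q'0 mulr0 mulf_eq0 (negbTE q0) orbF; by move/eqP.
exists (p`_0 / q`_0); rewrite (deg0 _ p'0) (deg0 _ q'0) !coefC eqxx /ratC.
have q00 : q`_0 != 0 by move: q0; rewrite {1}(deg0 _ q'0) polyC_eq0.
apply: (canLR (mulfK _)); first by rewrite tofrac_eq0 polyC_eq0.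
by rewrite -tofracM -polyCM divfK.
Qed.

End Dz.

(** * Power series, regular Laurent series and their constant terms *)

Section PowerSeries.
Context {K : fieldType}.
Implicit Types (p q : {poly K}) (g h : fps K) (f : laurent K).

Lemma fps_mulE g h k :
  fps_coef (g * h) k = \sum_(i < k.+1) fps_coef g i * fps_coef h (k - i).
Proof. by []. Qed.

Definition fps_coef0 g : K := fps_coef g 0.
Arguments fps_coef0 : simpl never.

Lemma fps_coef0_zmod : zmod_morphism fps_coef0. Proof. by []. Qed.
Lemma fps_coef0_monoid : monoid_morphism fps_coef0.
Proof.
by split=> // g h; rewrite /fps_coef0 fps_mulE big_ord_recl big_ord0 addr0.
Qed.
HB.instance Definition _ :=
  GRing.isZmodMorphism.Build (fps K) K fps_coef0 fps_coef0_zmod.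
HB.instance Definition _ :=
  GRing.isMonoidMorphism.Build (fps K) K fps_coef0 fps_coef0_monoid.

Definition fps_poly p : fps K := Fps (fun k => p`_k).

Lemma fps_poly_zmod : zmod_morphism fps_poly.
Proof. by move=> p q; apply/fpsP => k /=; rewrite coefB. Qed.
Lemma fps_poly_monoid : monoid_morphism fps_poly.
Proof.
split=> [|p q]; apply/fpsP => k /=; first by rewrite coef1.
by rewrite coefM.
Qed.
HB.instance Definition _ :=
  GRing.isZmodMorphism.Build {poly K} (fps K) fps_poly fps_poly_zmod.
HB.instance Definition _ :=
  GRing.isMonoidMorphism.Build {poly K} (fps K) fps_poly fps_poly_monoid.

Lemma fps_poly_inj : injective fps_poly.
Proof. by move=> p q /fpsP e; apply/polyP => k; apply: e. Qed.

Lemma fps_poly_eq0 p : (fps_poly p == 0) = (p == 0).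
Proof. by rewrite -(inj_eq fps_poly_inj) rmorph0. Qed.

Lemma fps_poly_const a : fps_poly a%:P = fps_const a.
Proof. by apply/fpsP => -[|k] /=; rewrite coefC. Qed.

Lemma fps_polyX : fps_poly 'X = fps_X K.
Proof. by apply/fpsP => k /=; rewrite coefX. Qed.

Lemma laurCE a : laurC a = tofrac (fps_poly a%:P).
Proof. by rewrite fps_poly_const. Qed.

Lemma laurTE : laurT K = tofrac (fps_poly 'X).
Proof. by rewrite fps_polyX. Qed.

Lemma laurT_neq0 : laurT K != 0.
Proof. by rewrite laurTE tofrac_eq0 fps_poly_eq0 polyX_eq0. Qed.

Lemma laurC_zmod : zmod_morphism (@laurC K).
Proof. by move=> a b; rewrite !laurCE polyCB !rmorphB. Qed.
Lemma laurC_monoid : monoid_morphism (@laurC K).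
Proof.
by split=> [|a b]; rewrite !laurCE ?polyCM ?rmorphM // rmorph1 tofrac1.
Qed.
HB.instance Definition _ :=
  GRing.isZmodMorphism.Build K (laurent K) (@laurC K) laurC_zmod.
HB.instance Definition _ :=
  GRing.isMonoidMorphism.Build K (laurent K) (@laurC K) laurC_monoid.

Definition laur_regular f : Prop := exists g : fps K, f = tofrac g.

Lemma laur_regularD f1 f2 :
  laur_regular f1 -> laur_regular f2 -> laur_regular (f1 + f2).
Proof. by move=> [g ->] [h ->]; exists (g + h); rewrite tofracD. Qed.

Lemma laur_regularM f1 f2 :
  laur_regular f1 -> laur_regular f2 -> laur_regular (f1 * f2).
Proof. by move=> [g ->] [h ->]; exists (g * h); rewrite tofracM. Qed.

Lemma laur_regularN f : laur_regular f -> laur_regular (- f).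
Proof. by move=> [g ->]; exists (- g); rewrite tofracN. Qed.

Lemma laur_regularC a : laur_regular (laurC a).
Proof. by exists (fps_const a). Qed.

Lemma laur_regular0 : laur_regular 0.
Proof. by exists 0; rewrite tofrac0. Qed.

Lemma laur_coef0E g : laur_coef0 (tofrac g) = fps_coef0 g.
Proof.
rewrite /laur_coef0; case: pselect => [e|[]]; last by exists g.
by case: cid => h /= /eqP; rewrite tofrac_eq => /eqP <-.
Qed.

Lemma laur_coef00 : @laur_coef0 K 0 = 0.
Proof. by rewrite -tofrac0 laur_coef0E rmorph0. Qed.

Lemma laur_coef0C (a : K) : laur_coef0 (laurC a) = a.
Proof. by rewrite laur_coef0E. Qed.

Lemma laur_coef0D f1 f2 : laur_regular f1 -> laur_regular f2 ->
  laur_coef0 (f1 + f2) = laur_coef0 f1 + laur_coef0 f2.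
Proof. by move=> [g ->] [h ->]; rewrite -tofracD !laur_coef0E rmorphD. Qed.

Lemma laur_coef0N f : laur_regular f -> laur_coef0 (- f) = - laur_coef0 f.
Proof. by move=> [g ->]; rewrite -tofracN !laur_coef0E rmorphN. Qed.

Lemma laur_coef0M f1 f2 : laur_regular f1 -> laur_regular f2 ->
  laur_coef0 (f1 * f2) = laur_coef0 f1 * laur_coef0 f2.
Proof. by move=> [g ->] [h ->]; rewrite -tofracM !laur_coef0E rmorphM. Qed.

End PowerSeries.

Arguments fps_coef0 {K} g : simpl never.

(** * Expansion of rational functions at the points of P^1 *)

Section Expansion.
Context {K : fieldType}.
Implicit Types (x : option K) (p q : {poly K}) (f g : ratfun K).

Definition poly_at x p : laurent K := (map_poly (@laurC K) p).[z_at x].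

Lemma poly_at_zmod x : zmod_morphism (poly_at x).
Proof. by move=> p q; rewrite /poly_at rmorphB hornerD hornerN. Qed.
Lemma poly_at_monoid x : monoid_morphism (poly_at x).
Proof.
by split=> [|p q]; rewrite /poly_at ?rmorph1 ?hornerC // rmorphM hornerM.
Qed.
HB.instance Definition _ x :=
  GRing.isZmodMorphism.Build {poly K} (laurent K) (poly_at x) (poly_at_zmod x).
HB.instance Definition _ x :=
  GRing.isMonoidMorphism.Build {poly K} (laurent K) (poly_at x)
    (poly_at_monoid x).

Lemma poly_at_finite c p :
  poly_at (Some c) p = tofrac (fps_poly (p \Po ('X + c%:P))).
Proof.
rewrite /poly_at /z_at /comp_poly laurCE laurTE addrC -tofracD -rmorphD /=.
have -> : map_poly (@laurC K) p =
    map_poly (@tofrac (fps K)) (map_poly fps_poly (map_poly polyC p)).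
  by rewrite -!map_poly_comp; apply: eq_map_poly => a /=; rewrite laurCE.
by rewrite !horner_map.
Qed.

Lemma poly_at_finite_coef0 c p :
  fps_coef0 (fps_poly (p \Po ('X + c%:P))) = p.[c].
Proof.
by rewrite /fps_coef0 /= -horner_coef0 horner_comp !hornerE.
Qed.

(* At oo, z = - 1 / t, so a polynomial of degree s has a pole of order s. *)
Lemma poly_at_oo p : p != 0 -> exists2 g : fps K, fps_coef0 g != 0 &
  poly_at None p * laurT K ^+ (size p).-1 = tofrac g.
Proof.
move=> p0; have t0 := @laurT_neq0 K.
(* The reversed polynomial, with the signs of z = - 1 / t; its constant term is the leading
   coefficient of p up to sign. *)
exists (\sum_(i < size p) fps_const p`_i * ((-1) ^+ i * fps_X K ^+ ((size p).-1 - i))).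
  rewrite raddf_sum /=; have sp : size p = (size p).-1.+1 by rewrite prednK ?size_poly_gt0.
  rewrite sp big_ord_recr big1 /= => [|i _].
    rewrite add0r subnn expr0 mulr1 !rmorphM rmorphXn rmorphN1 /=.
    by rewrite mulf_neq0 ?signr_eq0 // -lead_coefE lead_coef_eq0.
  rewrite !rmorphM rmorphXn /= [fps_coef0 (fps_X K)](_ : _ = 0) //.
  by rewrite expr0n subn_eq0 leqNgt ltn_ord !mulr0.
rewrite /poly_at horner_coef size_map_poly mulr_suml rmorph_sum /=.
apply: eq_bigr => i _; rewrite coef_map /= !tofracM !tofracXn tofracN tofrac1.
rewrite -mulrA; congr (_ * _); rewrite /z_at -mulN1r exprMn -mulrA; congr (_ * _).
have i_le : (i <= (size p).-1)%N by rewrite -ltnS prednK ?size_poly_gt0.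
by rewrite -{1}(subnKC i_le) exprD exprVn mulKf // expf_neq0.
Qed.

Lemma poly_at_eq0 x p : (poly_at x p == 0) = (p == 0).
Proof.
apply/idP/idP => [|/eqP->]; last by rewrite rmorph0.
case: x => [c|].
  rewrite poly_at_finite tofrac_eq0 fps_poly_eq0.
  by rewrite comp_poly2_eq0 // size_XaddC.
apply: contraTT => /poly_at_oo [g g0 e]; apply: contraNneq g0 => p0.
by move/eqP: e; rewrite p0 mul0r eq_sym tofrac_eq0 => /eqP ->.
Qed.

Lemma rat_atE x p q : q != 0 ->
  rat_at x (tofrac p / tofrac q) = poly_at x p / poly_at x q.
Proof.
move=> q0; rewrite /rat_at -/(poly_at x _) -/(poly_at x _).
have := denom_ratioP (repr (tofrac p / tofrac q)).
have := frac_reprE (tofrac p / tofrac q).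
set n := (frac _).1; set m := (frac _).2 => e m0.
apply/eqP; rewrite eqr_div ?poly_at_eq0 // -!rmorphM /=; apply/eqP; congr poly_at.
by apply/esym/tofrac_div_eq.
Qed.

Lemma rat_at_tofrac x p : rat_at x (tofrac p) = poly_at x p.
Proof.
by rewrite -[tofrac p]divr1 -tofrac1 rat_atE ?oner_eq0 // rmorph1 divr1.
Qed.

Lemma rat_at_zmod x : zmod_morphism (@rat_at K x).
Proof.
move=> f g; have [p [q [q0 ->]]] := frac_ex f; have [r [s [s0 ->]]] := frac_ex g.
rewrite -mulNr -tofracN addf_div ?tofrac_eq0 // -!tofracM -tofracD.
rewrite !rat_atE ?mulf_neq0 // !rmorphD !rmorphM rmorphN /=.
by rewrite -addf_div ?poly_at_eq0 // mulNr.
Qed.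

Lemma rat_at_monoid x : monoid_morphism (@rat_at K x).
Proof.
split=> [|f g]; first by rewrite -tofrac1 rat_at_tofrac rmorph1.
have [p [q [q0 ->]]] := frac_ex f; have [r [s [s0 ->]]] := frac_ex g.
rewrite mulf_div -!tofracM !rat_atE ?mulf_neq0 // !rmorphM /=.
by rewrite mulf_div.
Qed.
HB.instance Definition _ x :=
  GRing.isZmodMorphism.Build (ratfun K) (laurent K) (@rat_at K x) (rat_at_zmod x).
HB.instance Definition _ x :=
  GRing.isMonoidMorphism.Build (ratfun K) (laurent K) (@rat_at K x)
    (rat_at_monoid x).

Lemma rat_atB x f g : rat_at x (f - g) = rat_at x f - rat_at x g.
Proof. exact: rat_at_zmod. Qed.

Lemma rat_atM x f g : rat_at x (f * g) = rat_at x f * rat_at x g.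
Proof. by case: (rat_at_monoid x). Qed.

Lemma rat_at_ratC x a : rat_at x (ratC a) = laurC a.
Proof. by rewrite rat_at_tofrac /poly_at map_polyC hornerC. Qed.

Lemma rat_regularM c f g :
  rat_regular c f -> rat_regular c g -> rat_regular c (f * g).
Proof.
move=> [p [q [qc ->]]] [r [s [sc ->]]]; exists (p * r), (q * s).
by rewrite hornerM mulf_neq0 // mulf_div !tofracM.
Qed.

Lemma rat_regularN c f : rat_regular c f -> rat_regular c (- f).
Proof.
by move=> [p [q [qc ->]]]; exists (- p), q; rewrite tofracN mulNr.
Qed.

Lemma rat_regular_tofrac c p : rat_regular c (tofrac p).
Proof. by exists p, 1; rewrite hornerC oner_eq0 tofrac1 divr1. Qed.

(** In lowest terms, a root c of the denominator would give p(c) r(0) = 0 on constant terms, hence a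
    common root of coprime polynomials. *)
Lemma rat_at_regular c f (r s : fps K) : fps_coef0 r != 0 ->
  rat_at (Some c) f * tofrac r = tofrac s -> rat_regular c f.
Proof.
have [p [q [cpq q0 ->]]] := frac_coprimeE f => r0.
rewrite rat_atE // => e; exists p, q; split=> //; apply/negP => qc.
have {e} : poly_at (Some c) p * tofrac r = tofrac s * poly_at (Some c) q.
  by rewrite -e mulrAC divfK // poly_at_eq0.
rewrite !poly_at_finite -!tofracM => /eqP; rewrite tofrac_eq => /eqP.
move/(congr1 fps_coef0); rewrite !rmorphM /= !poly_at_finite_coef0.
rewrite (eqP qc) mulr0 => /eqP; rewrite mulf_eq0 (negbTE r0) orbF.
by apply/negP; apply: (coprimep_root (p := q)); rewrite 1?coprimep_sym.
Qed.

End Expansion.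

Arguments rat_at {K} x f : simpl never.

(** A reduced denominator without roots is constant over an algebraically closed field. *)
Lemma rat_regular_poly (K : closedFieldType) (f : ratfun K) :
  (forall c, rat_regular c f) -> exists p, f = tofrac p.
Proof.
have [p [q [cpq q0 ->]]] := frac_coprimeE f => reg.
have [[c qc]|] := altP (closed_rootP q).
  have [r [s [sc /tofrac_div_eq e]]] := reg c.
  have /(congr1 (horner^~ c)) : p * s = r * q.
    by apply: e => //; apply: contraNneq sc => ->; rewrite horner0.
  rewrite !hornerM (eqP qc) mulr0 => /eqP; rewrite mulf_eq0 (negbTE sc) orbF.
  have := coprimep_root (p := q) (q := p) _ qc; rewrite coprimep_sym => /(_ cpq).
  by move/negbTE ->.
rewrite negbK => /eqP/eqP/size_poly1P [a a0 ->].
exists (a^-1 *: p); apply: (canLR (mulfK _)).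
  by rewrite tofrac_eq0 polyC_eq0.
by rewrite -tofracM mulrC mul_polyC scalerA divff // scale1r.
Qed.

(** * The Wronskian equation and the Bethe equations *)

Section LogarithmicDerivative.
Context {R : comNzRingType} {F : fieldType}.
Variables phi delta : R -> F.
Hypothesis phi1 : phi 1 = 1.
Hypothesis phiM : {morph phi : x y / x * y}.
Hypothesis deltaM : forall x y, delta (x * y) = delta x * phi y + phi x * delta y.

Let delta1 : delta 1 = 0.
Proof.
apply: (addrI (delta 1)); rewrite addr0.
by rewrite -{3}[1]mulr1 deltaM phi1 mulr1 mul1r.
Qed.

Lemma log_derivX x k : phi x != 0 ->
  delta (x ^+ k) = phi (x ^+ k) * (k%:R * (delta x / phi x)).
Proof.
move=> x0; elim: k => [|k IHk]; first by rewrite delta1 mul0r mulr0.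
rewrite exprS deltaM IHk phiM -{1}[k.+1]addn1 natrD.
by field.
Qed.

(** Keeping phi and delta abstract covers two cases: evaluation at a point w with the derivative at
    w, and the embedding into K(z) with [Dz]. *)
Lemma log_deriv_prod (I : finType) (P : pred I) (f : I -> R) (k : I -> nat) :
  (forall i, P i -> phi (f i) != 0) ->
  delta (\prod_(i | P i) f i ^+ k i) =
  phi (\prod_(i | P i) f i ^+ k i) *
    \sum_(i | P i) (k i)%:R * (delta (f i) / phi (f i)).
Proof.
move=> f0; elim/big_rec2: _ => [|i s x Pi IH]; first by rewrite delta1 mulr0.
rewrite deltaM phiM IH log_derivX ?f0 //; ring.
Qed.

End LogarithmicDerivative.

Lemma prod_XsubC_neq0 (K : fieldType) (I : finType) (P : pred I) (z : I -> K)
    (l : I -> nat) (w : K) :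
  (forall i, P i -> w != z i) -> (\prod_(i | P i) ('X - (z i)%:P) ^+ l i).[w] != 0.
Proof.
move=> wz; rewrite horner_prod prodf_seq_neq0; apply/allP => i _.
by apply/implyP => Pi; rewrite horner_exp expf_neq0 // hornerXsubC subr_eq0 wz.
Qed.

Lemma log_deriv_horner (K : fieldType) (I : finType) (P : pred I) (z : I -> K)
    (l : I -> nat) (w : K) (p := \prod_(i | P i) ('X - (z i)%:P) ^+ l i) :
  (forall i, P i -> w != z i) ->
  p^`().[w] = p.[w] * \sum_(i | P i) (l i)%:R / (w - z i).
Proof.
move=> wz; rewrite (@log_deriv_prod _ _ (horner^~ w) (fun q => q^`().[w])).
- congr (_ * _); apply: eq_bigr => i _.
  by rewrite derivXsubC -polyC1 hornerC hornerXsubC mul1r.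
- by rewrite hornerC.
- by move=> x y; rewrite hornerM.
- by move=> x y; rewrite derivM hornerD !hornerM.
- by move=> i Pi; rewrite !hornerE subr_eq0 wz.
Qed.

Lemma log_deriv_Dz (K : fieldType) (I : finType) (z : I -> K) (l : I -> nat)
    (p := \prod_i ('X - (z i)%:P) ^+ l i) :
  Dz (tofrac p) / tofrac p = \sum_i (l i)%:R / tofrac ('X - (z i)%:P).
Proof.
have p0 : tofrac p != 0.
  by rewrite tofrac_eq0; apply/prodf_neq0 => i _; rewrite expf_neq0 // polyXsubC_eq0.
apply: (canLR (mulfK p0)); rewrite mulrC.
rewrite (@log_deriv_prod _ _ (@tofrac {poly K}) (fun q => Dz (tofrac q))).
- congr (_ * _); apply: eq_bigr => i _.
  by rewrite Dz_tofrac derivXsubC tofrac1 mul1r.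
- exact: tofrac1.
- by move=> x y; rewrite tofracM.
- by move=> x y; rewrite tofracM DzM.
- by move=> i _; rewrite tofrac_eq0 polyXsubC_eq0.
Qed.

Lemma log_derivZ_Dz (K : fieldType) (c : K) (p : {poly K}) : c != 0 ->
  Dz (tofrac (c *: p)) / tofrac (c *: p) = Dz (tofrac p) / tofrac p.
Proof.
move=> c0; rewrite !Dz_tofrac derivZ -!mul_polyC !tofracM -mulf_div divff ?mul1r //.
by rewrite tofrac_eq0 polyC_eq0.
Qed.

Lemma quotient_log_deriv (F : fieldType) (d : F -> F) (f g h : F) :
  (forall x y, d (x * y) = d x * y + x * d y) -> f != 0 -> f = g / h ->
  d f / f = d g / g - d h / h.
Proof.
move=> dM f0 fE; have h0 : h != 0.
  by apply: contraNneq f0 => h0; rewrite fE h0 invr0 mulr0.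
have -> : g = f * h by rewrite fE divfK.
by rewrite dM; field; rewrite f0 h0.
Qed.

(** * Degrees and roots in the Wronskian equation *)

Section Wronskian.
Context {K : closedFieldType}.
Hypothesis K0 : [pchar K] =i pred0.
Implicit Types p q V Q : {poly K}.

(** For degrees v and q, the coefficient of X (V Q' - V' Q) in degree v + q is q - v times the
    product of the leading coefficients; it is nonzero because v and q differ and the characteristic
    is 0. *)
Lemma wronskian_size V Q p : V != 0 -> Q != 0 -> size V != size Q ->
  V * Q^`() - V^`() * Q = p ^+ 2 ->
  ((size V).-1 + (size Q).-1 = ((size p).-1).*2.+1)%N.
Proof.
move=> V0 Q0 VQ W; set v := (size V).-1; set q := (size Q).-1.
have sV : size V = v.+1 by rewrite prednK ?size_poly_gt0.
have sQ : size Q = q.+1 by rewrite prednK ?size_poly_gt0.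
have [vq|vq] : (v + q)%N = 0%N \/ (0 < v + q)%N by case: (v + q)%N; auto.
  case/negP: VQ; rewrite sV sQ.
  by move/eqP: vq; rewrite addn_eq0 => /andP[/eqP-> /eqP->].
(* The operator X d/dX preserves the degree bound and multiplies the k-th coefficient by k,
   uniformly down to degree 0. *)
have sX (f : {poly K}) k : (size f <= k.+1)%N ->
    (size ('X * f^`())%R <= k.+1)%N /\ ('X * f^`())`_k = f`_k *+ k.
  move=> fk; split; last first.
    by rewrite coefXM; case: k fk => // k _; rewrite coef_deriv.
  apply/leq_sizeP => j kj; rewrite coefXM; case: j kj => // j kj.
  by rewrite coef_deriv; move/leq_sizeP: fk => -> //; rewrite mul0rn.
have top (f g : {poly K}) i j : (size f <= i.+1)%N -> (size g <= j.+1)%N ->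
    (f * g)`_(i + j) = f`_i * g`_j.
  move=> fi gj; have il : (i < (i + j).+1)%N by rewrite ltnS leq_addr.
  rewrite coefM (bigD1 (Ordinal il)) //= addKn big1 ?addr0 // => s.
  rewrite -val_eqE /= neq_ltn => /orP[si|sgi].
    have -> : g`_(i + j - s) = 0; last by rewrite mulr0.
    by move/leq_sizeP: gj; apply; rewrite ltn_subRL ltn_add2r.
  have -> : f`_s = 0; last by rewrite mul0r.
  by move/leq_sizeP: fi; apply.
have XW : V * ('X * Q^`()) - 'X * V^`() * Q = 'X * p ^+ 2.
  by rewrite -W mulrBr !mulrA [V * 'X]mulrC.
have [sV1 sV2] := sX V v (eq_leq sV); have [sQ1 sQ2] := sX Q q (eq_leq sQ).
have lead : ('X * p ^+ 2)`_(v + q) != 0.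
  rewrite -XW coefB !top ?sV ?sQ // sV2 sQ2 mulrnAl mulrnAr.
  have := VQ; rewrite sV sQ eqSS => vq'.
  have c0 : V`_v * Q`_q != 0 by rewrite mulf_neq0 // -lead_coefE lead_coef_eq0.
  have natK (k : nat) : (V`_v * Q`_q *+ k == 0) = (k == 0)%N.
    by rewrite -mulr_natr mulf_eq0 (negbTE c0) /= (iffLR (pcharf0P _) K0).
  have [qv|qv] := leqP v q.
    by rewrite -mulrnBr // natK subn_eq0 -ltnNge ltn_neqAle vq'.
  rewrite -opprB -mulrnBr ?(ltnW qv) // oppr_eq0 natK subn_eq0 -ltnNge //.
have szW : size ('X * p ^+ 2) = (v + q).+1.
  apply/eqP; rewrite eqn_leq; apply/andP; split; last first.
    by rewrite ltnNge; apply: contraNN lead => /leq_sizeP ->.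
  rewrite -XW (leq_trans (size_polyD _ _)) // size_polyN geq_max.
  have sM (f g : {poly K}) i j : (size f <= i.+1)%N -> (size g <= j.+1)%N ->
      (size (f * g)%R <= (i + j).+1)%N.
    move=> fi gj; apply: leq_trans (size_polyMleq _ _) _.
    by rewrite -subn1 leq_subLR add1n -addnS -addSn leq_add.
  by rewrite !sM ?sV ?sQ.
have p0 : p != 0.
  by apply: contraNneq lead => ->; rewrite expr0n mulr0 coef0.
move: szW; rewrite mulrC size_mulX ?expf_neq0 // => -[e].
by have := size_exp p 2; rewrite e muln2 => <-; rewrite prednK.
Qed.

(** Put R = Q / (c (X - w_j)), with c the leading coefficient of Q. Then Q' = c R and Q'' = 2 c R'
    at w_j, so the derivative of the Wronskian equation divided by the equation gives R' / R = p' /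
    p there. This is half the Bethe equation; p(w_j) is nonzero because no z_i is a root of Q. *)
Lemma bethe_roots N (z : 'I_N -> K) (l : 'I_N -> nat) V Q
    (p := \prod_i ('X - (z i)%:P) ^+ l i) :
  Q != 0 -> (forall i, Q.[z i] != 0) -> V * Q^`() - V^`() * Q = p ^+ 2 ->
  exists w : 'I_(size Q).-1 -> K,
    [/\ Q = lead_coef Q *: \prod_j ('X - (w j)%:P), injective w,
        forall i j, w j <> z i &
        forall j, \sum_i (2 * l i)%N%:R / (w j - z i) -
          \sum_(s | s != j) 2%:R / (w j - w s) = 0].
Proof.
move=> Q0 Qz W; have [r Qr] := closed_field_poly_normal Q.
have lQ0 : lead_coef Q != 0 by rewrite lead_coef_eq0.
have szQ : (size Q).-1 = size r by rewrite Qr size_scale // size_prod_XsubC.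
rewrite szQ; pose w (j : 'I_(size r)) := r`_j; exists w.
have Qw : Q = lead_coef Q *: \prod_j ('X - (w j)%:P).
  by rewrite {1}Qr (big_nth 0) big_mkord.
(* The exponent 1 gives the product the shape expected by [log_deriv_horner]. *)
pose Rj (j : 'I_(size r)) := \prod_(s | s != j) ('X - (w s)%:P) ^+ 1.
have QR j : Q = lead_coef Q *: (('X - (w j)%:P) * Rj j).
  rewrite {1}Qw (bigD1 j) //; congr (_ *: (_ * _)).
have Qw0 j : Q.[w j] = 0.
  by rewrite (QR j) hornerZ hornerM hornerXsubC subrr mul0r mulr0.
have wz i j : w j <> z i.
  by move=> e; move/negP: (Qz i); apply; rewrite -e Qw0.
have Q'w j : Q^`().[w j] = lead_coef Q * (Rj j).[w j].
  rewrite {1}(QR j) derivZ derivM derivXsubC mul1r hornerZ.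
  by rewrite hornerD hornerM hornerXsubC subrr mul0r addr0.
have Q''w j : Q^`()^`().[w j] = lead_coef Q * ((Rj j)^`().[w j] *+ 2).
  rewrite {1}(QR j) derivZ derivM derivXsubC mul1r derivZ derivD derivM.
  rewrite derivXsubC mul1r hornerZ !hornerD hornerM hornerXsubC subrr mul0r addr0.
  by rewrite mulr2n.
have pw j : p.[w j] != 0 by apply: prod_XsubC_neq0 => i _; apply/eqP/wz.
have Ww j : V.[w j] * Q^`().[w j] = p.[w j] ^+ 2.
  by rewrite -horner_exp -W hornerD hornerN !hornerM Qw0 mulr0 subr0.
have W'w j : V.[w j] * Q^`()^`().[w j] = p.[w j] * p^`().[w j] *+ 2.
  have /(congr1 (fun f => f^`().[w j])) := W; rewrite expr2 derivB !derivM.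
  rewrite !(hornerD, hornerN, hornerM) Qw0 mulr0 add0r.
  move=> e; rewrite mulr2n {1}[p.[w j] * _]mulrC -e.
  ring.
have Q'0 j : Q^`().[w j] != 0.
  by apply: contra_eq_neq (Ww j) => ->; rewrite mulr0 eq_sym expf_neq0.
have winj : injective w.
  move=> i j wij; apply/eqP; rewrite eq_sym; apply: contraT => ij.
  have /negP[] := Q'0 i; rewrite Q'w /Rj (bigD1 j) //= expr1 hornerM hornerXsubC.
  by rewrite wij subrr mul0r mulr0.
split=> // j; have ws s : s != j -> w j != w s.
  by move=> sj; apply: contraNneq sj => /winj ->.
have Rj0 : (Rj j).[w j] != 0 by apply: prod_XsubC_neq0.
have lR := log_deriv_horner (fun=> 1%N) ws; rewrite -/(Rj j) in lR.
have lp := @log_deriv_horner _ _ predT z l (w j) (fun i _ => introN eqP (wz i j)).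
rewrite -/p in lp.
have -> : \sum_i (2 * l i)%N%:R / (w j - z i) = 2 * (p^`().[w j] / p.[w j]).
  rewrite lp [_ / p.[w j]]mulrC mulKf // mulr_sumr.
  by apply: eq_bigr => i _; rewrite natrM mulrA.
have -> : \sum_(s | s != j) 2%:R / (w j - w s) = 2 * ((Rj j)^`().[w j] / (Rj j).[w j]).
  rewrite lR [_ / (Rj j).[w j]]mulrC mulKf // mulr_sumr.
  by apply: eq_bigr => i _; rewrite mul1r.
have V0 : V.[w j] != 0.
  by apply: contra_eq_neq (Ww j) => ->; rewrite mul0r eq_sym expf_neq0.
apply/eqP; rewrite -mulrBr mulf_eq0; apply/orP; right; rewrite subr_eq0 eqr_div //.
have e1 := Ww j; have e2 := W'w j; rewrite Q'w in e1; rewrite Q''w in e2.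
have two0 : (2 : K) != 0 by rewrite (iffLR (pcharf0P _) K0).
apply/eqP; apply: (mulfI (mulf_neq0 two0 (mulf_neq0 (mulf_neq0 V0 lQ0) (pw j)))).
transitivity (p.[w j] * p^`().[w j] *+ 2 * (V.[w j] * (lead_coef Q * (Rj j).[w j]))).
  by ring.
by rewrite -e2 e1; ring.
Qed.

End Wronskian.

(** * Degrees read off from orders at infinity *)

Section Infinity.
Context {K : fieldType}.
Implicit Types (u v r s : fps K) (p q : {poly K}).

Lemma fps_valuation_le u v a b : fps_coef0 u != 0 ->
  u * fps_X K ^+ a = v * fps_X K ^+ b -> (b <= a)%N.
Proof.
move=> u0 e; rewrite leqNgt; apply: contraNN u0 => ab.
have X0 : fps_X K ^+ a != 0.
  by rewrite expf_neq0 // -fps_polyX fps_poly_eq0 polyX_eq0.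
have -> : u = v * fps_X K ^+ (b - a).
  by apply: (mulIf X0); rewrite e -mulrA -exprD subnK // ltnW.
rewrite rmorphM rmorphXn /= [fps_coef0 (fps_X K)](_ : _ = 0) //.
by rewrite expr0n subn_eq0 leqNgt ab mulr0.
Qed.

(** Both sides are compared by their order in t, where a polynomial of degree e has order - e. The
    constant term of s decides between equality and strict inequality: V will fall in the first case
    and Q in the second. *)
Lemma degree_oo p q r s k : p != 0 -> q != 0 -> fps_coef0 r != 0 ->
  poly_at None p * laurT K ^+ k * tofrac r = tofrac s * poly_at None q ->
  (fps_coef0 s != 0 -> (size p).-1 = ((size q).-1 + k)%N) /\
  (fps_coef0 s = 0 -> ((size p).-1 < (size q).-1 + k)%N).
Proof.
move=> p0 q0 r0 e; have [gp gp0 ep] := poly_at_oo p0; have [gq gq0 eq] := poly_at_oo q0.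
set a := (size p).-1 in ep *; set b := (size q).-1 in eq *.
have e' : gp * r * fps_X K ^+ (b + k) = s * gq * fps_X K ^+ a.
  apply/eqP; rewrite -tofrac_eq !tofracM !tofracXn -ep -eq.
  rewrite -/(laurT K) exprD; apply/eqP.
  transitivity (poly_at None p * laurT K ^+ k * tofrac r * laurT K ^+ a * laurT K ^+ b).
    by ring.
  by rewrite e; ring.
have grp : fps_coef0 (gp * r) != 0 by rewrite rmorphM mulf_neq0.
have le1 := fps_valuation_le grp e'; split=> s0.
  apply/eqP; rewrite eqn_leq le1 /=; apply: (fps_valuation_le _ (esym e')).
  by rewrite rmorphM mulf_neq0.
rewrite ltn_neqAle le1 andbT; apply: contraNneq grp => ab.
have X0 : fps_X K ^+ a != 0.
  by rewrite expf_neq0 // -fps_polyX fps_poly_eq0 polyX_eq0.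
rewrite -ab in e'; rewrite (mulIf X0 e') rmorphM /= s0 mul0r eqxx //.
Qed.

End Infinity.

(** * Restriction to formal superdiscs *)

Section Restriction.
Context {K : fieldType} {n : nat}.
Local Notation sfun := (superfun K n).
Local Notation dfun := (grassmann n.+1 (laurent K)).
Implicit Types (x : option K) (F G : sfun).

Lemma gbody_res x F : gbody (res x F) = rat_at x (gbody F).
Proof. by rewrite /gbody ffunE inE mulr1. Qed.

Lemma res_parity x b F : gparity b F -> gparity b (res x F).
Proof.
move=> pF I; rewrite ffunE; have [->|/pF //] := eqVneq (F I) 0.
by rewrite rmorph0 mul0r eqxx.
Qed.

Lemma res_zmod x : zmod_morphism (@res K n x).
Proof.
move=> F G; apply/ffunP => I.
by rewrite [RHS]gaddE goppE !ffunE rat_atB mulrBl.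
Qed.

Lemma res_monoid x : monoid_morphism (@res K n x).
Proof.
split=> [|F G]; apply/ffunP => I.
  rewrite ffunE !goneE rmorph_nat; case: eqP => [->|_]; last by rewrite mul0r.
  by rewrite inE mulr1.
rewrite ffunE !gmulE rmorph_sum mulr_suml /=; apply: eq_bigr => J JI.
rewrite !ffunE !rat_atM rmorph_sign.
move: (rat_at x (F J)) (rat_at x (G _)) => a b.
(* If theta occurs in the product it occurs in exactly one of the two factors, so its rescaling is
   multiplicative. *)
have -> : (ord0 \in I : nat) = ((ord0 \in J) + (ord0 \in I :\: J))%N.
  by rewrite inE; case J0: (ord0 \in J) => //=; rewrite (subsetP JI).
by rewrite exprD -!mulrA; congr (_ * (_ * _)); rewrite mulrCA.
Qed.

HB.instance Definition _ x :=
  GRing.isZmodMorphism.Build sfun dfun (@res K n x) (res_zmod x).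
HB.instance Definition _ x :=
  GRing.isMonoidMorphism.Build sfun dfun (@res K n x) (res_monoid x).

Lemma res_mxM x (M N : 'M[sfun]_3) :
  map_mx (res x) (M *m N) = map_mx (res x) M *m map_mx (res x) N.
Proof. exact: map_mxM. Qed.

Lemma res_even x (M : 'M[sfun]_3) : smx_even M -> smx_even (map_mx (res x) M).
Proof. by move=> eM i j; rewrite mxE; apply: res_parity. Qed.

Lemma res_sinv x (M : 'M[sfun]_3) :
  map_mx (res x) (sinv M) = sinv (map_mx (res x) M).
Proof. by rewrite sinv_map // => F; apply: raddfN. Qed.

End Restriction.

(** * Regular functions on the formal superdisc and their values *)

Section Disc.
Context {K : fieldType} {n : nat}.
Local Notation dfun := (grassmann n.+1 (laurent K)).
Implicit Types (F G : dfun) (M N : 'M[dfun]_3).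

Lemma disc_regularD F G : disc_regular F -> disc_regular G -> disc_regular (F + G).
Proof. by move=> rF rG I; rewrite gaddE; apply: laur_regularD. Qed.

Lemma disc_regularN F : disc_regular F -> disc_regular (- F).
Proof. by move=> rF I; rewrite goppE; apply: laur_regularN. Qed.

Lemma laur_regular_sign k (f : laurent K) :
  laur_regular f -> laur_regular ((-1) ^+ k * f).
Proof.
by move=> rf; rewrite -signr_odd; case: odd; rewrite ?mulN1r ?mul1r //;
  apply: laur_regularN.
Qed.

Lemma laur_regular_sum (I : Type) (r : seq I) (P : pred I) (f : I -> laurent K) :
  (forall i, P i -> laur_regular (f i)) ->
  laur_regular (\sum_(i <- r | P i) f i).
Proof.
by move=> rf; elim/big_ind: _ => //; [apply: laur_regular0|apply: laur_regularD].
Qed.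

Lemma disc_regularM F G : disc_regular F -> disc_regular G -> disc_regular (F * G).
Proof.
move=> rF rG I; rewrite gmulE; apply: laur_regular_sum => J _.
by apply/laur_regular_sign/laur_regularM.
Qed.

Lemma disc_regular_mulmx M N : mx_all (@disc_regular K n) M ->
  mx_all (@disc_regular K n) N -> mx_all (@disc_regular K n) (M *m N).
Proof.
by move=> rM rN i j; rewrite mulmx3; do !apply: disc_regularD;
  apply: disc_regularM.
Qed.

Lemma disc_regular_sinv M :
  mx_all (@disc_regular K n) M -> mx_all (@disc_regular K n) (sinv M).
Proof.
move=> rM i; apply: ord3_ind; move: i; apply: ord3_ind; rewrite sinvE;
  by [|apply: disc_regularN].
Qed.

Lemma laur_coef0_sign k (f : laurent K) : laur_regular f ->
  laur_coef0 ((-1) ^+ k * f) = (-1) ^+ k * laur_coef0 f.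
Proof.
by move=> rf; rewrite -!(signr_odd _ k); case: odd;
  rewrite /= ?expr0 ?expr1 ?mulN1r ?mul1r ?laur_coef0N.
Qed.

Lemma laur_coef0_sum (I : Type) (r : seq I) (P : pred I) (f : I -> laurent K) :
  (forall i, P i -> laur_regular (f i)) ->
  laur_coef0 (\sum_(i <- r | P i) f i) = \sum_(i <- r | P i) laur_coef0 (f i).
Proof.
move=> rf; suff [] : laur_regular (\sum_(i <- r | P i) f i) /\
  laur_coef0 (\sum_(i <- r | P i) f i) = \sum_(i <- r | P i) laur_coef0 (f i) by [].
elim/big_rec2: _ => [|i s1 s2 Pi [r2 <-]].
  by split; [apply: laur_regular0|apply: laur_coef00].
have rFi := rf i Pi; rewrite laur_coef0D //; split=> //.
exact: laur_regularD.
Qed.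

Let lift0 : 'I_n -> 'I_n.+1 := lift ord0.
Let lift0_inj : injective lift0 := @lift_inj _ ord0.

Lemma gsign_lift (I J : {set 'I_n}) :
  gsign K (lift0 @: I) (lift0 @: J) = gsign K I J.
Proof.
rewrite /gsign /ginversions; congr (_ ^+ _).
rewrite big_imset /=; last by move=> ? ? _ _; apply: lift0_inj.
apply: eq_bigr => i _; rewrite big_imset /=; last first.
  by move=> ? ? _ _; apply: lift0_inj.
by apply: eq_bigr => j _; rewrite /bump !leq0n !add1n ltnS.
Qed.

Lemma disc_valueD F G : disc_regular F -> disc_regular G ->
  disc_value (F + G) = disc_value F + disc_value G.
Proof.
move=> rF rG; apply/ffunP => I; rewrite [RHS]gaddE !ffunE.
exact: laur_coef0D (rF _) (rG _).
Qed.

(** Every subset of a lifted index set is itself lifted, so no theta component contributes, and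
    lifting preserves the order of the generators, hence the signs. *)
Lemma disc_valueM F G : disc_regular F -> disc_regular G ->
  disc_value (F * G) = disc_value F * disc_value G.
Proof.
move=> rF rG; apply/ffunP => I; rewrite ffunE !gmulE.
rewrite laur_coef0_sum; last first.
  by move=> J _; apply/laur_regular_sign/laur_regularM; [apply: rF|apply: rG].
rewrite (reindex_onto (fun J : {set 'I_n} => lift0 @: J) (fun J => lift0 @^-1: J)) /=.
  apply: eq_big => [J|J /andP[_ /eqP JJ]].
    have -> : lift0 @^-1: (lift0 @: J) = J.
      by apply/setP => i; rewrite inE mem_imset.
    rewrite eqxx andbT; apply/subsetP/subsetP => sub i iJ.
      by have := sub _ (imset_f lift0 iJ); rewrite mem_imset.
    by case/imsetP: iJ => j jJ ->; rewrite imset_f // sub.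
  have -> : (lift ord0 @: I) :\: (lift0 @: J) = lift0 @: (I :\: J).
    apply/setP => i; rewrite inE; apply/andP/imsetP => [[nJ /imsetP[j jI ij]]|].
      exists j => //; rewrite inE jI andbT; apply: contra nJ => jJ.
      by rewrite ij; apply: imset_f.
    by case=> j; rewrite inE => /andP[nJ jI] ->; rewrite !mem_imset.
  rewrite {1}/gsign laur_coef0_sign; last exact: laur_regularM (rF _) (rG _).
  rewrite laur_coef0M; [|exact: rF|exact: rG].
  by rewrite !ffunE; congr (_ * _); rewrite -gsign_lift.
move=> J JI; apply/setP => i; apply/imsetP/idP => [[j]|iJ]; first by rewrite inE => ? ->.
by have /imsetP[j jI ij] := subsetP JI _ iJ; exists j => //; rewrite inE /lift0 -ij.
Qed.

Lemma disc_value_mulmx M N : mx_all (@disc_regular K n) M ->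
  mx_all (@disc_regular K n) N ->
  map_mx (@disc_value K n) (M *m N) =
  map_mx (@disc_value K n) M *m map_mx (@disc_value K n) N.
Proof.
move=> rM rN; apply/matrixP => i j; rewrite mxE !mulmx3.
have rMN k : disc_regular (M i k * N k j) by apply: disc_regularM.
have rMN2 := disc_regularD (rMN i1) (rMN i2).
rewrite (disc_valueD rMN2 (rMN i3)) (disc_valueD (rMN i1) (rMN i2)).
rewrite (disc_valueM (rM _ _) (rN _ _)) (disc_valueM (rM _ i2) (rN _ _)).
by rewrite (disc_valueM (rM _ i3) (rN _ _)) ![map_mx _ _ _ _]mxE.
Qed.

Lemma disc_valueN F : disc_regular F -> disc_value (- F) = - disc_value F.
Proof.
by move=> rF; apply/ffunP => I; rewrite [RHS]goppE !ffunE laur_coef0N.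
Qed.

Lemma disc_value_sinv M : mx_all (@disc_regular K n) M ->
  map_mx (@disc_value K n) (sinv M) = sinv (map_mx (@disc_value K n) M).
Proof.
move=> rM; apply: eq_mx3; apply: ord3_ind;
  by rewrite [LHS]mxE sinvE [in RHS]sinvE mxE ?(disc_valueN (rM _ _)).
Qed.

Lemma gbody_disc_value F : gbody (disc_value F) = disc_body F.
Proof. by rewrite /disc_body /gbody ffunE imset0. Qed.

End Disc.

(** * The kernel of the superderivative *)

Section DConstants.
Context {K : fieldType} {n : nat}.
Hypothesis K0 : [pchar K] =i pred0.
Local Notation sfun := (superfun K n).
Implicit Types F : sfun.

(** The theta-free components of D F are the theta components of F, and the theta components of D F
    are the derivatives of the theta-free ones. *)
Lemma Dtheta_constant F : Dtheta (@Dz K) F = 0 ->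
  forall I : {set 'I_n.+1}, if ord0 \in I then F I = 0 else exists c, F I = ratC c.
Proof.
move=> DF I; case: ifPn => I0.
  have /ffunP/(_ (I :\ ord0)) := DF.
  rewrite DthetaE gaddE theta_mulE ffunE gzeroE !inE eqxx /= addr0.
  by rewrite setD1K.
apply: (Dz_eq0 K0); have /ffunP/(_ (ord0 |: I)) := DF.
rewrite DthetaE gaddE theta_mulE !ffunE !inE eqxx /= add0r.
by rewrite setU1K.
Qed.

(** A D-constant has no theta and constant coefficients, so its expansion at any place, oo included,
    is regular and its value there recovers it. *)
Lemma Dtheta_constant_eq0 x F : Dtheta (@Dz K) F = 0 ->
  disc_regular (res x F) /\ (disc_value (res x F) = 0 -> F = 0).
Proof.
move=> /Dtheta_constant cF; split=> [I|F0].
  rewrite ffunE; have := cF I; case: ifP => [I0 ->|I0 [c ->]].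
    by rewrite rmorph0 mul0r; apply: laur_regular0.
  by rewrite mulr1 rat_at_ratC; apply: laur_regularC.
apply/ffunP => I; rewrite gzeroE; have := cF I; case: ifPn => // I0 [c Fc].
have /ffunP/(_ (lift ord0 @^-1: I)) := F0; rewrite !ffunE.
have -> : lift ord0 @: (lift ord0 @^-1: I) = I.
  apply/setP => i; apply/imsetP/idP => [[j]|iI]; first by rewrite inE => ? ->.
  case: (unliftP ord0 i) iI => [j ->|->] iI; last by rewrite iI in I0.
  by exists j; rewrite ?inE.
by rewrite (negbTE I0) mulr1 Fc rat_at_ratC laur_coef0C => ->; rewrite /ratC polyC0 tofrac0.
Qed.

End DConstants.

(** * Flat frames and the Cartan connection *)

Section OperEntries.
Context {n : nat} {A : comNzRingType}.
Variables a u c v : grassmann n A.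

Definition borel_mx : 'M[grassmann n A]_3 :=
  u *: coweight + c *: osp_e n A + v *: osp_e2 n A.

Definition oper_mx : 'M[grassmann n A]_3 := a *: osp_f + borel_mx.

Lemma borel_entries :
  (borel_mx i1 i1 = u) * (borel_mx i2 i1 = 0) * (borel_mx i3 i1 = 0) *
  (borel_mx i1 i3 = c) * (borel_mx i2 i3 = 0) * (borel_mx i3 i3 = 0).
Proof.
by do !split; rewrite !mxE /=
  ?(mulr0, mulr1, subr0, sub0r, addr0, add0r, oppr0, mulrN).
Qed.

Lemma osp_f_entries (f := osp_f : 'M[grassmann n A]_3) :
  (f i1 i1 = 0) * (f i2 i1 = 0) * (f i3 i1 = 1) *
  (f i1 i3 = 0) * (f i2 i3 = 1) * (f i3 i3 = 0).
Proof. by do !split; rewrite /f !mxE /= ?(addr0, add0r). Qed.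

Lemma oper_entries :
  (oper_mx i1 i1 = u) * (oper_mx i2 i1 = 0) * (oper_mx i3 i1 = a) *
  (oper_mx i1 i3 = c) * (oper_mx i2 i3 = a) * (oper_mx i3 i3 = 0).
Proof.
have oE i j : oper_mx i j = a * (osp_f : 'M[grassmann n A]_3) i j + borel_mx i j.
  by rewrite mxE [X in X + _]mxE.
by do !split; rewrite oE osp_f_entries borel_entries ?(mulr0, mulr1, addr0, add0r).
Qed.

Lemma cartan_oper_entries (M := osp_f + u *: coweight) :
  (M i1 i1 = u) * (M i1 i2 = 0) * (M i1 i3 = 0) *
  (M i2 i1 = 0) * (M i2 i2 = - u) * (M i2 i3 = 1) *
  (M i3 i1 = 1) * (M i3 i2 = 0) * (M i3 i3 = 0).
Proof.
by rewrite /M; do !split; rewrite !mxE /=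
  ?(mulr0, mulr1, subr0, sub0r, addr0, add0r, oppr0, mulrN).
Qed.

Lemma weyl_s_entries (s := weyl_s : 'M[grassmann n A]_3) :
  (s i1 i1 = 0) * (s i1 i2 = 1) * (s i1 i3 = 0) *
  (s i2 i1 = -1) * (s i2 i2 = 0) * (s i2 i3 = 0) *
  (s i3 i1 = 0) * (s i3 i2 = 0) * (s i3 i3 = 1).
Proof.
by rewrite /s; do !split; rewrite !mxE /=
  ?(mulr0, mulr1, subr0, sub0r, addr0, add0r, oppr0, mulrN).
Qed.

Lemma smxD_entry (d : A -> A) (M : 'M[grassmann n.+1 A]_3) i j :
  smxD d M i j = if i == i3 then - Dtheta d (M i j) else Dtheta d (M i j).
Proof. by rewrite mxE /spar; case: eqP => _; rewrite /= ?expr1 ?mulN1r ?mul1r. Qed.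

End OperEntries.

(** * The normalized frame of the H-reduction *)

Section NormalForm.
Context {n : nat} {A : fieldType}.
Hypothesis A2 : (2 : A) != 0.
Variable d : A -> A.
Hypothesis dD : {morph d : x y / x + y}.
Hypothesis dM : forall x y, d (x * y) = d x * y + x * d y.
Local Notation smx := 'M[grassmann n.+1 A]_3.
Local Notation D := (Dtheta d).

Lemma weyl_s_SPL2 : in_SPL2 (weyl_s : smx).
Proof.
have sE := @weyl_s_entries n.+1 A; apply/(in_SPL2E A2); split.
- move=> i; apply: ord3_ind; move: i; apply: ord3_ind; rewrite sE;
    by [apply: gparity0|apply: gparity1|apply: (gparityN gparity1)].
- apply: eq_mx3; apply: ord3_ind; rewrite mulmx3 !sinvE !sE [RHS]mxE /=;
    by rewrite ?(mulr0, mul0r, mulr1, mul1r, mulrN1, mulN1r, opprK, oppr0,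
      addr0, add0r).
by rewrite sE gbody1.
Qed.

Lemma DthetaV (F : grassmann n.+1 A) : gparity false F -> F \is a GRing.unit ->
  D F^-1 = - (F^-1 * D F * F^-1).
Proof.
move=> eF uF; have := Dtheta_evenM dD dM F^-1 eF.
rewrite mulrV // (Dtheta1 dD dM) => /esym/eqP; rewrite addr_eq0 => /eqP e.
by rewrite -mulrA e mulrN opprK mulKr.
Qed.

Lemma gcoef_log_deriv (F : grassmann n.+1 A) : gparity false F ->
  F \is a GRing.unit ->
  gcoef ord0 (- D F * F^-1) = - (d (gbody F) / gbody F).
Proof.
move=> eF uF; have F0 : gbody F != 0 by rewrite -gunitE.
rewrite gcoefM (gbody_odd (gparityN (Dtheta_parity dD eF))) mul0r add0r.
by rewrite (gbodyV F0) raddfN /= gcoef_Dtheta mulNr.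
Qed.

Variables (X chi : grassmann n.+1 A).
Let w := - D chi.
Hypothesis X_even : gparity false X.
Hypothesis chi_odd : gparity true chi.
Hypothesis w_unit : w \is a GRing.unit.
Hypothesis DX : D X = chi * w.

Let u := - D w * w^-1.

Let w_even : gparity false w.
Proof. exact: gparityN (Dtheta_parity dD chi_odd). Qed.

Lemma normal_form_cartan_odd : gparity true u.
Proof.
exact: gparityM (gparityN (Dtheta_parity dD w_even)) (gparityV w_even).
Qed.

(* A solution Psi of D Psi = Psi (f + u check omega) whose point Psi B of the big
   cell has the coordinates X (even) and chi (odd), with u = - D w / w. *)
Definition normal_form : smx := \matrix_(i, j)
  if i == i1 then (if j == i1 then X * w^-1 else if j == i2 then - w else chi)
  else if i == i2 then (if j == i1 then w^-1 else 0)
  else (if j == i1 then chi * w^-1 else if j == i2 then 0 else 1).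

Lemma normal_form_entries :
  (normal_form i1 i1 = X * w^-1) * (normal_form i1 i2 = - w) *
  (normal_form i1 i3 = chi) * (normal_form i2 i1 = w^-1) *
  (normal_form i2 i2 = 0) * (normal_form i2 i3 = 0) *
  (normal_form i3 i1 = chi * w^-1) * (normal_form i3 i2 = 0) *
  (normal_form i3 i3 = 1).
Proof. by do !split; rewrite mxE. Qed.

Lemma normal_form_SPL2 : in_SPL2 normal_form.
Proof.
have E := normal_form_entries; have ewi := gparityV w_even.
have chiw : chi * w^-1 = w^-1 * chi by rewrite (geven_comm ewi chi_odd).
apply/(in_SPL2E A2); split; last by rewrite E gbody1.
- move=> i; apply: ord3_ind; move: i; apply: ord3_ind; rewrite E;
    first [exact: gparity0|exact: gparity1|exact: ewi|exact: chi_odd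
      |exact: (gparityN w_even)|exact: (gparityM X_even ewi)
      |exact: (gparityM chi_odd ewi)].
apply: eq_mx3; apply: ord3_ind; rewrite mulmx3 !sinvE !E [RHS]mxE /=.
- by rewrite opprK !(mul0r, oppr0, add0r, addr0) mulrV.
- rewrite mulNr (geven_comm ewi (gparityM X_even ewi)) addNr add0r.
  have ochiw : gparity true (chi * w^-1) := gparityM chi_odd ewi.
  by rewrite (godd_sqr A2 ochiw).
- by rewrite mul0r add0r mul1r mulNr addNr.
- by rewrite !(mul0r, mulr0, oppr0, addr0).
- by rewrite !mulr0 !addr0 mulrN mulNr opprK mulVr.
- by rewrite !(mul0r, mulr0, addr0).
- by rewrite !(mul0r, mulr0, oppr0, addr0).
- by rewrite mulr0 addr0 mulr1 mulNr chiw addNr.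
- by rewrite !(mul0r, mulr0) !add0r mulr1.
Qed.

Lemma normal_form_parallel :
  smxD d normal_form = normal_form *m (osp_f + u *: coweight).
Proof.
have E := normal_form_entries; have C := @cartan_oper_entries n.+1 A u.
have ewi := gparityV w_even; have ou := normal_form_cartan_odd.
have wu : w * u = - D w.
  by rewrite (geven_comm w_even ou) /u -mulrA mulVr ?mulr1.
have Dwi : D w^-1 = w^-1 * u.
  by rewrite (DthetaV w_even w_unit) /u mulNr mulrN mulrA.
have D0 := @Dtheta0 n A d dD; have D1 := @Dtheta1 n A d dD dM.
have DN := DthetaN dD.
apply: eq_mx3; apply: ord3_ind; rewrite smxD_entry mulmx3 !E !C /=.
- rewrite (Dtheta_evenM dD dM _ X_even) DX Dwi mulr0 addr0 mulr1.
  by rewrite -mulrA mulrV // mulr1 addrC mulrA.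
- by rewrite Dwi mulr0 addr0 mul0r addr0.
- rewrite (Dtheta_oddM dD dM _ chi_odd) Dwi mulr0 addr0 mul1r opprB mulrA.
  by rewrite -[D chi]opprK -/w mulNr mulrV // opprK.
- by rewrite DN !mulr0 add0r addr0 mulrN mulNr opprK wu.
- by rewrite D0 !(mulr0, mul0r, addr0, oppr0).
- by rewrite D0 !(mulr0, mul0r, addr0, oppr0).
- by rewrite mulr0 add0r mulr1 mulr0 addr0 /w opprK.
- by rewrite D0 !(mulr0, mul0r, addr0, oppr0).
- by rewrite D1 !(mulr0, mul0r, addr0, oppr0).
Qed.

(** The second column of [normal_form] is a multiple of e1, so the constant reduction through e1 is
    opposite to F_B in this frame. The product is the second Borel factor required by
    [H_connection]. *)
Lemma normal_form_opposite : in_B (normal_form *m weyl_s).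
Proof.
have E := normal_form_entries; have sE := @weyl_s_entries n.+1 A.
split; first exact: SPL2M normal_form_SPL2 weyl_s_SPL2.
  by rewrite mulmx3 !E !sE !(mulr0, mul0r, addr0).
by rewrite mulmx3 !E !sE !(mulr0, mul0r, addr0).
Qed.

(** The first columns of Phi and [normal_form] represent the same point of G / B; they differ by the
    factor h = w Phi_21. *)
Lemma normal_form_reduction (Phi : smx) : in_SPL2 Phi ->
  Phi i1 i1 = X * Phi i2 i1 -> Phi i3 i1 = chi * Phi i2 i1 ->
  in_B (sinv normal_form *m Phi).
Proof.
move=> GPhi PX Pchi; have GN := normal_form_SPL2.
have GiN : in_SPL2 (sinv normal_form) by apply: SPL2_inv.
have E := normal_form_entries; pose h := w * Phi i2 i1.
have col i : Phi i i1 = normal_form i i1 * h.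
  by move: i; apply: ord3_ind; rewrite E /h ?PX ?Pchi -?mulrA ?mulKr.
have rel i j : (sinv normal_form *m normal_form) i j = (i == j)%:R.
  by rewrite (SPL2_mulVmx A2 GN) mxE.
have colN i : (sinv normal_form *m Phi) i i1 = (i == i1)%:R * h.
  by rewrite -rel !mulmx3 !mulrDl -!mulrA -!col.
by split; [apply: SPL2M|rewrite colN /= mul0r|rewrite colN /= mul0r].
Qed.

End NormalForm.

(** * Big-cell coordinates of a flat frame *)

Section FlatSolution.
Context {n : nat} {A : fieldType}.
Hypothesis A2 : (2 : A) != 0.
Variable d : A -> A.
Hypothesis dD : {morph d : x y / x + y}.
Hypothesis dM : forall x y, d (x * y) = d x * y + x * d y.
Local Notation smx := 'M[grassmann n.+1 A]_3.
Local Notation D := (Dtheta d).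
Variables (Phi M : smx) (a u c v : grassmann n.+1 A).
Hypothesis GPhi : in_SPL2 Phi.
Hypothesis ME : M = oper_mx a u c v.
Hypothesis u_odd : gparity true u.
Hypothesis a_neq0 : gbody a != 0.
Hypothesis flat : smxD d Phi = Phi *m M.

Let x := Phi i1 i1.
Let y := Phi i2 i1.
Let xi := Phi i3 i1.

Let ePhi := SPL2_even GPhi.
Let ey : gparity false y := @ePhi i2 i1.
Let ex : gparity false x := @ePhi i1 i1.
Let oxi : gparity true xi := @ePhi i3 i1.

Let flatE i j : smxD d Phi i j =
  Phi i i1 * M i1 j + Phi i i2 * M i2 j + Phi i i3 * M i3 j.
Proof. by rewrite flat mulmx3. Qed.

Let Dx : D x = x * u + Phi i1 i3 * a.
Proof.
have := flatE i1 i1; have E := oper_entries a u c v.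
by rewrite smxD_entry /= ME !E mulr0 addr0.
Qed.

Let Dy : D y = y * u + Phi i2 i3 * a.
Proof.
have := flatE i2 i1; have E := oper_entries a u c v.
by rewrite smxD_entry /= ME !E mulr0 addr0.
Qed.

Let Dxi : - D xi = xi * u + Phi i3 i3 * a.
Proof.
have := flatE i3 i1; have E := oper_entries a u c v.
by rewrite smxD_entry /= ME !E mulr0 addr0.
Qed.

Let relE i j : sinv Phi i i1 * Phi i1 j + sinv Phi i i2 * Phi i2 j
  + sinv Phi i i3 * Phi i3 j = (i == j)%:R.
Proof. by rewrite -mulmx3 (SPL2_mulVmx A2 GPhi) mxE. Qed.

(** Were the body of y zero, the theta coefficient of D y would make that of Phi_23 vanish, and then
    the body of D Phi_23 would make the body of Phi_22 vanish. Phi_21 and Phi_22 would both have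
    body 0, against the (1, 1) entry of [sinv Phi *m Phi] = 1. This is where invertibility of a
    enters. *)
Lemma flat_body_neq0 : gbody y != 0.
Proof.
apply/negP => /eqP y0; have d0 : d 0 = 0.
  by apply: (addrI (d 0)); rewrite -dD !addr0.
have E := oper_entries a u c v.
have o23 : gbody (Phi i2 i3) = 0 := gbody_odd (@ePhi i2 i3).
have := gcoef_Dtheta d y; rewrite Dy raddfD /= !gcoefM y0 d0 o23 (gbody_odd u_odd).
rewrite !(mul0r, mulr0, add0r, addr0) => /eqP.
rewrite mulf_eq0 (negbTE a_neq0) orbF -(gbody_Dtheta d) => /eqP c23.
have := flatE i2 i3; rewrite smxD_entry /= ME !E mulr0 addr0 => e23.
move: c23; rewrite e23 gbodyD !gbodyM -/y y0 mul0r add0r => /eqP.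
rewrite mulf_eq0 (negbTE a_neq0) orbF => /eqP y22.
have := congr1 (@gbody _ _) (relE i1 i1).
rewrite !sinvE !(gbodyD, gbodyM, gbodyN) y22 -/y y0 (gbody_odd (@ePhi i3 i2)) eqxx gbody1.
by rewrite !(mul0r, mulr0, oppr0, addr0) => /esym/eqP; rewrite oner_eq0.
Qed.

Let uy : y \is a GRing.unit.
Proof. by rewrite gunitE flat_body_neq0. Qed.

Let eyi : gparity false y^-1 := gparityV ey.

(* The coordinates of the class of Phi in G / B in the big cell. *)
Definition flat_chi := xi * y^-1.
Definition flat_X := x * y^-1.

Lemma flat_X_even : gparity false flat_X.
Proof. exact: gparityM ex eyi. Qed.

Lemma flat_chi_odd : gparity true flat_chi.
Proof. exact: gparityM oxi eyi. Qed.

Let Dyi : D y^-1 = - (y^-1 * D y * y^-1) := DthetaV dD dM ey uy.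

Lemma flat_Dchi :
  - D flat_chi = (Phi i3 i3 - flat_chi * Phi i2 i3) * a * y^-1.
Proof.
rewrite /flat_chi (Dtheta_oddM dD dM _ oxi) opprB Dyi addrC.
rewrite -[- (D xi * _)]mulNr Dxi Dy mulrDr mulKr // mulrN mulrA -mulrBl.
congr (_ * _); rewrite mulrDr opprD addrACA subrr add0r mulrBl.
by rewrite !mulrA.
Qed.

(** Columns 1 and 3 of Phi are orthogonal for the invariant form, which eliminates Phi_13; the term
    in chi^2 vanishes because chi is odd. *)
Lemma flat_DX : D flat_X = flat_chi * - D flat_chi.
Proof.
rewrite flat_Dchi /flat_X (Dtheta_evenM dD dM _ ex) Dyi.
rewrite Dx Dy mulrDr mulKr // mulrN [RHS]mulrA [x * (_ / y)]mulrA -mulrBl.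
congr (_ * _).
rewrite mulrDr opprD addrACA subrr add0r [RHS]mulrA mulrBr.
rewrite [flat_chi * (flat_chi * _)]mulrA (godd_sqr A2 flat_chi_odd) mul0r subr0.
rewrite !mulrA -mulrBl; congr (_ * _).
have yx : y * (x * y^-1) = x by rewrite (geven_comm ey flat_X_even) mulrVK.
have yxi : y * flat_chi = xi by rewrite (geven_comm ey flat_chi_odd) mulrVK.
have := relE i2 i3; rewrite !sinvE -/x -/y -/xi mulNr => e.
apply: (mulrI uy); rewrite mulrBr [y * (x / y * _)]mulrA yx [y * (flat_chi * _)]mulrA yxi.
apply/esym/eqP; rewrite -subr_eq0 opprB addrC [_ - y * _]addrC.
by rewrite e.
Qed.

Lemma flat_chi_body : gbody (- D flat_chi) = gbody a / gbody y.
Proof.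
rewrite flat_Dchi 2!gbodyM gbodyD gbodyN [gbody (flat_chi * _)]gbodyM.
rewrite (gbodyV flat_body_neq0) (gbody_odd flat_chi_odd).
by rewrite (SPL2_body33 A2 GPhi) mul0r oppr0 addr0 mul1r.
Qed.

Lemma flat_X_body : gbody flat_X = gbody x / gbody y.
Proof. by rewrite gbodyM (gbodyV flat_body_neq0). Qed.

(** The theta coefficient of [flat_DX]. The minus sign appears because the theta coefficient of chi
    is the body of D chi, whereas a / y is the body of - D chi. *)
Lemma flat_wronskian : d (gbody x / gbody y) = - (gbody a / gbody y) ^+ 2.
Proof.
rewrite -flat_X_body -gcoef_Dtheta flat_DX gcoefM (gbody_odd flat_chi_odd).
rewrite mul0r add0r flat_chi_body -(gbody_Dtheta d) -[gbody _]opprK -gbodyN.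
by rewrite flat_chi_body mulNr expr2.
Qed.

Lemma flat_chi_unit : - D flat_chi \is a GRing.unit.
Proof.
by rewrite gunitE flat_chi_body mulf_neq0 ?invr_neq0 // flat_body_neq0.
Qed.

End FlatSolution.

Lemma fraction_two (R : idomainType) : (2 : R) != 0 -> (2 : {fraction R}) != 0.
Proof. by rewrite -[2 : {fraction R}](rmorph_nat (@tofrac R)) tofrac_eq0. Qed.

(** * Superopers on the super Riemann sphere *)

Section FieldIdentities.
Context {F : fieldType}.
Implicit Types a b c g h p q r s t x y : F.

Lemma div_mul_unit x g h a : a != 0 -> g * h = 1 -> x / (a * h) = x * g / a.
Proof.
move=> a0 gh; have h0 : h != 0.
  by apply: contra_eq_neq gh => ->; rewrite mulr0 eq_sym oner_eq0.
have -> : g = h^-1 by apply: (mulIf h0); rewrite gh mulVf.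
by field; rewrite h0 a0.
Qed.

Lemma div_gauge x a h r s t b : a != 0 -> b * a * h = t * r -> x * h = s ->
  x / a * t * r = b * s.
Proof. by move=> a0 e <-; rewrite -mulrA -e; field. Qed.

Lemma mul_shift t p x r s : x * t * r = s -> t * p * x * r = p * s.
Proof. by move=> <-; ring. Qed.

Lemma mul_shift_pole t p x u r s : t != 0 -> x * u * r = - t^-1 * s ->
  p * x * (t * u) * r = - s * p.
Proof.
move=> t0 e; have -> : p * x * (t * u) * r = p * (t * (x * u * r)) by ring.
by rewrite e mulNr mulrN mulVKf // mulrC.
Qed.

Lemma div_ratio p x y a : p != 0 -> a != 0 -> x != 0 ->
  y / x = p * (y / a) / (p * (x / a)).
Proof. by move=> p0 a0 x0; field; rewrite p0 x0 a0. Qed.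

Lemma inv_ratio p x a : p != 0 -> a != 0 -> x != 0 ->
  a / x = p / (p * (x / a)).
Proof. by move=> p0 a0 x0; field; rewrite p0 x0 a0. Qed.

End FieldIdentities.

Section Avoiding.
Import Order.TTheory Num.Theory.

Lemma exists_avoiding (K : numDomainType) N (z : 'I_N -> K) :
  exists c, forall i, c != z i.
Proof.
exists (1 + \sum_i `|z i|) => i; apply/eqP => e.
have s0 (P : pred 'I_N) : 0 <= \sum_(j | P j) `|z j| by apply: sumr_ge0.
have := congr1 Num.norm e; rewrite ger0_norm ?addr_ge0 ?ler01 //.
rewrite (bigD1 i) //= addrCA -[RHS]addr0 => /addrI /eqP.
by rewrite gt_eqF // ltr_pwDl ?ltr01.
Qed.

End Avoiding.

(** * Body and theta coefficient of the superpoles *)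

Section Superpoles.
Context {K : fieldType} {n : nat}.
Implicit Types Pt : superpoint K n.

Lemma gbody_embS (A : comNzRingType) (iota : K -> A) (s : grassmann n K) :
  gbody (embS iota s) = iota (gbody s).
Proof.
rewrite /gbody ffunE inE; congr (iota (s _)).
by apply/setP => i; rewrite !inE.
Qed.

Lemma gcoef_embS (A : comNzRingType) (iota : K -> A) (s : grassmann n K) :
  gcoef ord0 (embS iota s) = 0.
Proof. by rewrite /gcoef ffunE inE eqxx. Qed.

Lemma gbody_sdist Pt : gbody (sdist Pt) = tofrac ('X - (sp_body Pt)%:P).
Proof.
rewrite /sdist !(gbodyD, gbodyN, gbodyM) gbody_scalar gbody_embS.
by rewrite (gbody_odd theta_odd) mul0r oppr0 addr0 tofracB.
Qed.

Lemma gbody_sdist_neq0 Pt : gbody (sdist Pt) != 0.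
Proof. by rewrite gbody_sdist tofrac_eq0 polyXsubC_eq0. Qed.

Lemma gbody_superpole Pt : gbody (superpole Pt) = 0.
Proof.
rewrite gbodyM gbodyD gbodyN (gbody_odd theta_odd) gbody_embS.
by rewrite (gbody_odd (@sp_theta_odd _ _ Pt)) /ratC tofrac0 oppr0 addr0 mul0r.
Qed.

(** Since theta - theta_P has body 0, only its theta coefficient 1 meets the body of the inverse.
    Hence odd coordinates of a point are invisible modulo nilp. *)
Lemma gcoef_superpole Pt :
  gcoef ord0 (superpole Pt) = (tofrac ('X - (sp_body Pt)%:P))^-1.
Proof.
rewrite gcoefM gbodyD gbodyN (gbody_odd theta_odd) gbody_embS.
rewrite (gbody_odd (@sp_theta_odd _ _ Pt)) {1}/ratC tofrac0 oppr0 addr0 mul0r add0r.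
rewrite (gbodyV (gbody_sdist_neq0 Pt)) gbody_sdist raddfB /= gcoef_embS subr0.
by rewrite /gcoef /theta /ggen ffunE eqxx mul1r.
Qed.

End Superpoles.

(** Charts are supplied only by the covering of unmarked points, so an unmarked point has to be
    exhibited. *)
Lemma chart_ex (K : numClosedFieldType) n N (Z : 'I_N -> superpoint K n)
    (tau : superoper Z) : exists j : chart tau, True.
Proof.
have [c cZ] := exists_avoiding (fun i => sp_body (Z i)).
by have [j _] := cut_cover tau cZ; exists j.
Qed.

(** * A non-degenerate superoper with its flat trivialization *)

Section FlatTrivialization.
Context {K : numClosedFieldType} {n N : nat}.
Variables (Z : 'I_N -> superpoint K n) (l : 'I_N -> nat) (loo : nat).
Hypothesis Z_distinct : injective (fun i => sp_body (Z i)).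
Variable tau : sOp Z l loo.
Variable Phi : chart tau -> 'M[superfun K n]_3.
Hypothesis Phi_flat : flat_triv Phi.
Hypothesis Phi_generic :
  forall i j, generic_pos (phi_puncture Phi j (Some i)).

Local Notation sfun := (superfun K n).
Local Notation dfun := (grassmann n.+1 (laurent K)).

Let K0 : [pchar K] =i pred0 := Num.Theory.pchar_num K.
Let K2 : (2 : K) != 0.
Proof. by rewrite (iffLR (pcharf0P _) K0). Qed.
Let R2 : (2 : ratfun K) != 0.
Proof. by apply: fraction_two; rewrite -polyC_natr polyC_eq0. Qed.
Let L2 : (2 : laurent K) != 0.
Proof.
apply: fraction_two; apply: contra_neq K2 => /(congr1 (@fps_coef0 K)).
by rewrite rmorph_nat rmorph0.
Qed.

Let PhiG j : in_SPL2 (Phi j).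
Proof. by case: Phi_flat => /(_ j)[]. Qed.

Let Phi_regular j : mx_all (regular_on (cut j)) (Phi j).
Proof. by case: Phi_flat => /(_ j)[]. Qed.

Let Phi_glue j k : Phi j *m glue j k = Phi k.
Proof. by case: Phi_flat. Qed.

Let Phi_parallel j : smxD (@Dz K) (Phi j) = Phi j *m conn j.
Proof. by case: Phi_flat => _ _ /(_ j)/(gauge0E R2 _ _ (PhiG j)). Qed.

Let disc_frame p (j : chart tau) : 'M[dfun]_3 :=
  map_mx (res (place Z p)) (Phi j) *m sinv (frame p j).

Let disc_frame_regular p j : mx_all (@disc_regular K n) (disc_frame p j).
Proof. by rewrite /disc_frame -sinv_def; case: Phi_flat. Qed.

Let disc_frame_value j : map_mx (@disc_value K n) (disc_frame None j) = 1%:M.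
Proof. by rewrite /disc_frame -sinv_def; case: Phi_flat. Qed.

Let res_even_Phi p j : smx_even (map_mx (res (place Z p)) (Phi j)).
Proof. exact/res_even/SPL2_even/PhiG. Qed.

Let frameG p (j : chart tau) : in_SPL2 (frame p j).
Proof. by case: (frame_B p j). Qed.

Let sinv_disc_frame p (j : chart tau) : sinv (disc_frame p j) =
  frame p j *m map_mx (res (place Z p)) (sinv (Phi j)).
Proof.
have eF := smx_even_inv (SPL2_even (frameG p j)).
by rewrite (sinvM (@res_even_Phi p j) eF) sinvK res_sinv.
Qed.

Let col1_glue j k i : Phi k i i1 = Phi j i i1 * glue j k i1 i1.
Proof.
rewrite -(Phi_glue j k) mulmx3; have [_ -> ->] := glue_B j k.
by rewrite !mulr0 !addr0.
Qed.

(* In the flat trivialization F'_B is constant, equal to the fiber of F_B at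
   (oo, 0). *)
Definition flat_reduction j : 'M[sfun]_3 := spl2_inv (Phi j).

Lemma flat_reduction_miura : miura flat_reduction.
Proof.
rewrite /flat_reduction; split=> [j|j k|j x xj|p j|j].
- by rewrite sinv_def; apply: SPL2_inv.
- exists 1%:M; first exact: in_B1.
  rewrite mulmx1 !sinv_def -[RHS]mulmx1 -(SPL2_mulmxV R2 (PhiG k)).
  by rewrite -(Phi_glue j k) !mulmxA (SPL2_mulVmx R2 (PhiG j)) mul1mx.
- exists 1%:M; first exact: in_B1.
  have reg i i' : regular_at x (Phi j i i') by apply: Phi_regular.
  have regN i i' : regular_at x (- Phi j i i').
    by move=> I; rewrite goppE; apply/rat_regularN/reg.
  rewrite mulmx1 sinv_def => i; apply: ord3_ind; move: i; apply: ord3_ind;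
    by rewrite sinvE.
- exists 1%:M; first exact: in_B1.
  rewrite mulmx1 sinv_def -sinv_disc_frame; apply: disc_regular_sinv.
  exact: disc_frame_regular.
rewrite !sinv_def sinvK; have -> : gauge (@Dz K) (Phi j) (conn j) = 0.
  by case: Phi_flat.
exists 0, 0, 0; split; first by split; apply: gparity0.
by rewrite !scale0r !addr0.
Qed.

Lemma flat_reduction_oo : coincide_at_oo flat_reduction.
Proof.
move=> j; exists 1%:M; first exact: in_B1.
rewrite /flat_reduction mulmx1 sinv_def -(sinv_disc_frame None).
split; first by apply/disc_regular_sinv/disc_frame_regular.
rewrite disc_value_sinv; last exact: disc_frame_regular.
by rewrite disc_frame_value sinv1; apply: in_B1.
Qed.

(** With Q = Phi P, preservation by nabla multiplies the first column of Q by one and the same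
    Cartan term u, up to the sign of [smxD]. The quotients Q_21 / Q_11 and Q_31 / Q_11 cancel it, so
    they are D-constants; they vanish at (oo, 0), hence everywhere, and Q lies in B. *)
Lemma flat_reduction_unique (P : chart tau -> 'M[sfun]_3) :
  miura P -> coincide_at_oo P -> same_reduction flat_reduction P.
Proof.
case=> PG _ _ _ Pb Poo j; pose Q := Phi j *m P j.
have GQ : in_SPL2 Q by apply: SPL2M.
have eQ := SPL2_even GQ.
exists Q; last first.
  by rewrite /flat_reduction sinv_def /Q mulmxA (SPL2_mulVmx R2 (PhiG j)) mul1mx.
have [c [u [v [[_ ou _] [_ _ _ gP]]]]] := Pb j; rewrite sinv_def in gP.
have DQ : smxD (@Dz K) Q = Q *m borel_mx u c v.
  have GiP := SPL2_inv R2 (PG j); have QP : Q *m sinv (P j) = Phi j.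
    by rewrite /Q -mulmxA (SPL2_mulmxV R2 (PG j)) mulmx1.
  have eqQ : smxD (@Dz K) (Q *m sinv (P j)) = Q *m sinv (P j) *m conn j.
    by rewrite QP Phi_parallel.
  exact: (iffLR (gauge_parallel R2 (@DzD K) (@DzM K) _ GQ GiP eqQ) gP).
have E := borel_entries u c v.
have col i : smxD (@Dz K) Q i i1 = Q i i1 * u.
  by rewrite DQ mulmx3 !E !mulr0 !addr0.
have := Poo j; case=> b Bb /= [reg Bv]; set M := _ *m b in reg Bv.
have [Bb11 _ _] := in_B_entries L2 Bb.
have eM : map_mx (res None) Q *m b = disc_frame None j *m M.
  rewrite /disc_frame /M /Q res_mxM !mulmxA -(mulmxA _ (sinv _)).
  by rewrite (SPL2_mulVmx L2 (frameG None j)) mulmx1.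
have regE : mx_all (@disc_regular K n) (map_mx (res None) Q *m b).
  by rewrite eM; apply: disc_regular_mulmx.
have valE : in_B (map_mx (@disc_value K n) (map_mx (res None) Q *m b)).
  rewrite eM (disc_value_mulmx (disc_frame_regular None j) reg).
  by rewrite disc_frame_value mul1mx; exact: Bv.
have colE i : (map_mx (res None) Q *m b) i i1 = res None (Q i i1) * b i1 i1.
  by rewrite mulmx3; case: Bb => _ -> ->; rewrite !mulr0 !addr0 mxE.
have [v22 _ _] := in_B_entries K2 valE; have [_ v21 v31] := valE.
rewrite mxE colE in v21; rewrite mxE colE in v31.
set V11 := map_mx _ _ i1 i1 in v22; have V11E : V11 = disc_value (res None (Q i1 i1) * b i1 i1).
  by rewrite /V11 mxE colE.
(* With body 0 its value at (oo, 0), after multiplication by b_11, would have body 0, whereas it is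
   a unit because the value matrix lies in B. *)
have uQ : Q i1 i1 \is a GRing.unit.
  rewrite gunitE; apply: contra_eq_neq v22 => q0.
  apply: contra_neq (@oner_neq0 K) => /(congr1 (@gbody _ _)).
  rewrite gbodyM V11E gbody_disc_value /disc_body gbodyM gbody_res q0 rmorph0.
  by rewrite mul0r laur_coef00 mulr0 gbody1.
have quotient0 i : i = i2 \/ i = i3 -> Q i i1 = 0.
  move=> i23; pose F := Q i i1 * (Q i1 i1)^-1.
  have eq1 : gparity false (Q i1 i1) by apply: eQ.
  have DF : Dtheta (@Dz K) F = 0.
    rewrite /F; have Dq1 := col i1; rewrite smxD_entry /= in Dq1.
    have DqV : Dtheta (@Dz K) (Q i1 i1)^-1 = - (u * (Q i1 i1)^-1).
      by rewrite (DthetaV (@DzD K) (@DzM K) eq1 uQ) Dq1 mulKr.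
    have Dq := col i; rewrite smxD_entry in Dq.
    case: i23 => ie; rewrite ie /= in Dq *.
      rewrite (Dtheta_evenM (@DzD K) (@DzM K) _ (@eQ i2 i1)) Dq DqV.
      by rewrite mulrN mulrA subrr.
    rewrite (Dtheta_oddM (@DzD K) (@DzM K) _ (@eQ i3 i1)) DqV mulrN opprK.
    by rewrite -[Dtheta _ _]opprK Dq mulNr mulrA addNr.
  have [regF F0] := Dtheta_constant_eq0 K0 None DF.
  have vi : disc_value (res None (Q i i1) * b i1 i1) = 0 by case: i23 => ->.
  have QF : Q i i1 = F * Q i1 i1 by rewrite mulrVK.
  have reg1 : disc_regular (res None (Q i1 i1) * b i1 i1) by have := regE i1 i1; rewrite colE.
  rewrite QF F0 ?mul0r //.
  move: vi; rewrite QF rmorphM -mulrA disc_valueM // -V11E => e.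
  have [_ uV _] := in_B_entries K2 valE.
  by rewrite -[LHS]mulr1 -uV mulrA e mul0r.
by split=> //; apply: quotient0; [left|right].
Qed.

Let lead (j : chart tau) : ratfun K := gbody (conn j i3 i1).

Let oper_form j : exists a u c v : sfun,
  [/\ conn j = oper_mx a u c v,
      gparity true u, gbody a != 0, gbody a = lead j &
      forall x, x \notin cut j -> rat_regular x (lead j)^-1].
Proof.
have [a [mu [[ea _ [a' rega' aa']] [[c [u [v [[ec ou ov] [_ _ _ muE]]]]] cE]]]] :=
  conn_oper j.
have {}cE : conn j = oper_mx a u c v by rewrite cE muE.
have E := oper_entries a u c v.
have leadE : gbody a = lead j by rewrite /lead cE E.
have aa1 : gbody a * gbody a' = 1 by rewrite -gbodyM aa' gbody1.
have a0 : gbody a != 0 by apply: contra_eq_neq aa1 => ->; rewrite mul0r eq_sym oner_eq0.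
exists a, u, c, v; split; [exact: cE|exact: ou|exact: a0|exact: leadE|].
move=> x xj; rewrite -leadE; have -> : (gbody a)^-1 = gbody a' by rewrite -[LHS]mulr1 -aa1 mulKf.
exact: rega'.
Qed.

Let lead_neq0 j : lead j != 0.
Proof. by have [a [u [c [v [_ _ a0 <- _]]]]] := oper_form j. Qed.

Let conn21 (j : chart tau) : conn j i2 i1 = 0.
Proof.
have [a [u [c [v [cE _ _ _ _]]]]] := oper_form j.
by have E := oper_entries a u c v; rewrite cE E.
Qed.

Let ratio i j : ratfun K := gbody (Phi j i i1) / lead j.

(** On bodies, a change of frame g in B multiplies the first column of Phi and the coefficient of f
    by the same g_22, because g_11 g_22 = 1 and g_33 has body 1. *)
Let ratio_glue i j k : ratio i j = ratio i k.
Proof.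
have Bg := glue_B j k; have Gg : in_SPL2 (glue j k) by case: Bg.
have [_ g12 _] := in_B_entries R2 Bg; have /(congr1 (@gbody _ _)) := g12.
rewrite gbodyM gbody1 => g1.
rewrite /ratio; have -> : lead j = lead k * gbody (glue j k i2 i2).
  rewrite /lead (conn_glue j k) (gauge_31 R2 (@Dz0 K) Bg (conn21 k)) !gbodyM.
  by rewrite (SPL2_body33 R2 Gg) mul1r.
rewrite (col1_glue j k) gbodyM.
exact: (div_mul_unit _ (lead_neq0 k) g1).
Qed.

Let gbody_coord (p : option _) : gbody (local_coord Z p) = laurT K.
Proof.
case: p => [i|]; last by rewrite gbody_scalar.
rewrite gbody_res gbody_sdist rat_at_tofrac /poly_at rmorphB /= map_polyX.
by rewrite map_polyC hornerXsubC addrAC subrr add0r.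
Qed.

(** The disc frame multiplies the numerator and denominator of [ratio] by the same entry, apart from
    the factor [theta_at] by which D_theta changes. The pole is then governed by the power of t in
    the local form: r is the unit part of that form, and s is the body of the first column of the
    disc frame. *)
Let disc_relation p i (j : chart tau) : exists r s : fps K,
  [/\ fps_coef0 r != 0, fps_coef0 s = disc_body (disc_frame p j i i1) &
      rat_at (place Z p) (ratio i j) * laurT K ^+ weight l loo p * tofrac r =
      theta_at (place Z p) * tofrac s].
Proof.
have [a [r [mu [[_ aE /(_ set0)[r' rE] r0] [[c [u [v [_ [_ _ _ muE]]]]] ME]]]]] :=
  frame_oper p j.
have Bf := frame_B p j; have Gf := frameG p j.
have [_ h12 f23] := in_B_entries L2 Bf; have [_ f21 f31] := Bf.
have h1 : gbody (frame p j i1 i1) * gbody (frame p j i2 i2) = 1.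
  by rewrite -gbodyM h12 gbody1.
have [s sE] := disc_frame_regular p j i i1 set0.
exists r', s; split.
- by move: r0; rewrite /disc_body /gbody rE laur_coef0E.
- by rewrite /disc_body /gbody sE laur_coef0E.
have E := oper_entries a u c v.
have [c21 cE] : res_conn (place Z p) (conn j) i2 i1 = 0 /\
    res_conn (place Z p) (conn j) i3 i1 =
    gscalar n.+1 (theta_at (place Z p)) * res (place Z p) (conn j i3 i1).
  by rewrite /res_conn; split; rewrite !mxE // conn21 rmorph0 mulr0.
have {}ME : gauge (@Dt K) (frame p j) (res_conn (place Z p) (conn j)) =
    oper_mx a u c v by rewrite ME muE.
have := gauge_31 L2 (@Dt0 K) Bf c21; rewrite ME E aE cE.
move/(congr1 (@gbody _ _)); rewrite !gbodyM (SPL2_body33 L2 Gf) mul1r gbody_scalar.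
rewrite rmorphXn /= gbody_coord [gbody r]rE gbody_res -/(lead j) => eq_a.
have := sE; rewrite -[_ set0]/(gbody _) mulmx3 !sinvE f21 f23 oppr0 !mulr0 !addr0.
rewrite gbodyM mxE gbody_res => eq_x.
have lead0 : rat_at (place Z p) (lead j) != 0 by rewrite fmorph_eq0 lead_neq0.
rewrite /ratio rat_atM fmorphV /=.
exact: (div_gauge lead0 (esym eq_a) eq_x).
Qed.

Let P : {poly K} := \prod_i ('X - (sp_body (Z i))%:P) ^+ l i.

Let P_neq0 : P != 0.
Proof.
by apply/prodf_neq0 => i _; rewrite expf_neq0 // polyXsubC_eq0.
Qed.

Let size_P : (size P).-1 = (\sum_i l i)%N.
Proof.
rewrite size_prod => [|i _]; last by rewrite expf_neq0 // polyXsubC_eq0.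
under eq_bigr do rewrite size_exp_XsubC.
rewrite (eq_bigr (fun i => (l i + 1)%N)) => [|i _]; last by rewrite addn1.
by rewrite big_split /= sum_nat_const card_ord muln1 -addSn addnK.
Qed.

(** One factor of P supplies t^l at this place; the cofactor does not vanish there because the
    bodies of the marked points are distinct, so it can be absorbed in s. *)
Let finite_place i0 i j (z := sp_body (Z i0)) : exists r s : fps K,
  [/\ fps_coef0 r != 0,
      disc_body (disc_frame (Some i0) j i i1) != 0 -> fps_coef0 s != 0 &
      rat_at (Some z) (tofrac P * ratio i j) * tofrac r = tofrac s].
Proof.
have [r [s [r0 s0 e]]] := disc_relation (Some i0) i j.
pose P' := \prod_(i | i != i0) ('X - (sp_body (Z i))%:P) ^+ l i.
have PE : P = ('X - z%:P) ^+ l i0 * P' by rewrite /P (bigD1 i0).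
have P'0 : P'.[z] != 0.
  by apply: prod_XsubC_neq0 => i' ne; apply: contraNneq ne => /Z_distinct ->.
exists r, (fps_poly (P' \Po ('X + z%:P)) * s); split=> // [d0|].
  by rewrite rmorphM /= poly_at_finite_coef0 mulf_neq0 // s0.
rewrite rat_atM rat_at_tofrac PE rmorphM rmorphXn /=.
have -> : poly_at (Some z) ('X - z%:P) = laurT K.
  rewrite /poly_at rmorphB /= map_polyX map_polyC hornerXsubC /z_at.
  by rewrite addrAC subrr add0r.
rewrite tofracM -poly_at_finite; apply: mul_shift.
by rewrite e mul1r.
Qed.

(** At an unmarked point one may pass to a chart containing it, as [ratio] does not depend on the
    chart; at a marked point P clears the pole. *)
Let ratio_poly i j : exists p, tofrac P * ratio i j = tofrac p.
Proof.
apply: rat_regular_poly => c.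
have [[i0 ->]|nZ] := pselect (exists i0, c = sp_body (Z i0)).
  have [r [s [r0 _]]] := finite_place i0 i j; exact: rat_at_regular.
have [k ck] := cut_cover tau (fun i0 => introN eqP (fun e => nZ (ex_intro _ i0 e))).
rewrite (ratio_glue i j k); apply: rat_regularM; first exact: rat_regular_tofrac.
apply: rat_regularM; first exact: Phi_regular.
by have [a [u [c' [v [_ _ _ _ reg]]]]] := oper_form k; apply: reg.
Qed.

(** The exponent exceeds l_oo by one, and s changes sign, because [theta_at] at oo is - 1 / t. *)
Let infinite_place i j p : tofrac P * ratio i j = tofrac p -> exists r s : fps K,
  [/\ fps_coef0 r != 0, fps_coef0 s = - disc_body (disc_frame None j i i1) &
      poly_at None p * laurT K ^+ loo.+1 * tofrac r = tofrac s * poly_at None P].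
Proof.
move=> pE; have [r [s [r0 s0 e]]] := disc_relation None i j.
exists r, (- s); split=> //; first by rewrite rmorphN /= s0.
rewrite -!rat_at_tofrac -pE rat_atM tofracN exprS.
by apply: mul_shift_pole; [apply: laurT_neq0|apply: e].
Qed.

(* For the first column (x, y) of the body of Phi and the body a of the coefficient
   of f, the polynomials are V = P x / a and Q = P y / a. *)
Lemma wronskian_polynomials (j : chart tau) (x := Phi j i1 i1) (y := Phi j i2 i1) :
  exists V Q : {poly K},
  [/\ Q != 0, gbody (conn j i3 i1) / gbody y = tofrac P / tofrac Q,
      forall i, Q.[sp_body (Z i)] != 0,
      V * Q^`() - V^`() * Q = P ^+ 2 & (size P).-1 = ((size Q).-1 + loo)%N].
Proof.
have [a [u [c [v [cE ou a0 aE _]]]]] := oper_form j.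
have y0 : gbody y != 0.
  exact: (flat_body_neq0 R2 (@DzD K) (PhiG j) cE ou a0 (Phi_parallel j)).
have [V VE] := ratio_poly i1 j; have [Q QE] := ratio_poly i2 j.
have P0 : tofrac P != 0 by rewrite tofrac_eq0.
have Q0 : Q != 0.
  suff : tofrac Q != 0 by rewrite tofrac_eq0.
  rewrite -QE; exact: (mulf_neq0 P0 (mulf_neq0 y0 (invr_neq0 (lead_neq0 j)))).
have l0 := lead_neq0 j; have tQ0 : tofrac Q != 0 by rewrite tofrac_eq0.
have ayE : lead j / gbody y = tofrac P / tofrac Q.
  by rewrite -QE; exact: (inv_ratio P0 l0 y0).
have xyE : gbody x / gbody y = tofrac V / tofrac Q.
  by rewrite -QE -VE; exact: (div_ratio _ P0 l0 y0).
have W : V * Q^`() - V^`() * Q = P ^+ 2.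
  have := flat_wronskian R2 (@DzD K) (@DzM K) (PhiG j) cE ou a0 (Phi_parallel j).
  rewrite -/x -/y aE ayE xyE {1}/Dz frac_derivE //; last by move=> p q; apply: derivM.
  rewrite expr_div_n -[- (tofrac P ^+ 2 / _)]mulNr => e; have /eqP := mulIf (invr_neq0 (expf_neq0 2 tQ0)) e.
  rewrite -tofracXn -tofracN tofrac_eq => /eqP {}e.
  by rewrite -[RHS]opprK -e opprB.
(* The flat frame is 1 at (oo, 0): there x has value 1, so V attains the degree deg P + l_oo + 1,
   and y has value 0, so Q stays strictly below it. *)
have dV i i' : gbody (disc_value (disc_frame None j i i')) = (i == i')%:R.
  have /matrixP/(_ i i') := disc_frame_value j; rewrite !mxE => ->.
  exact: rmorph_nat.
have [r1 [s1 [r10 s10 e1]]] := infinite_place VE.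
have [r2 [s2 [r20 s20 e2]]] := infinite_place QE.
rewrite -gbody_disc_value dV eqxx in s10; rewrite -gbody_disc_value dV /= oppr0 in s20.
have s10' : fps_coef0 s1 != 0 by rewrite s10 oppr_eq0 oner_eq0.
have V0 : V != 0.
  apply: contraNneq s10' => V0; move/eqP: e1; rewrite V0 rmorph0 !mul0r eq_sym.
  by rewrite mulf_eq0 poly_at_eq0 (negbTE P_neq0) orbF tofrac_eq0 => /eqP ->; rewrite rmorph0.
have [/(_ s10') dVE _] := degree_oo V0 P_neq0 r10 e1.
have [_ /(_ s20) dQ] := degree_oo Q0 P_neq0 r20 e2.
exists V, Q; split=> // [i|].
  (* Generic position at Z_i is a nonzero value of y in the disc frame, that is, a nonzero constant
     term in the expansion of Q. *)
  have [r [s [r0 s0 e]]] := finite_place i i2 j.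
  have {}s0 : fps_coef0 s != 0.
    by apply: s0; have := Phi_generic i j; rewrite /generic_pos mxE sinv_def.
  move: e; rewrite QE rat_at_tofrac poly_at_finite -tofracM => /eqP.
  rewrite tofrac_eq => /eqP /(congr1 (@fps_coef0 K)).
  rewrite rmorphM /= poly_at_finite_coef0 => e; apply: contraNneq s0 => Qz.
  by rewrite -e Qz mul0r.
have VQ : size V != size Q.
  apply: contraTneq dQ => VQ; rewrite -VQ dVE ltnn //.
have := wronskian_size K0 V0 Q0 VQ W; rewrite dVE -addnn => /eqP.
by rewrite addnS addSn eqSS -addnA eqn_add2l addnC => /eqP <-.
Qed.



Let glue_unit (j k : chart tau) : glue j k i1 i1 \is a GRing.unit.
Proof.
have [g21 g12 _] := in_B_entries R2 (glue_B j k).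
by apply/unitrP; exists (glue j k i2 i2).
Qed.

Let y_unit j : Phi j i2 i1 \is a GRing.unit.
Proof.
have [a [u [c [v [cE ou a0 _ _]]]]] := oper_form j; rewrite gunitE.
exact: (flat_body_neq0 R2 (@DzD K) (PhiG j) cE ou a0 (Phi_parallel j)).
Qed.

(** The transition entry cancels on the right, so X and chi, computed on one chart, describe F_B on
    every chart and a single normalized frame serves them all. *)
Let quotient_glue j k i :
  Phi k i i1 * (Phi k i2 i1)^-1 = Phi j i i1 * (Phi j i2 i1)^-1.
Proof.
rewrite !(col1_glue j k) (invrM (y_unit j) (glue_unit j k)) mulrA.
by rewrite (mulrK (glue_unit j k)).
Qed.

Variable j0 : chart tau.
Let chi : sfun := flat_chi (Phi j0).
Let X : sfun := flat_X (Phi j0).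
Let w : sfun := - Dtheta (@Dz K) chi.
Let u : sfun := - Dtheta (@Dz K) w * w^-1.
Let NF : 'M[sfun]_3 := normal_form (@Dz K) X chi.

Let X_even : gparity false X.
Proof. exact: flat_X_even (PhiG j0). Qed.

Let chi_odd : gparity true chi.
Proof. exact: flat_chi_odd (PhiG j0). Qed.

Let w_body : gbody w = lead j0 / gbody (Phi j0 i2 i1).
Proof.
have [a [u' [c [v [cE ou a0 <- _]]]]] := oper_form j0.
exact: (flat_chi_body R2 (@DzD K) (@DzM K) (PhiG j0) cE ou a0 (Phi_parallel j0)).
Qed.

Let w_unit : w \is a GRing.unit.
Proof.
have [a [u' [c [v [cE ou a0 _ _]]]]] := oper_form j0.
exact: (flat_chi_unit R2 (@DzD K) (@DzM K) (PhiG j0) cE ou a0 (Phi_parallel j0)).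
Qed.

Let X_w : Dtheta (@Dz K) X = chi * w.
Proof.
have [a [u' [c [v [cE ou a0 _ _]]]]] := oper_form j0.
exact: (flat_DX R2 (@DzD K) (@DzM K) (PhiG j0) cE ou a0 (Phi_parallel j0)).
Qed.

Let u_odd : gparity true u.
Proof. exact: (normal_form_cartan_odd (@DzD K) chi_odd). Qed.

Let NF_SPL2 : in_SPL2 NF.
Proof. exact: (normal_form_SPL2 R2 (@DzD K) X_even chi_odd w_unit). Qed.

Let NF_mul j : NF *m (sinv NF *m Phi j) = Phi j.
Proof. by rewrite mulmxA (SPL2_mulmxV R2 NF_SPL2) mul1mx. Qed.

Let NF_reduction j : in_B (sinv NF *m Phi j).
Proof.
apply: (normal_form_reduction R2 (@DzD K) X_even chi_odd w_unit (PhiG j)).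
  by rewrite /X /flat_X -(quotient_glue j0 j) (mulrVK (y_unit j)).
by rewrite /chi /flat_chi -(quotient_glue j0 j) (mulrVK (y_unit j)).
Qed.

Let NF_gauge j :
  gauge (@Dz K) (sinv NF *m Phi j) (conn j) = osp_f + u *: coweight.
Proof.
have Gb : in_SPL2 (sinv NF *m Phi j) by case: (NF_reduction j).
have e : smxD (@Dz K) (NF *m (sinv NF *m Phi j)) =
    NF *m (sinv NF *m Phi j) *m conn j.
  by rewrite NF_mul Phi_parallel.
apply: (iffRL (gauge_parallel R2 (@DzD K) (@DzM K) _ NF_SPL2 Gb e)).
exact: (normal_form_parallel (@DzD K) (@DzM K) X_even chi_odd w_unit X_w).
Qed.

Lemma flat_H_connection : H_connection flat_reduction (u *: coweight).
Proof.
split=> [|j]; first by exists u; [exact: u_odd|].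
(* In the first frame the constant reduction [sinv (Phi j)] becomes [sinv NF], and the second factor
   is chosen so that the product is s. *)
exists (sinv NF *m Phi j), (NF *m weyl_s); split.
- exact: NF_reduction.
- exact: (normal_form_opposite R2 (@DzD K) X_even chi_odd w_unit).
- rewrite /flat_reduction sinv_def -(mulmxA (sinv NF)) (SPL2_mulmxV R2 (PhiG j)).
  by rewrite mulmx1 mulmxA (SPL2_mulVmx R2 NF_SPL2) mul1mx.
exact: NF_gauge.
Qed.

Let gcoef_u : gcoef ord0 u = - (Dz (gbody w) / gbody w).
Proof.
have ew : gparity false w := gparityN (Dtheta_parity (@DzD K) chi_odd).
exact: (gcoef_log_deriv (@DzD K) ew w_unit).
Qed.

Lemma Miura_bethe :
  exists (U : 'M[sfun]_3) (m : nat) (W : 'I_m -> superpoint K n) (g : sfun),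
      H_connection flat_reduction U /\
      [/\ injective (fun j => sp_body (W j)),
          forall i j, sp_body (W j) <> sp_body (Z i),
          nilp_term g &
          U = - (\sum_(i < N) superpole (Z i) *: (coweight *+ l i))
              + \sum_(j < m) superpole (W j) *: coweight
              + g *: coweight] /\
      (forall j : 'I_m,
         \sum_(i < N) (2 * l i)%N%:R / (sp_body (W j) - sp_body (Z i))
         - \sum_(s < m | s != j) 2%:R / (sp_body (W j) - sp_body (W s)) = 0) /\
      \sum_(i < N) (l i)%:Z - m%:Z = loo%:Z.
Proof.
have [V [Q [Q0 wE Qz W sPQ]]] := wronskian_polynomials j0.
have [r [Qr rinj rz bethe]] := bethe_roots K0 Q0 Qz W.
have pz (j : 'I_(size Q).-1) : gparity false (gscalar n (r j)).
  exact: gscalar_even.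
pose Wp j := SuperPoint (pz j) (@gparity0 n K true).
have Wb j : sp_body (Wp j) = r j by rewrite /sp_body /= gbody_scalar.
pose SZ := \sum_i superpole (Z i) *+ l i.
pose SW := \sum_j superpole (Wp j).
(* The nilp term is by definition the discrepancy between u and the superpoles, and the number of
   the W_j is deg Q. *)
exists (u *: coweight), (size Q).-1, Wp, (u + SZ - SW).
split; first exact: flat_H_connection.
split; first split.
- by move=> j k /=; rewrite !Wb => /rinj.
- by move=> i j; rewrite Wb; apply: rz.
- split.
    have bZ : gbody SZ = 0.
      by rewrite raddf_sum big1 // => i _; rewrite raddfMn /= gbody_superpole mul0rn.
    have bW : gbody SW = 0.
      by rewrite raddf_sum big1 // => i _; apply: gbody_superpole.
    by rewrite gbodyD gbodyN gbodyD (gbody_odd u_odd) bZ bW subr0 addr0.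
  (* Only the theta coefficient remains. For u it is minus the logarithmic derivative of P / Q, the
     body of w; the superpoles provide its partial fractions. *)
  rewrite gbody_Dtheta raddfB raddfD /= gcoef_u w_body [lead j0 / _]wE.
  have f0 : tofrac P / tofrac Q != 0.
    by rewrite mulf_neq0 ?invr_neq0 ?tofrac_eq0.
  have -> : Dz (tofrac P / tofrac Q) / (tofrac P / tofrac Q) =
      Dz (tofrac P) / tofrac P - Dz (tofrac Q) / tofrac Q.
    exact: (quotient_log_deriv (@DzM K) f0 erefl).
  rewrite log_deriv_Dz.
  have lQ0 : lead_coef Q != 0 by rewrite lead_coef_eq0.
  have -> : Dz (tofrac Q) / tofrac Q =
      \sum_(j < (size Q).-1) (tofrac ('X - (r j)%:P))^-1.
    set q := \prod_(j < (size Q).-1) ('X - (r j)%:P) ^+ 1.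
    have Qq : lead_coef Q *: q = Q by exact: (esym Qr).
    have -> : Dz (tofrac Q) / tofrac Q = Dz (tofrac q) / tofrac q.
      by rewrite -(log_derivZ_Dz q lQ0) Qq.
    by rewrite /q log_deriv_Dz; apply: eq_bigr => i _; rewrite mul1r.
  have cW : gcoef ord0 SW = \sum_j (tofrac ('X - (r j)%:P))^-1.
    by rewrite raddf_sum; apply: eq_bigr => i _; rewrite /= gcoef_superpole Wb.
  have cZ : gcoef ord0 SZ = \sum_i (l i)%:R / tofrac ('X - (sp_body (Z i))%:P).
    rewrite raddf_sum; apply: eq_bigr => i _.
    by rewrite raddfMn /= gcoef_superpole mulr_natl.
  by rewrite cW cZ opprB subrK subrr.
- have -> : \sum_i superpole (Z i) *: (coweight *+ l i) =
      SZ *: coweight :> 'M[sfun]_3.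
    rewrite /SZ scaler_suml; apply: eq_bigr => i _.
    by rewrite -scalerMnr scalerMnl.
  rewrite -scaler_suml -/SW -scaleNr -!scalerDl; congr (_ *: _).
  by rewrite [- SZ + SW]addrC [RHS]addrC addrA subrK addrK.
split=> [j|].
  rewrite -[RHS](bethe j); congr (_ - _).
    by apply: eq_bigr => i _; rewrite Wb.
  by apply: eq_bigr => i _; rewrite !Wb.
move: sPQ; rewrite size_P => sPQ; rewrite -(big_morph Posz PoszD (erefl _)) sPQ.
by rewrite PoszD addrC addKr.
Qed.

End FlatTrivialization.

Theorem mainTheorem2 (R : realType) (n N : nat)
    (Z : 'I_N -> superpoint R[i] n) (l : 'I_N -> nat) (loo : nat)
    (Z_distinct : injective (fun i => sp_body (Z i)))
    (tau : sOp Z l loo) (tau_nondegenerate : nondegenerate_superoper tau) :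
  exists P : chart tau -> 'M[superfun R[i] n]_3,
    [/\ miura P, coincide_at_oo P &
        forall P', miura P' -> coincide_at_oo P' -> same_reduction P P'] /\
    exists (U : 'M[superfun R[i] n]_3)
      (m : nat) (W : 'I_m -> superpoint R[i] n)
      (g : superfun R[i] n),
      H_connection P U /\
      [/\ injective (fun j => sp_body (W j)),
          forall i j, sp_body (W j) <> sp_body (Z i),
          nilp_term g &
          U = - (\sum_(i < N) superpole (Z i) *: (coweight *+ l i))
              + \sum_(j < m) superpole (W j) *: coweight
              + g *: coweight] /\
      (forall j : 'I_m,
         \sum_(i < N) (2 * l i)%N%:R / (sp_body (W j) - sp_body (Z i))
         - \sum_(s < m | s != j) 2%:R / (sp_body (W j) - sp_body (W s)) = 0) /\
      \sum_(i < N) (l i)%:Z - m%:Z = loo%:Z.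
Proof.
have [Phi Phi_flat [Phi_generic _ _]] := tau_nondegenerate.
exists (flat_reduction Phi); split.
  split; [exact: flat_reduction_miura|exact: flat_reduction_oo|].
  exact: flat_reduction_unique.
have [j0 _] := chart_ex tau.
exact: (Miura_bethe Z_distinct Phi_flat Phi_generic j0).
Qed.
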